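(* Let $(A_\Omega,B_\Omega)_{\Omega\in\mathcal O}$ be domain-uniformly exponentially stabilizable and $(A_\Omega,C_\Omega)_{\Omega\in\mathcal O}$ be domain-uniformly exponentially detectable, and assume there are constants $C_B,C_C,C_R,\alpha>0$ with $\|B_\Omega\|\le C_B$, $\|C_\Omega\|\le C_C$, $\|R_\Omega\|\le C_R$ and $\|R_\Omega u\|_{U_\Omega}^2\ge\alpha\|u\|^2_{U_\Omega}$ for all $u\in U_\Omega$ and all $\Omega\in\mathcal O$. Then there exists a constant $c>0$ such that for all $T>0$ and all $\Omega\in\mathcal O$ the solution operator $\mathcal M^{-1}$ of the optimality system satisfies $$\|\mathcal M^{-1}\|_{L(W^{1\vee2}_\Omega,W^{2\wedge\infty}_\Omega)}\le c,$$ i.e. every mild solution $z=(x,\lambda)$ of $\mathcal M z=r$ satisfies $\|z\|_{2\wedge\infty}\le c\,\|r\|_{1\vee2}$.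
   Context: $\mathcal O$ is a family of open bounded Lipschitz domains in $\mathbb R^d$. For each $\Omega\in\mathcal O$: $X_\Omega=L^2(\Omega)$, $A_\Omega$ generates a $C_0$-semigroup $(\mathcal T_\Omega(t))_{t\ge0}$ on $X_\Omega$, $U_\Omega,Y_\Omega$ Hilbert spaces, $B_\Omega\in L(U_\Omega,X_\Omega)$, $C_\Omega\in L(X_\Omega,Y_\Omega)$, $R_\Omega\in L(U_\Omega)$, $Q_\Omega=R^*_\Omega R_\Omega$. Domain-uniform notions: a family of $C_0$-semigroups $(\mathcal T_\Omega)_{\Omega\in\mathcal O}$ is domain-uniformly exponentially stable if there are $M,k>0$ with $\|\mathcal T_\Omega(t)\|_{L(X_\Omega)}\le Me^{-kt}$ for all $\Omega\in\mathcal O$, $t\ge0$. $(A_\Omega,B_\Omega)_{\Omega\in\mathcal O}$ is domain-uniformly exponentially stabilizable if there are $K^B_\Omega\in L(X_\Omega,U_\Omega)$ with $\sup_\Omega\|K^B_\Omega\|<\infty$ such that the semigroups generated by $A_\Omega+B_\Omega K^B_\Omega$ form a domain-uniformly exponentially stable family. $(A_\Omega,C_\Omega)_{\Omega\in\mathcal O}$ is domain-uniformly exponentially detectable if $(A^*_\Omega,C^*_\Omega)_{\Omega\in\mathcal O}$ is domain-uniformly exponentially stabilizable. Optimality system: $\mathcal M(x,\lambda)=(C^*Cx-\dot\lambda-A^*\lambda,\ \lambda(T),\ \dot x-Ax-BQ^{-1}B^*\lambda,\ x(0))$, understood in the mild sense: for $r=(r_1,r_2,r_3,r_4)$ with $r_1,r_3\in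 L^1(0,T;X_\Omega)$, $r_2,r_4\in X_\Omega$, $(x,\lambda)\in C(0,T;X_\Omega)^2$ solves $\mathcal M(x,\lambda)=r$ if $x(t)=\mathcal T(t)r_4+\int_0^t\mathcal T(t-s)(BQ^{-1}B^*\lambda(s)+r_3(s))ds$ and $\lambda(t)=\mathcal T(T-t)^*r_2+\int_t^T\mathcal T(s-t)^*(r_1(s)-C^*Cx(s))ds$. Norms: $\|v\|_{2\wedge\infty}=\max\{\|v\|_{L^2(0,T;X)},\|v\|_{C(0,T;X)}\}$, $\|v\|_{1\vee2}=\min\{\|v\|_{L^1(0,T;X)},\|v\|_{L^2(0,T;X)}\}$; $\|r\|_{1\vee2}=(\|r_1\|_{1\vee2}^2+\|r_2\|_X^2+\|r_3\|_{1\vee2}^2+\|r_4\|_X^2)^{1/2}$ on $W^{1\vee2}_\Omega=(L^1(0,T;X_\Omega)\times X_\Omega)^2$; $\|(x,\lambda)\|_{2\wedge\infty}=(\|x\|_{2\wedge\infty}^2+\|\lambda\|_{2\wedge\infty}^2)^{1/2}$ on $W^{2\wedge\infty}_\Omega=C(0,T;X_\Omega)^2$. *)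

(* Defs.v *)
From HB Require Import structures.
From mathcomp Require Import all_boot all_order all_algebra.
From mathcomp Require Import all_classical all_reals all_analysis.
From mathcomp Require Import Rstruct Rstruct_topology.
From Stdlib Require Import Rdefinitions.

Set Implicit Arguments.
Unset Strict Implicit.
Unset Printing Implicit Defensive.

Import Order.TTheory GRing.Theory Num.Theory.
Import numFieldNormedType.Exports.
Local Open Scope classical_set_scope.
Local Open Scope ring_scope.

Notation RR := Rdefinitions.R.

Record hilbertSpace := HilbertSpace {
  hcarrier :> completeNormedModType RR;
  inner : hcarrier -> hcarrier -> RR;
  inner_sym : forall x y, inner x y = inner y x;
  inner_linl : forall (a : RR) x y z, inner (a *: x + y) z = a * inner x z + inner y z;
  inner_norm : forall x, inner x x = `|x| ^+ 2
}.

Definition opnorm_le (X Y : hilbertSpace) (f : X -> Y) (c : RR) : Prop :=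
  forall x : X, `|f x| <= c * `|x|.

Definition bounded_linear (X Y : hilbertSpace) (f : X -> Y) : Prop :=
  linear f /\ exists c : RR, opnorm_le f c.

Definition is_adjoint (X Y : hilbertSpace) (f : X -> Y) (g : Y -> X) : Prop :=
  forall (x : X) (y : Y), inner (f x) y = inner x (g y).

Definition is_unbounded_adjoint (X : hilbertSpace)
    (D : set X) (A : X -> X) (Dstar : set X) (Astar : X -> X) : Prop :=
  (forall y : X, Dstar y <-> exists z : X, forall x, D x -> inner (A x) y = inner x z) /\
  (forall y x : X, Dstar y -> D x -> inner (A x) y = inner x (Astar y)).

Definition C0_semigroup (X : hilbertSpace) (T : RR -> X -> X) : Prop :=
  (forall t, 0 <= t -> bounded_linear (T t)) /\
  (forall x, T 0 x = x) /\
  (forall t s x, 0 <= t -> 0 <= s -> T (t + s) x = T t (T s x)) /\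
  (forall x : X, (fun t => T t x) @ 0^'+ --> x).

Definition generates (X : hilbertSpace) (T : RR -> X -> X) (D : set X) (A : X -> X) : Prop :=
  (forall x : X, D x <-> exists l : X, (fun h : RR => h^-1 *: (T h x - x)) @ 0^'+ --> l) /\
  (forall x : X, D x -> (fun h : RR => h^-1 *: (T h x - x)) @ 0^'+ --> A x).

Definition du_exp_stable (O : Type) (X : O -> hilbertSpace)
    (S : forall o, RR -> X o -> X o) : Prop :=
  exists M k : RR, 0 < M /\ 0 < k /\
    forall o (t : RR) (x : X o), 0 <= t -> `|S o t x| <= M * expR (- (k * t)) * `|x|.

Definition du_stabilizable (O : Type) (X U : O -> hilbertSpace)
    (D : forall o, set (X o)) (A : forall o, X o -> X o)
    (B : forall o, U o -> X o) : Prop :=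
  exists K : forall o, X o -> U o,
    (forall o, bounded_linear (K o)) /\
    (exists cK : RR, forall o, opnorm_le (K o) cK) /\
    exists S : forall o, RR -> X o -> X o,
      (forall o, C0_semigroup (S o)) /\
      (forall o, generates (S o) (D o) (fun x => A o x + B o (K o x))) /\
      du_exp_stable S.

Definition leb := @lebesgue_measure RR.

Definition simple_on (X : hilbertSpace) (a b : RR) (f : RR -> X) : Prop :=
  finite_set (f @` `[a, b]) /\
  forall y : X, @measurable _ (measurableTypeR RR) (`[a, b] `&` f @^-1` [set y]).

Definition strongly_measurable_on (X : hilbertSpace) (a b : RR) (f : RR -> X) : Prop :=
  exists g : nat -> RR -> X, (forall n, simple_on a b (g n)) /\
    {ae leb, forall s, s \in `[a, b] -> (fun n => g n s) @ \oo --> f s}.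

Definition L1int (X : hilbertSpace) (a b : RR) (f : RR -> X) : \bar RR :=
  (\int[leb]_(s in `[a, b]) (`|f s|)%:E)%E.

Definition L2sq (X : hilbertSpace) (a b : RR) (f : RR -> X) : \bar RR :=
  (\int[leb]_(s in `[a, b]) (`|f s| ^+ 2)%:E)%E.

Definition in_L1 (X : hilbertSpace) (a b : RR) (f : RR -> X) : Prop :=
  strongly_measurable_on a b f /\ (L1int a b f < +oo)%E.

(* ||f||_{1 v 2} = min(||f||_{L^1}, ||f||_{L^2}) (L^2 norm may be +oo) *)
Definition norm_1v2 (X : hilbertSpace) (a b : RR) (f : RR -> X) : RR :=
  if (L2sq a b f < +oo)%E
  then Num.min (fine (L1int a b f)) (Num.sqrt (fine (L2sq a b f)))
  else fine (L1int a b f).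

Definition norm_2inf (X : hilbertSpace) (a b : RR) (v : RR -> X) : RR :=
  Num.max (Num.sqrt (fine (L2sq a b v))) (sup [set `|v t| | t in `[a, b]]).

(* Bochner integrals are expressed weakly (tested against every y).    *)
Definition mild_solution (X U Y : hilbertSpace)
    (T Tstar : RR -> X -> X) (B : U -> X) (Bstar : X -> U) (C : X -> Y)
    (Cstar : Y -> X) (Qinv : U -> U) (Tf : RR)
    (r1 : RR -> X) (r2 : X) (r3 : RR -> X) (r4 : X)
    (x lam : RR -> X) : Prop :=
  {within `[0, Tf], continuous x} /\ {within `[0, Tf], continuous lam} /\
  (forall t, t \in `[0, Tf] -> forall y : X,
     inner (x t) y = inner (T t r4) y +
       Rintegral leb `[0, t]
         (fun s => inner (T (t - s) (B (Qinv (Bstar (lam s))) + r3 s)) y)) /\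
  (forall t, t \in `[0, Tf] -> forall y : X,
     inner (lam t) y = inner (Tstar (Tf - t) r2) y +
       Rintegral leb `[t, Tf]
         (fun s => inner (Tstar (s - t) (r1 s - Cstar (C (x s)))) y)).

(* Main.v *)
Require Import Defs.
From HB Require Import structures.
From mathcomp Require Import all_boot all_order all_algebra.
From mathcomp Require Import all_classical all_reals all_analysis.
From mathcomp Require Import Rstruct Rstruct_topology.
From mathcomp Require Import measurable_realfun ring lra.
Import Order.TTheory GRing.Theory Num.Theory.
Import numFieldNormedType.Exports HBNNSimple.
Local Open Scope classical_set_scope.
Local Open Scope ring_scope.

(** Testing the state equation with the costate and vice versa gives the energy
identity (by Fubini's theorem on a triangle, as solutions are only mild)
  <x(T),r2> - <lam(0),r4> = int <B Q^-1 B^* lam + r3, lam> - int <r1 - C^*C x, x>,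
so that |C x|_2^2 + |B^* lam|_2^2 is bounded by a constant times |r| |z|.
On the other hand, x also solves a mild equation for the adjoint of the
exponentially stable semigroup provided by detectability, with right-hand side
involving x only through C x; likewise the time-reversed costate involves lam
only through B^* lam for the stabilised semigroup.  Both facts follow from
Duhamel's formula for the perturbed semigroup and Fubini's theorem.  Exponential
convolution bounds, uniform in T, then give
  |z| <= c (|r| + |C x|_2 + |B^* lam|_2),
and the energy estimate absorbs the last two terms. *)

Set Implicit Arguments.
Unset Strict Implicit.
Unset Printing Implicit Defensive.

(** * Lebesgue integrals *)

(** The constant must depend neither on the horizon nor on the domain, while the semigroup [T]
    itself is only known to be bounded on bounded time intervals. Such local bounds are therefore
    used for continuity and integrability alone; every quantitative estimate goes through a stable
    semigroup. Since all integrals are tested against a vector y, the semigroup can be moved onto y.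
    In the state equation this puts the adjoint of [T] in front of y, and Duhamel's formula
    exchanges it directly for the semigroup generated by A^* + C^* K, with the error term <x, C^* K
    z> = <C x, K z>; no adjoint of that stable semigroup is ever formed. The costate is treated
    alike with [T] and A + B K. The norms fit this scheme: an exponential convolution maps both L^1
    and L^2 into both L^2 and C with bounds free of the horizon, and the two norms are dual enough
    to bound the energy terms. The absorption succeeds because the energy estimate is quadratic in
    |C x|_2 + |B^* lam|_2 but only linear in |z|. *)

Section null_sets.
Context d (T : measurableType d) (R : realType) (mu : {measure set T -> \bar R}).

Let lower_integral (f : T -> \bar R) := ereal_sup [set sintegral mu h |
  h in [set h : {nnsfun T >-> R} | forall x, ((h x)%:E <= f x)%E]].

(** Multiplying a simple function below [f] by the indicator of the complement of [N] does not
    change its integral, and puts it below [g] everywhere because [g] is nonnegative. As the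
    integral is a supremum over simple functions, this compares non-measurable integrands as
    well. *)
Let le_lower_integral_null (N : set T) (f g : T -> \bar R) :
  measurable N -> mu N = 0%E -> (forall x, 0 <= g x)%E ->
  (forall x, ~ N x -> (f x <= g x)%E) -> (lower_integral f <= lower_integral g)%E.
Proof.
move=> mN N0 g0 fg; apply: ge_ereal_sup => _ [h hf <-].
pose h' := mul_nnsfun h (indic_nnsfun R (measurableC mN)).
have h'E x : h' x = h x * \1_(~` N) x by [].
have -> : sintegral mu h = sintegral mu h'.
  rewrite -!integralT_nnsfun; apply: ge0_ae_eq_integral => //.
  - exact/measurable_EFinP/measurable_funP.
  - exact/measurable_EFinP/measurable_funP.
  - by move=> x _; rewrite lee_fin.
  - by move=> x _; rewrite lee_fin.
  - exists N; split => // x; apply: contra_notP => nNx _.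
    by rewrite h'E indicE mem_set ?mulr1.
apply: ereal_sup_ubound; exists h' => // x; rewrite h'E indicE.
have [xN|xN] := boolP (x \in ~` N).
  by rewrite mulr1; apply: (le_trans (hf x)); apply: fg; rewrite inE in xN.
by rewrite mulr0.
Qed.

(* No measurability is assumed: the integrands of a strongly measurable
   function are only Lebesgue measurable, while [leb] lives on Borel sets. *)
Lemma integral_null_eq (D N : set T) (f g : T -> \bar R) :
  measurable N -> mu N = 0%E -> (forall x, D x -> ~ N x -> f x = g x) ->
  (\int[mu]_(x in D) f x = \int[mu]_(x in D) g x)%E.
Proof.
move=> mN N0 fg.
have E x : ~ N x -> (f \_ D) x = (g \_ D) x.
  move=> Nx; rewrite !patchE; case: ifPn => // /set_mem Dx; exact: fg.
by rewrite /integral; congr (_ - _)%E; apply/eqP; rewrite eq_le; apply/andP; split;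
  apply: (le_lower_integral_null mN N0) => // x Nx; rewrite ?funeposE ?funenegE E.
Qed.

End null_sets.

(** * Reflections of an interval *)

Section reflection.
Context {R : realType}.
Local Notation mu := (@lebesgue_measure R).

Let refl (c s : R) : R := c - s.

Let measurable_refl c : measurable_fun setT (refl c : measurableTypeR R -> measurableTypeR R).
Proof. by apply: measurable_funB => //; exact: measurable_cst. Qed.

Let preimage_refl (c a b : R) :
  refl c @^-1` `[c - b, c - a] = `[a, b]%classic.
Proof.
by apply/seteqP; split => s /=; rewrite !in_itv /= /refl => /andP[? ?];
  apply/andP; split; lra.
Qed.

(** Lebesgue measure is determined by its values on the intervals ]a, b], and a reflection only
    moves the open end to the other side. *)
Let pushforward_refl c (A : set R) : measurable A ->
  pushforward mu (refl c : _ -> measurableTypeR R) A = mu A.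
Proof.
move=> mA; have mr := measurable_refl c.
apply/esym/lebesgue_measure_unique => //= _ [[a b]] _ <-; rewrite /pushforward /=.
have -> : refl c @^-1` `]a, b] = `[c - b, c - a[%classic.
  by apply/seteqP; split => s /=; rewrite !in_itv /= /refl => /andP[? ?];
    apply/andP; split; lra.
rewrite !lebesgue_measure_itv/= !lte_fin ltrD2l ltrN2; case: ifP => // _.
by rewrite -!EFinD; congr EFin; ring.
Qed.

Lemma ge0_integral_refl (c a b : R) (f : R -> \bar R) :
  measurable_fun `[c - b, c - a] f ->
  (forall s, s \in `[c - b, c - a] -> (0 <= f s)%E) ->
  (\int[mu]_(s in `[a, b]) f (c - s)%R = \int[mu]_(s in `[(c - b)%R, (c - a)%R]) f s)%E.
Proof.
move=> mf f0; rewrite -(preimage_refl c a b).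
rewrite -(@ge0_integral_pushforward _ _ _ _ _ _ (measurable_refl c)) //.
apply: eq_measure_integral => A mA _; exact: pushforward_refl.
by move=> y; rewrite inE; exact: f0.
Qed.

(** Positive and negative parts are reflected separately. This is what turns the backward costate
    equation into a forward one. *)
Lemma Rintegral_refl (c a b : R) (f : R -> R) :
  measurable_fun `[c - b, c - a] f ->
  \int[mu]_(s in `[a, b]) f (c - s) = \int[mu]_(s in `[c - b, c - a]) f s.
Proof.
move=> /measurable_EFinP mf; congr fine; rewrite integralE [RHS]integralE.
congr (_ - _)%E.
  rewrite -(@ge0_integral_refl c a b ((EFin \o f)^\+)%E) //.
  - by apply: eq_integral => s _; rewrite !funeposE.
  - exact: measurable_funepos.
rewrite -(@ge0_integral_refl c a b ((EFin \o f)^\-)%E) //.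
- by apply: eq_integral => s _; rewrite !funenegE.
- exact: measurable_funeneg.
Qed.

End reflection.

(** * Fubini's theorem on a triangle *)

Section fubini_triangle.
Context {R : realType}.
Local Notation mu := (@lebesgue_measure R).

Definition triangle (b : R) : set (R * R) :=
  [set p | [&& 0 <= p.1, p.1 <= p.2 & p.2 <= b]].

Lemma measurable_triangle b : measurable (triangle b).
Proof.
have -> : triangle b = [set p | 0 <= p.1] `&`
    ([set p | p.1 <= p.2] `&` [set p | p.2 <= b]).
  by apply/seteqP; split => p /= => [/and3P[]|[? [? ?]]]; [split|apply/and3P].
have m1 : measurable_fun setT (fst : R * R -> R) by exact: measurable_fst.
have m2 : measurable_fun setT (snd : R * R -> R) by exact: measurable_snd.
by do 2?apply: measurableI; rewrite -[X in measurable X]setTI;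
  apply: measurable_fun_le => //; exact: measurable_cst.
Qed.

Variables (b : R) (K : R -> R -> R).
Variables (F G : R -> R).
Hypotheses (mK : measurable_fun (triangle b) (fun p => K p.1 p.2))
  (iF : mu.-integrable `[0, b] (EFin \o F))
  (iG : mu.-integrable `[0, b] (EFin \o G))
  (KFG : forall r s, 0 <= r -> r <= s -> s <= b -> `|K r s| <= F r * G s).

Let Kt : R * R -> R := (fun p => K p.1 p.2) \_ (triangle b).

Let mKt : measurable_fun setT (EFin \o Kt).
Proof.
by apply/measurable_EFinP/(measurable_restrictT _ _).1 => //; exact: measurable_triangle.
Qed.

Let F' := (Num.norm \o F) \_ `[0, b].
Let G' := (Num.norm \o G) \_ `[0, b].

Let iF' : mu.-integrable setT (EFin \o F').
Proof.
rewrite -restrict_EFin.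
have /integrable_norm i := iF.
exact: ((@integrable_mkcond _ _ _ mu `[0, b] (EFin \o (Num.norm \o F)) (measurable_itv _)).1 i).
Qed.

Let iG' : mu.-integrable setT (EFin \o G').
Proof.
rewrite -restrict_EFin.
have /integrable_norm i := iG.
exact: ((@integrable_mkcond _ _ _ mu `[0, b] (EFin \o (Num.norm \o G)) (measurable_itv _)).1 i).
Qed.

Let F'_ge0 r : 0 <= F' r.
Proof. by rewrite /F' patchE; case: ifP => //= _; exact: normr_ge0. Qed.

Let G'_ge0 s : 0 <= G' s.
Proof. by rewrite /G' patchE; case: ifP => //= _; exact: normr_ge0. Qed.

Let Kt_le r s : `|Kt (r, s)| <= F' r * G' s.
Proof.
rewrite /Kt /F' /G' !patchE; case: ifPn => [/set_mem /and3P/= [r0 rs sb]|_].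
  rewrite !mem_set /=; [|by rewrite in_itv/= sb (le_trans r0)|
    by rewrite in_itv/= r0 (le_trans rs)].
  rewrite -normrM; exact: le_trans (KFG r0 rs sb) (ler_norm _).
by rewrite normr0; case: ifP => _; case: ifP => _; rewrite /= ?mulr0 ?mul0r ?mulr_ge0.
Qed.

Let iKt1 s : mu.-integrable setT (fun r => (Kt (r, s))%:E).
Proof.
apply: (@le_integrable _ _ _ mu _ measurableT _
  (fun r => ((G' s)%:E * (F' r)%:E)%E)) => //.
- exact: (measurable_fun_pair1 s mKt).
- move=> r _; rewrite -EFinM !abse_EFin lee_fin [leRHS]ger0_norm mulrC.
    exact: Kt_le.
  exact: le_trans (Kt_le _ _).
- exact: (integrableZl _ _ iF').
Qed.

Let iKt2 r : mu.-integrable setT (fun s => (Kt (r, s))%:E).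
Proof.
apply: (@le_integrable _ _ _ mu _ measurableT _
  (fun s => ((F' r)%:E * (G' s)%:E)%E)) => //.
- exact: (measurable_fun_pair2 r mKt).
- move=> s _; rewrite -EFinM !abse_EFin lee_fin [leRHS]ger0_norm; first exact: Kt_le.
  exact: le_trans (Kt_le _ _).
- exact: (integrableZl _ _ iG').
Qed.

Let iKt : (mu \x mu)%E.-integrable setT (EFin \o Kt).
Proof.
apply/(integrable12ltyP mu mu mKt).
(* The product majorant bounds the iterated integral by the product of two finite integrals, and
   Tonelli then gives integrability on the plane. *)
apply: (@le_lt_trans _ _ (\int[mu]_r ((F' r)%:E * \int[mu]_s (G' s)%:E))%E).
  apply: ge0_le_integral => //.
  - by move=> r _; apply: integral_ge0.
  - apply: (measurable_fun_fubini_tonelli_F (m2 := mu) (fun p => `|(EFin \o Kt) p|%E)) => //.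
    exact: measurableT_comp.
  - apply: emeasurable_funM => //; exact: measurable_int iF'.
  - move=> r _; rewrite -ge0_integralZl //.
    + apply: ge0_le_integral => //.
      * exact: measurableT_comp (measurable_fun_pair2 r mKt).
      * apply: emeasurable_funM => //; exact: measurable_int iG'.
      * by move=> s _; rewrite lee_fin; exact: Kt_le.
    + exact: measurable_int iG'.
    + by move=> s _; rewrite lee_fin.
    + by rewrite lee_fin.
have : (\int[mu]_s (G' s)%:E)%E \is a fin_num by exact: integrable_fin_num.
move=> /fineK <-; rewrite ltey_eq integrable_fin_num //.
under eq_fun do rewrite muleC.
exact: integrableZl.
Qed.

Let Kt_col s : s <= b ->
  (fun r => (Kt (r, s))%:E) = ((fun r => (K r s)%:E) \_ `[0%R, s])%E.
Proof.
move=> sb; apply/funext => r; rewrite /Kt !patchE.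
have -> : ((r, s) \in triangle b) = (r \in (`[0, s]%classic : set R)).
  by apply/idP/idP; rewrite !inE /triangle /= in_itv/= sb ?andbT.
by case: ifP.
Qed.

Let Kt_row r : 0 <= r ->
  (fun s => (Kt (r, s))%:E) = ((fun s => (K r s)%:E) \_ `[r, b])%E.
Proof.
move=> r0; apply/funext => s; rewrite /Kt !patchE.
have -> : ((r, s) \in triangle b) = (s \in (`[r, b]%classic : set R)).
  by apply/idP/idP; rewrite !inE /triangle /= in_itv/= r0.
by case: ifP.
Qed.

(** The kernel is extended by zero to the plane, where the majorant [F r * G s] makes it integrable;
    its sections are the two inner integrals. [Rintegral] takes finite parts inside as well, so
    every single section has to be integrable, not just almost every one. *)
Lemma Fubini_triangle :
  \int[mu]_(s in `[0, b]) (\int[mu]_(r in `[0, s]) K r s) =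
  \int[mu]_(r in `[0, b]) (\int[mu]_(s in `[r, b]) K r s).
Proof.
congr fine; rewrite integral_mkcond [RHS]integral_mkcond.
transitivity (\int[mu]_s \int[mu]_r (Kt (r, s))%:E)%E.
  apply: eq_integral => s _; rewrite patchE; case: ifPn => [/set_mem /=|sb].
    rewrite in_itv/= => /andP[s0 sb]; rewrite Kt_col // -integral_mkcond fineK //.
    by rewrite integral_mkcond -Kt_col // integrable_fin_num.
  rewrite integral0_eq // => r _; rewrite /Kt patchE; case: ifPn => // /set_mem.
  move=> /and3P/= [r0 rs sb']; move/negP: sb; case; rewrite inE /= in_itv/= sb'.
  by rewrite (le_trans r0).
rewrite -(Fubini iKt); apply/esym; apply: eq_integral => r _.
rewrite patchE; case: ifPn => [/set_mem /=|rb].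
  rewrite in_itv/= => /andP[r0 rb]; rewrite Kt_row // -integral_mkcond fineK //.
  by rewrite integral_mkcond -Kt_row // integrable_fin_num.
rewrite integral0_eq // => s _; rewrite /= /Kt patchE; case: ifPn => // /set_mem.
move=> /and3P/= [r0 rs sb]; move/negP: rb; case; rewrite inE /= in_itv/= r0.
by rewrite (le_trans rs).
Qed.

End fubini_triangle.

(** The choice l = c / a turns the hypothesis into c^2 <= a b. If a = 0, then c = 0, since otherwise
    l = (b + 1) / c would give 2 (b + 1) <= b. *)
Lemma le_sqrtM_of_le_scaled (R : rcfType) (c a b : R) : 0 <= c -> 0 <= a -> 0 <= b ->
  (forall l, 0 < l -> 2 * c <= l * a + l^-1 * b) -> c <= Num.sqrt (a * b).
Proof.
move=> c0 a0 b0 h; rewrite -(ger0_norm c0) -sqrtr_sqr ler_wsqrtr //.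
have [->|cn0] := eqVneq c 0; first by rewrite expr0n mulr_ge0.
have cp : 0 < c by rewrite lt_neqAle eq_sym cn0.
have [aE|an0] := eqVneq a 0.
  have b1 : 0 < b + 1 by rewrite ltr_wpDl.
  have := h ((b + 1) / c) (divr_gt0 b1 cp).
  rewrite aE mulr0 add0r invf_div => h'.
  have : 2 * c * (b + 1) <= c * b.
    by have := ler_wpM2r (ltW b1) h'; rewrite [leRHS]mulrAC divfK ?gt_eqF.
  by nra.
have ap : 0 < a by rewrite lt_neqAle eq_sym an0.
have := h (c / a) (divr_gt0 cp ap); rewrite divfK // invf_div => h'.
have h2 : c * c <= (a / c * b) * c by rewrite ler_pM2r //; lra.
by move: h2; rewrite [leRHS]mulrAC divfK // expr2.
Qed.

(** * Inequalities of Cauchy-Schwarz type *)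

Section integral_inequalities.
Context {R : realType}.
Local Notation mu := (@lebesgue_measure R).

(** The pointwise inequality 2 w <= l p + r / l is integrated, and l is optimised afterwards. The
    three functions leave open how a product is split into two factors, which the convolution bounds
    do in two different ways. *)
Lemma cauchy_schwarz_integral (D : set R) (w p r : R -> R) (a b : R) :
  measurable D -> measurable_fun D w -> measurable_fun D p -> measurable_fun D r ->
  (forall s, D s -> [/\ 0 <= w s, 0 <= p s, 0 <= r s & w s ^+ 2 <= p s * r s]) ->
  0 <= a -> 0 <= b ->
  (\int[mu]_(s in D) (p s)%:E <= a%:E)%E -> (\int[mu]_(s in D) (r s)%:E <= b%:E)%E ->
  (\int[mu]_(s in D) (w s)%:E <= (Num.sqrt (a * b))%:E)%E.
Proof.
move=> mD mw mp mr hD a0 b0 pa rb.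
have Zl (k : R) (f : R -> R) : 0 <= k -> measurable_fun D f ->
    (forall s, D s -> 0 <= f s) ->
    (\int[mu]_(s in D) (k%:E * (f s)%:E) = k%:E * \int[mu]_(s in D) (f s)%:E)%E.
  by move=> k0 mf f0; apply: ge0_integralZl => //; apply/measurable_EFinP.
have w0 s : D s -> 0 <= w s by move=> /hD[].
have p0 s : D s -> 0 <= p s by move=> /hD[].
have r0 s : D s -> 0 <= r s by move=> /hD[].
have le_l l : 0 < l -> (2%:E * \int[mu]_(s in D) (w s)%:E <= (l * a + l^-1 * b)%:E)%E.
  move=> l0; have li0 : 0 <= l^-1 by rewrite invr_ge0 ltW.
  rewrite -Zl //.
  apply: (@le_trans _ _ (\int[mu]_(s in D) ((l%:E * (p s)%:E) + (l^-1%:E * (r s)%:E)))%E).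
    apply: ge0_le_integral => //.
    - by move=> s Ds; rewrite -EFinM lee_fin mulr_ge0 // w0.
    - by apply/measurable_EFinP; exact: measurable_funM.
    - by apply/measurable_EFinP; apply: measurable_funD; exact: measurable_funM.
    - move=> s /hD[ws ps rs wpr]; rewrite -!EFinM -EFinD lee_fin.
      have lp : 0 <= l * p s + l^-1 * r s by rewrite addr_ge0 ?mulr_ge0 // ltW.
      rewrite -(ler_pXn2r (n := 2)) ?nnegrE ?mulr_ge0 //.
      have lE : l * l^-1 = 1 by rewrite divff ?gt_eqF.
      have : (l * p s) * (l^-1 * r s) = p s * r s by rewrite mulrACA lE mul1r.
      have := sqr_ge0 (l * p s - l^-1 * r s).
      by nra.
  rewrite ge0_integralD //.
  - rewrite EFinD !EFinM; apply: leeD.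
      rewrite Zl //; last exact: ltW.
      by rewrite lee_wpmul2l // lee_fin ltW.
    by rewrite Zl // lee_wpmul2l // lee_fin.
  - by move=> s Ds; rewrite -EFinM lee_fin mulr_ge0 ?p0 // ltW.
  - by apply/measurable_EFinP; exact: measurable_funM.
  - by move=> s Ds; rewrite -EFinM lee_fin mulr_ge0 ?r0.
  - by apply/measurable_EFinP; exact: measurable_funM.
have iw0 : (0 <= \int[mu]_(s in D) (w s)%:E)%E.
  by apply: integral_ge0 => s Ds; rewrite lee_fin w0.
(* The inequality with l = 1 already shows finiteness. *)
have wfin : (\int[mu]_(s in D) (w s)%:E)%E \is a fin_num.
  rewrite ge0_fin_numE //.
  apply: (@le_lt_trans _ _ (2%:E * \int[mu]_(s in D) (w s)%:E)%E).
    by rewrite -{1}[X in (X <= _)%E]mul1e lee_wpmul2r // lee_fin ler1n.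
  by apply: le_lt_trans (le_l 1 ltr01) _; rewrite ltry.
move: le_l iw0; rewrite -(fineK wfin) lee_fin => le_l iw0; rewrite lee_fin.
apply: (le_sqrtM_of_le_scaled iw0 a0 b0) => l l0.
by have := le_l l l0; rewrite -EFinM lee_fin.
Qed.

Lemma integral_FTC2 (f F : R -> R) (a b : R) : a <= b ->
  continuous f -> continuous F ->
  (forall s, a < s < b -> is_derive s 1 F (f s)) ->
  (\int[mu]_(s in `[a, b]) (f s)%:E = (F b - F a)%:E)%E.
Proof.
rewrite le_eqVlt => /orP[/eqP <- _ _ _|ab cf cF dF].
  by rewrite set_itv1 integral_set1 subrr.
rewrite (@continuous_FTC2 _ f F) ?EFinB //.
- exact: continuous_subspaceT.
- split.
  + by move=> s; rewrite in_itv/= => /dF[].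
  + exact/cvg_at_right_filter/cF.
  + exact/cvg_at_left_filter/cF.
- by move=> s; rewrite in_itv/= derive1E => /dF[].
Qed.

Lemma continuous_expR_affine (a b : R) : continuous (fun s => expR (a + b * s)).
Proof.
move=> s; apply: continuous_comp; last exact: continuous_expR.
by apply: cvgD; [exact: cvg_cst|apply: cvgMr; exact: cvg_id].
Qed.

Lemma is_derive_expR_affine (a b s : R) :
  is_derive s 1 (fun s => expR (a + b * s)) (b * expR (a + b * s)).
Proof.
by apply: is_derive_eq; rewrite add0r mul1r mulrC; congr (_ * _); exact: mulr1.
Qed.

Lemma integral_expR_affine_le (a b x y : R) : x <= y -> b != 0 ->
  (\int[mu]_(s in `[x, y]) (expR (a + b * s)%R)%:E =
    ((expR (a + b * y) - expR (a + b * x)) / b)%:E)%E.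
Proof.
move=> xy b0; pose F s := b^-1 * expR (a + b * s).
have cF : continuous F by move=> s; apply: cvgMr; exact: continuous_expR_affine.
have dF s : x < s < y -> is_derive s 1 F (expR (a + b * s)).
  move=> _; have d := is_derive_expR_affine a b s.
  by apply: is_derive_eq; rewrite /GRing.scale /= mulKf.
rewrite (integral_FTC2 xy (@continuous_expR_affine a b) cF dF).
by congr EFin; rewrite -mulrBr mulrC.
Qed.

(** The bound does not grow with t. Together with its mirror image below, this is the source of all
    constants that are independent of the horizon. *)
Lemma integral_expR_left (c t : R) : 0 < c -> 0 <= t ->
  (\int[mu]_(s in `[0%R, t]) (expR (- (c * (t - s)))%R)%:E <= c^-1%:E)%E.
Proof.
move=> c0 t0.
have E s : expR (- (c * (t - s))) = expR (- (c * t) + c * s).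
  by congr expR; ring.
under eq_integral do rewrite E.
rewrite integral_expR_affine_le ?gt_eqF // lee_fin ler_pdivrMr // mulVf ?gt_eqF //.
by rewrite addNr exp.expR0 lerBlDr lerDl expR_ge0.
Qed.

Lemma integral_expR_right (c s T : R) : 0 < c -> s <= T ->
  (\int[mu]_(t in `[s, T]) (expR (- (c * (t - s)))%R)%:E <= c^-1%:E)%E.
Proof.
move=> c0 sT.
have E t : expR (- (c * (t - s))) = expR (c * s + - c * t).
  by congr expR; ring.
under eq_integral do rewrite E.
rewrite integral_expR_affine_le ?oppr_eq0 ?gt_eqF // lee_fin invrN mulrN -mulNr opprB.
rewrite ler_pdivrMr // mulVf ?gt_eqF // mulNr addrN exp.expR0.
by rewrite lerBlDr lerDl expR_ge0.
Qed.

Lemma measurable_expR_gap (c t : R) (D : set R) :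
  measurable_fun D (fun s => expR (- (c * (t - s)))).
Proof.
have -> : (fun s => expR (- (c * (t - s)))) = (fun s => expR (- (c * t) + c * s)).
  by apply/funext => s; congr expR; ring.
apply: measurable_funTS; apply: continuous_measurable_fun; exact: continuous_expR_affine.
Qed.

(** * Convolution with a decaying exponential *)

Section exponential_convolution.
Variables (c T : R) (q : R -> R).
Hypotheses (c0 : 0 < c) (mq : measurable_fun `[0, T] q)
  (q0 : forall s, s \in `[0, T] -> 0 <= q s).

Let g (p : R * R) : R := expR (- (c * (p.2 - p.1))) * q p.1.
Let h : R * R -> R := g \_ (triangle T).

Let h0 p : 0 <= h p.
Proof.
rewrite /h patchE; case: ifPn => // /set_mem /and3P[p1 p12 p2]; rewrite /g.
by rewrite mulr_ge0 ?expR_ge0 // q0 // in_itv/= p1 (le_trans p12).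
Qed.

Let mh : measurable_fun setT (EFin \o h).
Proof.
apply/measurable_EFinP.
have mtr : measurable (triangle T) by exact: measurable_triangle.
suff mg : measurable_fun (triangle T) g by exact: ((measurable_restrictT g mtr).1 mg).
rewrite /g.
have m1 : measurable_fun setT (fst : R * R -> R) by exact: measurable_fst.
have m2 : measurable_fun setT (snd : R * R -> R) by exact: measurable_snd.
have me : measurable_fun setT (fun p : R * R => expR (- (c * (p.2 - p.1)))).
  have mx : measurable_fun setT (fun x : R => expR (0 + (- c) * x)).
    by apply: continuous_measurable_fun; exact: continuous_expR_affine.
  have -> : (fun p : R * R => expR (- (c * (p.2 - p.1)))) =
      (fun x : R => expR (0 + (- c) * x)) \o (fun p : R * R => p.2 - p.1).
    by apply/funext => p /=; congr expR; ring.
  exact: (measurableT_comp mx (measurable_funB m2 m1)).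
apply: measurable_funM; first exact: (measurable_funS measurableT (@subsetT _ _) me).
apply: (measurable_comp (measurable_itv `[0, T]) _ mq).
  by move=> _ [p /and3P[p1 p12 p2] <-]; rewrite /= in_itv/= p1 (le_trans p12).
exact: (measurable_funS measurableT (@subsetT _ _) m1).
Qed.

Let hc t : t <= T -> (fun s => (h (s, t))%:E) =
    ((fun s => (expR (- (c * (t - s)))%R * q s)%:E) \_ `[0%R, t])%E.
Proof.
move=> tT; apply/funext => s; rewrite /h !patchE.
have -> : ((s, t) \in triangle T) = (s \in (`[0, t]%classic : set R)).
  by apply/idP/idP; rewrite !inE /triangle /= in_itv/= tT ?andbT.
by case: ifP.
Qed.

Let hr s : 0 <= s -> (fun t => (h (s, t))%:E) =
    ((fun t => (expR (- (c * (t - s)))%R * q s)%:E) \_ `[s, T])%E.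
Proof.
move=> s0; apply/funext => t; rewrite /h !patchE.
have -> : ((s, t) \in triangle T) = (t \in (`[s, T]%classic : set R)).
  by apply/idP/idP; rewrite !inE /triangle /= in_itv/= s0.
by case: ifP.
Qed.

Lemma measurable_convolution : measurable_fun `[0, T]
  (fun t => \int[mu]_(s in `[0%R, t]) (expR (- (c * (t - s))) * q s)%:E)%E.
Proof.
apply: (eq_measurable_fun (fun t => \int[mu]_s (h (s, t))%:E)%E).
  move=> t /set_mem; rewrite /= in_itv/= => /andP[t0 tT].
  by rewrite hc // -integral_mkcond.
by apply: measurable_funTS; exact: (measurable_fun_fubini_tonelli_G (m1 := mu) _ mh).
Qed.

(** Young's inequality in L^1: by Tonelli on the triangle the exponential is integrated first, over
    t in [s, T], and contributes at most 1 / c. *)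
Lemma integral_convolution_le :
  (\int[mu]_(t in `[0%R, T]) \int[mu]_(s in `[0%R, t]) (expR (- (c * (t - s))) * q s)%:E
    <= c^-1%:E * \int[mu]_(s in `[0%R, T]) (q s)%:E)%E.
Proof.
apply: (@le_trans _ _ (\int[mu]_t \int[mu]_s (h (s, t))%:E)%E).
  rewrite integral_mkcond; apply: ge0_le_integral => //.
  - move=> t _; rewrite patchE; case: ifPn => // /set_mem; rewrite /= in_itv/= => /andP[t0 tT].
    apply: integral_ge0 => s; rewrite /= in_itv/= => /andP[s0 st].
    by rewrite lee_fin mulr_ge0 ?expR_ge0 // q0 // in_itv/= s0 (le_trans st).
  - by apply: ((measurable_restrictT _ (measurable_itv _)).1 measurable_convolution).
  - exact: (measurable_fun_fubini_tonelli_G (m1 := mu) _ mh).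
  - move=> t _; rewrite patchE; case: ifPn => [/set_mem|_].
      by rewrite /= in_itv/= => /andP[t0 tT]; rewrite hc // -integral_mkcond.
    by apply: integral_ge0 => s _; rewrite lee_fin.
rewrite -(fubini_tonelli (m1 := mu) (m2 := mu) (EFin \o h)) //.
have mqE : measurable_fun `[0%R, T] (fun s => (q s)%:E) by exact/measurable_EFinP.
rewrite -ge0_integralZl //; last by rewrite lee_fin invr_ge0 ltW.
rewrite [leRHS]integral_mkcond; apply: ge0_le_integral => //.
- by move=> s _; apply: integral_ge0 => t _; rewrite lee_fin.
- exact: (measurable_fun_fubini_tonelli_F (m2 := mu) _ mh).
- apply: ((measurable_restrictT _ (measurable_itv _)).1 _).
  exact: emeasurable_funM.
move=> s _; rewrite patchE; case: ifPn => [/set_mem|sT].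
  rewrite /= in_itv/= => /andP[s0 sT]; rewrite hr // -integral_mkcond.
  under eq_integral do rewrite EFinM.
  have qs : (0 <= (q s)%:E)%E by rewrite lee_fin q0 // in_itv/= s0.
  have me : measurable_fun `[s, T] (fun t => (expR (- (c * (t - s))))%:E).
    apply/measurable_EFinP.
    have -> : (fun t => expR (- (c * (t - s)))) = (fun t => expR (c * s + - c * t)).
      by apply/funext => t; congr expR; ring.
    by apply: measurable_funTS; apply: continuous_measurable_fun; exact: continuous_expR_affine.
  rewrite ge0_integralZr //; first by apply: lee_wpmul2r => //; exact: integral_expR_right.
rewrite integral0_eq // => t _; rewrite /= /h patchE; case: ifPn => // /set_mem.
move=> /and3P/= [s0 st tT]; move/negP: sT; case; rewrite inE /= in_itv/= s0.
by rewrite (le_trans st).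
Qed.

End exponential_convolution.

Definition convolution (k : R) (q : R -> R) (t : R) : R :=
  \int[mu]_(s in `[0, t]) (expR (- (k * (t - s))) * q s).

Lemma convolution_ge0 (k T : R) (q : R -> R) (t : R) : (forall s, s \in `[0, T] -> 0 <= q s) -> t <= T ->
  0 <= convolution k q t.
Proof.
move=> q0 tT; apply: Rintegral_ge0 => s; rewrite /= in_itv/= => /andP[s0 st].
by rewrite mulr_ge0 ?expR_ge0 // q0 // in_itv/= s0 (le_trans st).
Qed.

Lemma measurable_convolution_fine (k T : R) (q : R -> R) : 0 < k -> measurable_fun `[0, T] q ->
  (forall s, s \in `[0, T] -> 0 <= q s) -> measurable_fun `[0, T] (convolution k q).
Proof.
move=> k0 mq q0.
have -> : convolution k q = fine \o
    (fun t => \int[mu]_(s in `[0%R, t]) (expR (- (k * (t - s))) * q s)%:E)%E by [].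
apply: measurableT_comp; first exact: fine_measurable.
exact: measurable_convolution.
Qed.

(** Cauchy-Schwarz gives (convolution)^2 <= a chi, where chi is the convolution of p with the
    exponential of rate c. Bounding chi pointwise by P yields the sup bound; bounding its integral
    by P / c yields the L^2 bound. *)
Let convolution_bound_aux (k c T a P : R) (q p : R -> R) (p1 : R -> R -> R) :
  0 < k -> 0 < c -> 0 <= a -> 0 <= P ->
  measurable_fun `[0, T] q -> measurable_fun `[0, T] p ->
  (forall s, s \in `[0, T] -> 0 <= q s) -> (forall s, s \in `[0, T] -> 0 <= p s) ->
  (forall t, t \in `[0, T] -> [/\ measurable_fun `[0, t] (p1 t),
    (forall s, s \in `[0, t] -> 0 <= p1 t s) &
    (\int[mu]_(s in `[0%R, t]) (p1 t s)%:E <= a%:E)%E]) ->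
  (forall t s, (expR (- (k * (t - s))) * q s) ^+ 2 =
    p1 t s * (expR (- (c * (t - s))) * p s)) ->
  (\int[mu]_(s in `[0%R, T]) (p s)%:E <= P%:E)%E ->
  (forall t, t \in `[0, T] -> convolution k q t <= Num.sqrt (a * P)) /\
  (\int[mu]_(t in `[0%R, T]) (convolution k q t ^+ 2)%:E <= (a * (c^-1 * P))%:E)%E.
Proof.
move=> k0 c0 a0 P0 mq mp q0 p0 hp1 hqp pP.
pose chi t := (\int[mu]_(s in `[0%R, t]) (expR (- (c * (t - s))) * p s)%:E)%E.
have sub t : t \in `[0, T] -> (`[0, t] `<=` `[0, T])%classic.
  rewrite in_itv/= => /andP[t0 tT] s; rewrite /= !in_itv/= => /andP[-> st].
  exact: le_trans st tT.
have mE l f t : t \in `[0, T] -> measurable_fun `[0, T] f ->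
    measurable_fun `[0, t] (fun s => expR (- (l * (t - s))) * f s).
  move=> tT mf; apply: measurable_funM; first exact: measurable_expR_gap.
  exact: measurable_funS (sub _ tT) mf.
have chi0 t : t \in `[0, T] -> (0 <= chi t)%E.
  move=> tT; apply: integral_ge0 => s /(sub _ tT) sT.
  by rewrite lee_fin mulr_ge0 ?expR_ge0 ?p0.
have chiP t : t \in `[0, T] -> (chi t <= P%:E)%E.
  move=> tT; apply: le_trans pP.
  apply: (@le_trans _ _ (\int[mu]_(s in `[0%R, t]) (p s)%:E)%E).
    apply: ge0_le_integral => //.
    - by move=> s /(sub _ tT) sT; rewrite lee_fin mulr_ge0 ?expR_ge0 ?p0.
    - by apply/measurable_EFinP; exact: mE.
    - by apply/measurable_EFinP; exact: measurable_funS (sub _ tT) mp.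
    - move=> s st; rewrite lee_fin ler_piMl ?p0 ?(sub _ tT) //.
      rewrite -[leRHS]exp.expR0 ler_expR oppr_le0 mulr_ge0 ?(ltW c0) // subr_ge0.
      by move: st; rewrite /= in_itv/= => /andP[].
  apply: ge0_subset_integral => //; [exact/measurable_EFinP|exact: sub].
have chif t : t \in `[0, T] -> chi t \is a fin_num.
  move=> tT; rewrite ge0_fin_numE ?chi0 //.
  by apply: le_lt_trans (chiP _ tT) _; rewrite ltry.
have conv_le t : t \in `[0, T] -> convolution k q t <= Num.sqrt (a * fine (chi t)).
  move=> tT; have [mp1 p10 p1a] := hp1 t tT.
  have le1 : (\int[mu]_(s in `[0%R, t]) (expR (- (k * (t - s))) * q s)%:E
      <= (Num.sqrt (a * fine (chi t)))%:E)%E.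
    apply: (@cauchy_schwarz_integral _ _ (p1 t) (fun s => expR (- (c * (t - s))) * p s)) => //.
    - exact: mE.
    - exact: mE.
    - move=> s st; have sT := sub _ tT s st.
      by split; rewrite ?mulr_ge0 ?expR_ge0 ?q0 ?p0 ?p10 // hqp.
    - by rewrite fine_ge0 ?chi0.
    - by rewrite fineK ?chif.
  rewrite -lee_fin /convolution /Rintegral fineK // ge0_fin_numE.
    by apply: le_lt_trans le1 _; rewrite ltry.
  by apply: integral_ge0 => s /(sub _ tT) sT; rewrite lee_fin mulr_ge0 ?expR_ge0 ?q0.
split=> [t tT|].
  apply: le_trans (conv_le t tT) _; rewrite ler_wsqrtr // ler_wpM2l //.
  by rewrite -lee_fin fineK ?chif ?chiP.
apply: (@le_trans _ _ (\int[mu]_(t in `[0%R, T]) (a%:E * chi t))%E).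
  apply: ge0_le_integral => //.
  - by move=> t tT; rewrite lee_fin sqr_ge0.
  - by apply/measurable_EFinP; apply: measurable_funX; exact: measurable_convolution_fine.
  - apply: emeasurable_funM => //; exact: measurable_convolution.
  - move=> t tT; have /fineK <- := chif t tT; rewrite -EFinM lee_fin.
    have ac : 0 <= a * fine (chi t) by rewrite mulr_ge0 // fine_ge0 ?chi0.
    rewrite -(sqr_sqrtr ac) ler_pXn2r ?nnegrE ?sqrtr_ge0 ?conv_le //.
    apply: (@convolution_ge0 _ T) => //.
    by move: tT; rewrite /= in_itv/= => /andP[].
rewrite ge0_integralZl //.
- rewrite !EFinM; apply: lee_wpmul2l; first by rewrite lee_fin.
  apply: le_trans (integral_convolution_le c0 mp p0) _.
  by apply: lee_wpmul2l; rewrite ?lee_fin ?invr_ge0 // ltW.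
- exact: measurable_convolution.
Qed.

(* For [q] in L^1 apply Cauchy-Schwarz to [q^(1/2) * (e^(-k .) q^(1/2))], for
   [q] in L^2 to [e^(-k ./2) * (e^(-k ./2) q)]. *)
Lemma convolution_bounds (k T Q : R) (q : R -> R) : 0 < k -> 0 <= Q ->
  measurable_fun `[0, T] q -> (forall s, s \in `[0, T] -> 0 <= q s) ->
  (\int[mu]_(s in `[0%R, T]) (q s)%:E <= Q%:E)%E \/
    (\int[mu]_(s in `[0%R, T]) (q s ^+ 2)%:E <= (Q ^+ 2)%:E)%E ->
  (forall t, t \in `[0, T] -> convolution k q t <= (1 + k^-1) * Q) /\
  (\int[mu]_(t in `[0%R, T]) (convolution k q t ^+ 2)%:E <=
    (((1 + k^-1) * Q) ^+ 2)%:E)%E.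
Proof.
move=> k0 Q0 mq q0 qQ; have ki0 : 0 < k^-1 by rewrite invr_gt0.
have eM (c : R) u : expR (- (c * u)) * expR (- (c * u)) = expR (- (2 * c * u)).
  by rewrite -exp.expRD; congr expR; ring.
suff [a [c [P [[a0 c0 P0] aP acP [p [p1 [mp p0 hp1 hqp pP]]]]]]] :
    exists (a c P : R), [/\ [/\ 0 <= a, 0 < c & 0 <= P], a * P <= ((1 + k^-1) * Q) ^+ 2,
      a * (c^-1 * P) <= ((1 + k^-1) * Q) ^+ 2 & exists (p : R -> R) (p1 : R -> R -> R),
  [/\ measurable_fun `[0, T] p, (forall s, s \in `[0, T] -> 0 <= p s),
  (forall t, t \in `[0, T] -> [/\ measurable_fun `[0, t] (p1 t),
    (forall s, s \in `[0, t] -> 0 <= p1 t s) &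
    (\int[mu]_(s in `[0%R, t]) (p1 t s)%:E <= a%:E)%E]),
  (forall t s, (expR (- (k * (t - s))) * q s) ^+ 2 =
    p1 t s * (expR (- (c * (t - s))) * p s)) &
  (\int[mu]_(s in `[0%R, T]) (p s)%:E <= P%:E)%E]].
  have [h1 h2] := convolution_bound_aux k0 c0 a0 P0 mq mp q0 p0 hp1 hqp pP.
  split=> [t tT|]; last by apply: le_trans h2 _; rewrite lee_fin.
  apply: le_trans (h1 t tT) _; have Qk : 0 <= (1 + k^-1) * Q by rewrite mulr_ge0 // addr_ge0 // ltW.
  by rewrite -[leRHS](ger0_norm Qk) -sqrtr_sqr ler_wsqrtr.
(* The quantities a P and a P / c are Q^2 and Q^2 / (2 k) in the first case, Q^2 / k and Q^2 / k^2
   in the second; the square of (1 + 1 / k) Q dominates all four. *)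
case: qQ => qQ.
  exists Q, (2 * k), Q; split; first by rewrite mulr_gt0.
  - by rewrite expr2; nra.
  - by rewrite invfM; nra.
  exists q, (fun _ => q); split=> //.
  - move=> t; rewrite in_itv/= => /andP[t0 tT].
    have sub : (`[0, t] `<=` `[0, T])%classic.
      by move=> s; rewrite /= !in_itv/= => /andP[-> st]; exact: le_trans st tT.
    split; [exact: measurable_funS sub mq|by move=> s /sub/q0|].
    apply: le_trans qQ; apply: ge0_subset_integral => //; exact/measurable_EFinP.
  - by move=> t s; rewrite expr2 mulrACA eM; ring.
exists k^-1, k, (Q ^+ 2); split; first by rewrite sqr_ge0 ltW.
- by have := sqr_ge0 Q; nra.
- by have := sqr_ge0 Q; nra.
exists (fun s => q s ^+ 2), (fun t s => expR (- (k * (t - s)))); split=> //.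
- exact: measurable_funX.
- by move=> s _; exact: sqr_ge0.
- move=> t; rewrite in_itv/= => /andP[t0 tT].
  split; [exact: measurable_expR_gap|by move=> s _; exact: expR_ge0|].
  exact: integral_expR_left.
- by move=> t s; rewrite !expr2; ring.
Qed.

End integral_inequalities.

(** * Hilbert spaces and bounded operators *)

Lemma lipschitz_continuous (V W : normedModType RR) (f : V -> W) (c : RR) :
  (forall x y, `|f x - f y| <= c * `|x - y|) -> continuous f.
Proof.
move=> h x; apply/cvgrPdist_lt => e e0; have c1 : 0 < `|c| + 1 by rewrite ltr_wpDl.
have : \forall t \near x, `|x - t| < e / (`|c| + 1).
  by apply: cvgr_dist_lt; [exact: cvg_id|exact: divr_gt0].
apply: filterS => t; rewrite ltr_pdivlMr // => h'; apply: le_lt_trans (h _ _) _.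
apply: le_lt_trans h'; rewrite mulrC ler_wpM2l //.
by have := ler_norm c; lra.
Qed.

Section hilbert.
Variable X : hilbertSpace.
Implicit Types x y z : X.

Lemma innerDl x y z : inner (x + y) z = inner x z + inner y z.
Proof. by have := inner_linl 1 x y z; rewrite scale1r mul1r. Qed.

Lemma inner0l z : inner 0 z = 0 :> RR.
Proof. by apply: (addrI (inner (0 : X) z)); rewrite -innerDl !addr0. Qed.

Lemma innerZl a x z : inner (a *: x) z = a * inner x z.
Proof. by have := inner_linl a x 0 z; rewrite !addr0 inner0l addr0. Qed.

Lemma innerNl x z : inner (- x) z = - inner x z.
Proof. by rewrite -scaleN1r innerZl mulN1r. Qed.

Lemma innerBl x y z : inner (x - y) z = inner x z - inner y z.
Proof. by rewrite innerDl innerNl. Qed.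

Lemma innerDr x y z : inner z (x + y) = inner z x + inner z y.
Proof. by rewrite !(inner_sym z) innerDl. Qed.

Lemma innerZr a x z : inner z (a *: x) = a * inner z x.
Proof. by rewrite !(inner_sym z) innerZl. Qed.

Lemma innerBr x y z : inner z (x - y) = inner z x - inner z y.
Proof. by rewrite !(inner_sym z) innerBl. Qed.

Lemma inner0r z : inner z 0 = 0 :> RR.
Proof. by rewrite inner_sym inner0l. Qed.

Lemma normD_sqr x y : `|x + y| ^+ 2 = `|x| ^+ 2 + 2 * inner x y + `|y| ^+ 2.
Proof. rewrite -!inner_norm innerDl !innerDr (inner_sym y x); ring. Qed.

(** Expand the squared norm of |y| x + |x| y and of |y| x - |x| y. *)
Lemma cauchy_schwarz x y : `|inner x y| <= `|x| * `|y|.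
Proof.
have h (a b : RR) : 0 <= a ^+ 2 * `|x| ^+ 2 + 2 * (a * b) * inner x y + b ^+ 2 * `|y| ^+ 2.
  have := normD_sqr (a *: x) (b *: y); rewrite innerZl innerZr => E.
  have := sqr_ge0 `|a *: x + b *: y|; rewrite E -!inner_norm.
  by rewrite !innerZl !innerZr !inner_norm; congr (0 <= _); ring.
have nx := normr_ge0 x; have ny := normr_ge0 y.
have [x0|xn0] := eqVneq `|x| 0.
  by move/normr0_eq0: (x0) => ->; rewrite inner0l !normr0 mul0r.
have [y0|yn0] := eqVneq `|y| 0.
  by move/normr0_eq0: (y0) => ->; rewrite inner0r !normr0 mulr0.
have xp : 0 < `|x| by rewrite lt_neqAle eq_sym xn0.
have yp : 0 < `|y| by rewrite lt_neqAle eq_sym yn0.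
rewrite ler_norml; apply/andP; split.
  have := h `|y| `|x|; set c := inner x y => hh.
  have : 0 <= 2 * (`|x| * `|y|) * (`|x| * `|y| + c) by move: hh; congr (0 <= _); ring.
  by rewrite pmulr_rge0 ?mulr_gt0 // => ?; lra.
have := h `|y| (- `|x|); set c := inner x y => hh.
have : 0 <= 2 * (`|x| * `|y|) * (`|x| * `|y| - c) by move: hh; congr (0 <= _); ring.
by rewrite pmulr_rge0 ?mulr_gt0 // => ?; lra.
Qed.

(** Take z = x. Norm bounds for vectors that are known only through their inner products are
    obtained in this way. *)
Lemma norm_le_inner x (c : RR) : 0 <= c -> (forall z, inner x z <= c * `|z|) -> `|x| <= c.
Proof.
move=> c0 h; have := h x; rewrite inner_norm expr2.
have [->|xn0] := eqVneq `|x| 0; first by [].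
have xp : 0 < `|x| by rewrite lt_neqAle eq_sym xn0 normr_ge0.
by rewrite ler_pM2r.
Qed.

Lemma inner_inj x y : (forall z, inner x z = inner y z) -> x = y.
Proof.
move=> h; apply/eqP; rewrite -subr_eq0 -normr_le0; apply: norm_le_inner => // z.
by rewrite innerBl h subrr mul0r.
Qed.

(** Polarisation reduces the claim to the continuity of addition and of the norm. *)
Lemma cvg_inner (I : Type) (F : set_system I) (FF : Filter F) (f g : I -> X) x y :
  f @ F --> x -> g @ F --> y -> (fun i => inner (f i) (g i)) @ F --> inner x y.
Proof.
move=> fx gy.
have E : (fun i => inner (f i) (g i)) =
    (fun i => 2^-1 * (`|f i + g i| ^+ 2 - `|f i| ^+ 2 - `|g i| ^+ 2)).
  by apply/funext => i; rewrite normD_sqr; field.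
have -> : inner x y = 2^-1 * (`|x + y| ^+ 2 - `|x| ^+ 2 - `|y| ^+ 2).
  by rewrite normD_sqr; field.
rewrite E; apply: cvgMr; apply: cvgB; first apply: cvgB.
- by rewrite expr2; apply: cvgM; apply: cvg_norm; apply: cvgD.
- by rewrite expr2; apply: cvgM; apply: cvg_norm.
- by rewrite expr2; apply: cvgM; apply: cvg_norm.
Qed.

(** Written with the midpoint, in the form that makes minimising sequences Cauchy. *)
Lemma parallelogram x y :
  `|x - y| ^+ 2 = 2 * `|x| ^+ 2 + 2 * `|y| ^+ 2 - 4 * `|2^-1 *: (x + y)| ^+ 2.
Proof.
rewrite -!inner_norm innerZl innerZr innerBl !innerBr innerDl !innerDr (inner_sym y x).
by field.
Qed.

(* The minimiser of [|x|^2 - 2 phi x]. *)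
Lemma riesz (phi : X -> RR) (c : RR) :
  (forall a x y, phi (a *: x + y) = a * phi x + phi y) ->
  (forall x, `|phi x| <= c * `|x|) -> exists z, forall x, phi x = inner x z.
Proof.
move=> phil phic.
have phi0 : phi 0 = 0 by apply/eqP; rewrite -normr_le0; have := phic 0; rewrite normr0 mulr0.
have phiD x y : phi (x + y) = phi x + phi y by have := phil 1 x y; rewrite scale1r mul1r.
have phiZ a x : phi (a *: x) = a * phi x by have := phil a x 0; rewrite !addr0 phi0 addr0.
have phiB x y : phi (x - y) = phi x - phi y by rewrite phiD -scaleN1r phiZ mulN1r.
pose J x := `|x| ^+ 2 - 2 * phi x.
pose E := [set J x | x in setT].
have Elb : has_inf E.
  split; first by exists (J 0), 0.
  exists (- c ^+ 2) => _ [x _ <-]; rewrite /J.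
  have q (R : realFieldType) (n p l : R) : p <= l * n -> - l ^+ 2 <= n ^+ 2 - 2 * p.
    by move=> pn; have := sqr_ge0 (n - l); rewrite sqrrB => h; lra.
  by apply: q; apply: le_trans (ler_norm _) (phic x).
pose d := inf E.
have dJ x : d <= J x by apply: ge_inf; [exact: Elb.2|exists x].
have /choice[u uP] : forall n : nat, exists x, J x < d + n.+1%:R^-1.
  move=> n; have n0 : 0 < n.+1%:R^-1 :> RR by rewrite invr_gt0.
  by have [_ [x _ <-] h] := inf_adherent n0 Elb; exists x.
(* The linear parts of J at the two points and at their midpoint cancel in the parallelogram
   identity, and J at the midpoint is at least d. *)
have uu m n : `|u m - u n| ^+ 2 <= 2 * m.+1%:R^-1 + 2 * n.+1%:R^-1.
  have := dJ (2^-1 *: (u m + u n)); have := uP m; have := uP n.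
  rewrite parallelogram /J phiZ phiD.
  set mid := `|2^-1 *: _| ^+ 2; set im := m.+1%:R^-1; set i_n := n.+1%:R^-1.
  by move: mid im i_n (phi (u m)) (phi (u n)) => mid im i_n pm pn; lra.
have ucv : cauchy (u @ \oo).
  apply: cauchy_exP => e e0.
  have e2 : 0 < e ^+ 2 / 4 by rewrite divr_gt0 // exprn_gt0.
  have [N _ hN] := near_infty_natSinv_lt (PosNum e2).
  exists (u N); exists N => // n /= Nn; rewrite -ball_normE /=.
  have := uu N n; have := hN N (leqnn N); have := hN n Nn => /= h1 h2 h3.
  rewrite -(ltr_pXn2r (n := 2)) ?nnegrE ?normr_ge0 ?ltW //.
  apply: le_lt_trans h3 _; move: h1 h2; move: N.+1%:R^-1 n.+1%:R^-1 => a b ? ?.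
  by lra.
have [z uz] : exists z, u @ \oo --> z.
  by exists (lim (u @ \oo)); apply: cauchy_cvg.
have cphi : phi \o u @ \oo --> phi z.
  have cp : continuous phi by apply: (@lipschitz_continuous X RR^o phi c) => x y; rewrite -phiB.
  exact: (cvg_comp _ _ uz (cp z)).
have Jz : J z <= d.
  have J1 : J \o u @ \oo --> J z.
    apply: cvgB; last by apply: cvgMr.
    by rewrite expr2; apply: cvgM; apply: cvg_norm.
  have J2 : (fun n : nat => (d + n.+1%:R^-1 : RR)) @ \oo --> d + 0.
    have h1 : (fun n : nat => n.+1%:R^-1 : RR) @ \oo --> (0 : RR) by exact: (@cvg_harmonic RR).
    have h2 : (fun n : nat => d : RR) @ \oo --> (d : RR) by exact: cvg_cst.
    exact: (@cvgD _ RR^o _ _ _ _ _ _ _ h2 h1).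
  rewrite -(addr0 d); apply: (ler_cvg_to J1 J2).
  by apply: nearW => n; exact/ltW/uP.
exists z => x.
have h t : 0 <= t ^+ 2 * `|x| ^+ 2 + 2 * t * (inner x z - phi x).
  have := dJ (z + t *: x); rewrite /J normD_sqr normrZ exprMn real_normK ?num_real //.
  rewrite innerZr phiD phiZ (inner_sym z).
  by move: Jz; rewrite /J; lra.
suff : inner x z - phi x = 0 by lra.
set b := inner x z - phi x in h *.
have q (R : realFieldType) (a t : R) : 0 <= a ->
    0 <= t ^+ 2 * a + 2 * t * (- (t * (a + 1))) -> t ^+ 2 <= 0 by nra.
have a0 : 0 <= `|x| ^+ 2 by exact: sqr_ge0.
set a := `|x| ^+ 2 in h a0.
have a1 : a + 1 != 0 by rewrite gt_eqF // ltr_wpDl.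
(* With b = - t (a + 1) the variation inequality becomes 0 <= - t^2 (a + 2), hence t = 0 and b = 0.
   Adding 1 to a avoids a division by zero when x = 0. *)
have := h (- b / (a + 1)); set t := - b / (a + 1).
have -> : b = - (t * (a + 1)) by rewrite /t divfK // opprK.
move=> /(q _ _ _ a0); rewrite real_exprn_even_le0 ?num_real //= => /eqP ->.
by rewrite mul0r oppr0.
Qed.

End hilbert.

(** * Integrals over intervals *)

Section interval_integrals.
Context {R : realType}.
Local Notation mu := (@lebesgue_measure R).
Implicit Types (f g : R -> R) (a b c : R).

Lemma continuous_integrable f a b : continuous f -> mu.-integrable `[a, b] (EFin \o f).
Proof.
move=> cf; apply: continuous_compact_integrable; first exact: segment_compact.
exact: continuous_subspaceT.
Qed.

Lemma Rintegral_itv_cst a b c : a <= b -> \int[mu]_(s in `[a, b]) c = c * (b - a).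
Proof.
move=> ab; rewrite Rintegral_cst //; congr (_ * _).
have := @lebesgue_measure_itv R `[a, b]; rewrite /= lte_fin => ->.
by case: ltP => [//|ba] /=; rewrite (le_anti (introT andP (conj ab ba))) subrr.
Qed.

Lemma Rintegral_le_cst f a b c : a <= b -> mu.-integrable `[a, b] (EFin \o f) ->
  (forall s, s \in `[a, b] -> `|f s| <= c) ->
  `|\int[mu]_(s in `[a, b]) f s| <= c * (b - a).
Proof.
move=> ab fi fc; apply: le_trans (le_normr_Rintegral _ fi) _ => //.
have -> : c * (b - a) = \int[mu]_(s in `[a, b]) c.
  by rewrite Rintegral_itv_cst.
apply: le_Rintegral => //; first exact: integrable_norm.
- by apply: continuous_integrable; exact: cst_continuous.
Qed.

Lemma Rintegral_chasles f a b c : continuous f -> a <= b -> b <= c ->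
  \int[mu]_(s in `[a, c]) f s =
  \int[mu]_(s in `[a, b]) f s + \int[mu]_(s in `[b, c]) f s.
Proof.
move=> cf ab bc; rewrite -(@Rintegral_itv_obnd_cbnd _ b (BRight c) f); last first.
  apply: integrableS (continuous_integrable b c cf) => //.
  exact: subset_itv_oc_cc.
rewrite -(@Rintegral_itvB _ f (BLeft a) (BRight c) b) ?bnd_simp //; first by rewrite subrKC.
exact: continuous_integrable.
Qed.

(** A translation is the composition of two reflections. *)
Lemma Rintegral_shift f u h : continuous f ->
  \int[mu]_(s in `[0, h]) f (u + s) = \int[mu]_(s in `[u, u + h]) f s.
Proof.
move=> cf; pose g s := f (u + h - s).
have cg : continuous g.
  move=> s; apply: (@continuous_comp _ _ _ (fun s => u + h - s) f); last exact: cf.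
  by apply: cvgB; [exact: cvg_cst|exact: cvg_id].
have mg A : measurable_fun A g by apply: measurable_funTS; exact: continuous_measurable_fun.
have mf A : measurable_fun A f by apply: measurable_funTS; exact: continuous_measurable_fun.
transitivity (\int[mu]_(s in `[0, h]) g (h - s)).
  by apply: eq_Rintegral => s _; rewrite /g; congr f; ring.
rewrite Rintegral_refl // subrr subr0.
rewrite /g (Rintegral_refl (a := 0) (b := h) (mf _)).
by rewrite subr0 addrK.
Qed.

End interval_integrals.

(** * Bounded operators and their adjoints *)

Section bounded_operators.
Variables X Y : hilbertSpace.
Implicit Types (f : X -> Y) (g : Y -> X).

Lemma linear_add f x y : linear f -> f (x + y) = f x + f y.
Proof. by move=> lf; have := lf 1 x y; rewrite !scale1r. Qed.

Lemma linear_at0 f : linear f -> f 0 = 0.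
Proof. by move=> lf; apply: (addrI (f 0)); rewrite -linear_add // !addr0. Qed.

Lemma linear_scale f a x : linear f -> f (a *: x) = a *: f x.
Proof. by move=> lf; have := lf a x 0; rewrite !addr0 linear_at0 // addr0. Qed.

Lemma linear_sub f x y : linear f -> f (x - y) = f x - f y.
Proof. by move=> lf; rewrite linear_add // -scaleN1r linear_scale // scaleN1r. Qed.

Lemma bounded_linear_pos f : bounded_linear f -> exists c : RR, 0 <= c /\ opnorm_le f c.
Proof.
move=> [_ [c fc]]; exists `|c|; split=> // x; apply: le_trans (fc x) _.
by rewrite ler_wpM2r // ler_norm.
Qed.

Lemma continuous_of_bounded_linear f : bounded_linear f -> continuous f.
Proof.
move=> [lf [c fc]]; apply: (@lipschitz_continuous X Y f c) => x y.
by rewrite -linear_sub.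
Qed.

Lemma adjoint_opnorm f g (c : RR) : is_adjoint f g -> 0 <= c -> opnorm_le f c -> opnorm_le g c.
Proof.
move=> fg c0 fc y; apply: norm_le_inner; first by rewrite mulr_ge0.
move=> z; rewrite inner_sym -fg; apply: le_trans (ler_norm _) _.
apply: le_trans (cauchy_schwarz _ _) _.
by rewrite [leRHS]mulrAC ler_wpM2r // fc.
Qed.

Lemma adjoint_linear f g : is_adjoint f g -> linear g.
Proof.
move=> fg a x y; apply: inner_inj => z.
by rewrite innerDl innerZl ![inner (g _) z]inner_sym -!fg innerDr innerZr.
Qed.

Lemma adjoint_exists f : bounded_linear f -> exists g, is_adjoint f g.
Proof.
move=> bf; have [lf _] := bf; have [c [c0 fc]] := bounded_linear_pos bf.
have /choice[g gP] : forall y, exists z, forall x, inner (f x) y = inner x z.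
  move=> y; apply: (@riesz X (fun x => inner (f x) y) (c * `|y|)).
    by move=> a u v; rewrite lf innerDl innerZl.
  move=> x; apply: le_trans (cauchy_schwarz _ _) _.
  by rewrite [leRHS]mulrAC ler_wpM2r // fc.
by exists g => x y; exact: gP.
Qed.

End bounded_operators.

(** * Strongly continuous semigroups *)

Section semigroup.
Variables (X : hilbertSpace) (S : RR -> X -> X).
Hypothesis hS : C0_semigroup S.

Lemma C0_linear t : 0 <= t -> linear (S t).
Proof. by case: hS => h _ /h[]. Qed.

Lemma C0_zero x : S 0 x = x.
Proof. by case: hS => _ []. Qed.

Lemma C0_add t s x : 0 <= t -> 0 <= s -> S (t + s) x = S t (S s x).
Proof. by case: hS => _ [_ [h _]] t0 s0; exact: h. Qed.

Lemma C0_near0 x (e : RR) : 0 < e ->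
  exists eta : RR, 0 < eta /\ forall h, 0 <= h -> h < eta -> `|S h x - x| < e.
Proof.
move=> e0; case: hS => _ [_ [_ /(_ x)/cvgrPdist_lt/(_ e e0)]].
move=> [eta /= eta0 h]; exists eta; split=> // u; rewrite le_eqVlt => /orP[/eqP <- _|u0 ue].
  by rewrite C0_zero subrr normr0.
rewrite distrC; apply: h => //=; rewrite sub0r normrN gtr0_norm //.
Qed.

(** Otherwise there are times p_n <= 1 / (n + 1) at which the operator norm exceeds n + 1. Strong
    continuity at 0 makes these operators pointwise bounded, so Banach-Steinhaus bounds them
    uniformly on the unit ball, a contradiction. *)
Let local_bound0 : exists (delta M : RR), [/\ 0 < delta, 1 <= M &
  forall t x, 0 <= t -> t <= delta -> `|S t x| <= M * `|x|].
Proof.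
apply: contrapT => hno.
have bad (n : nat) : exists p : RR * X,
    [/\ 0 <= p.1, p.1 <= n.+1%:R^-1 & n.+1%:R * `|p.2| < `|S p.1 p.2|].
  apply: contrapT => hn; apply: hno; exists n.+1%:R^-1, n.+1%:R; split.
  - by rewrite invr_gt0.
  - by rewrite ler1n.
  - by move=> t x t0 tn; rewrite leNgt; apply/negP => h; apply: hn; exists (t, x).
have [p pP] := choice bad.
pose F : set (X -> X) := [set f | exists n, f = S (p n).1].
have FP f : F f -> bounded_fun_norm f /\ linear f.
  move=> [n ->]; have [p0 _ _] := pP n; split; last exact: C0_linear.
  case: hS => /(_ _ p0)/bounded_linear_pos [c [c0 hc]] _ r.
  by exists (c * r) => x xr; apply: le_trans (hc x) _; rewrite ler_wpM2l.
have Fpt : pointwise_bounded F.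
  move=> x; have [eta [eta0 hx]] := C0_near0 x ltr01.
  have [N _ hN] := near_infty_natSinv_lt (PosNum eta0).
  (* From index N on, S (p_n) x is within 1 of x; the sum takes care of the finitely many earlier
     indices. *)
  exists (`|x| + 1 + \sum_(i < N) `|S (p i).1 x|) => _ [n ->].
  have [p0 pn _] := pP n; have [nN|Nn] := ltnP n N.
    rewrite (bigD1 (Ordinal nN)) //= addrCA lerDl addr_ge0 ?addr_ge0 //.
    exact: sumr_ge0.
  apply: (@le_trans _ _ (`|x| + 1)); last by rewrite lerDl; exact: sumr_ge0.
  rewrite -[S _ x](subrKC x); apply: le_trans (ler_normD _ _) _.
  by rewrite lerD2l; apply/ltW/hx => //; apply: le_lt_trans pn _; exact: hN.
have [M hM] := @Banach_Steinhauss RR X X F FP Fpt 1.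
have lt_M (n : nat) : n.+1%:R <= M.
  have [p0 pn pb] := pP n; have lS := C0_linear p0.
  have xn0 : `|(p n).2| != 0.
    by apply/eqP => /normr0_eq0 x0; move: pb; rewrite x0 linear_at0 // normr0 mulr0 ltxx.
  have xp : 0 < `|(p n).2| by rewrite lt_neqAle eq_sym xn0 normr_ge0.
  have := hM (S (p n).1) (ex_intro _ n erefl) (`|(p n).2|^-1 *: (p n).2).
  rewrite normrZ normfV normr_id mulVf // => /(_ (lexx _)).
  rewrite linear_scale // normrZ normfV normr_id => h; apply: le_trans h.
  by rewrite mulrC ler_pdivlMr // ltW.
have := lt_M (Num.truncn M); apply/negP; rewrite -ltNge.
exact: truncnS_gt.
Qed.

(** The bound near 0 is iterated about L / d times. As the result depends on L, it never enters the
    final constant. *)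
Lemma C0_local_bound (L : RR) :
  exists M : RR, 0 < M /\ forall t x, 0 <= t -> t <= L -> `|S t x| <= M * `|x|.
Proof.
have [d [M [d0 M1 hM]]] := local_bound0.
have M0 : 0 < M by apply: lt_le_trans M1.
have step (n : nat) t x : 0 <= t -> t <= n%:R * d -> `|S t x| <= M ^+ n * `|x|.
  elim: n t x => [|n IH] t x t0 tn.
    have -> : t = 0 by apply/eqP; rewrite eq_le t0 andbT -(mul0r d).
    by rewrite C0_zero expr0 mul1r.
  have [td|dt] := leP t d.
    apply: le_trans (hM _ _ t0 td) _; rewrite ler_wpM2r // exprS ler_peMr ?(ltW M0) //.
    exact: exprn_ege1.
  have td0 : 0 <= t - d by rewrite subr_ge0 ltW.
  have := C0_add x (ltW d0) td0; rewrite subrKC => ->.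
  apply: le_trans (hM _ _ (ltW d0) (lexx d)) _.
  rewrite exprS -mulrA ler_wpM2l ?(ltW M0) //; apply: IH => //.
  by rewrite lerBlDr; move: tn; rewrite -natr1 mulrDl mul1r.
exists (M ^+ (Num.truncn (L / d)).+1); split; first exact: exprn_gt0.
move=> t x t0 tL; apply: step => //; apply: le_trans tL _.
by rewrite -ler_pdivrMr // ltW // truncnS_gt.
Qed.

(** Joint continuity in time and vector. Clamping at 0 extends t -> S t to the whole line, so that
    two-sided limits make sense at every time; this device recurs throughout. *)
Lemma C0_cvg (I : Type) (F : set_system I) (FF : Filter F) (u : I -> RR) (q : I -> X)
    (u0 : RR) (q0 : X) : u @ F --> u0 -> q @ F --> q0 ->
  (fun i => S (Num.max (u i) 0) (q i)) @ F --> S (Num.max u0 0) q0.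
Proof.
move=> uu0 qq0; have [M [M0 hM]] := C0_local_bound (`|u0| + 1).
apply/cvgrPdist_lt => e e0.
have e2 : 0 < e / (2 * M) by rewrite divr_gt0 // mulr_gt0.
have [eta [eta0 hq]] := C0_near0 q0 e2.
have [m0 m1] : 0 < Num.min eta 1 /\ Num.min eta 1 <= 1.
  by rewrite lt_min eta0 ltr01 ge_min lexx orbT.
have H1 : \forall i \near F, `|u0 - u i| < Num.min eta 1 by exact: (@cvgr_dist_lt RR RR^o I F FF u u0 uu0).
have H2 : \forall i \near F, `|q0 - q i| < e / (2 * M) by exact: (@cvgr_dist_lt RR X I F FF q q0 qq0 _ e2).
apply: filterS2 H1 H2 => i; rewrite lt_min => /andP[h1 h1'] h2.
set a := Num.max u0 0; set b := Num.max (u i) 0.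
have a0 : 0 <= a by rewrite le_max lexx orbT.
have b0 : 0 <= b by rewrite le_max lexx orbT.
have nu := ler_norm u0.
have aL : a <= `|u0| + 1 by rewrite ge_max; apply/andP; split; [lra|rewrite addr_ge0].
have uiL : u i <= `|u0| + 1.
  by have := ler_norm (u i - u0); rewrite distrC => h; lra.
have bL : b <= `|u0| + 1 by rewrite ge_max uiL /= addr_ge0.
have ab : `|a - b| < eta.
  apply: le_lt_trans h1; rewrite /a /b; have := ler_norm (u0 - u i).
  have := ler_norm (u i - u0); rewrite (distrC (u i)) => h3 h4.
  case: (leP u0 0) => u00; case: (leP (u i) 0) => ui0; rewrite ler_norml; apply/andP; split; lra.
(* Factoring out the smaller of the two times leaves an increment near time 0, where strong
   continuity at q0 applies. *)
have key c d x : 0 <= c -> c <= d -> d <= `|u0| + 1 ->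
    `|S d x - S c x| <= M * `|S (d - c) x - x|.
  move=> c0 cd dL; have dc0 : 0 <= d - c by rewrite subr_ge0.
  have -> : S d x = S c (S (d - c) x) by rewrite -C0_add // subrKC.
  by rewrite -linear_sub; [apply: hM => //; exact: le_trans cd dL|exact: C0_linear].
have h3 : `|S a q0 - S b q0| < e / 2.
  have E : e / 2 = M * (e / (2 * M)) by field; rewrite gt_eqF.
  rewrite E; have [ab'|ba'] := leP a b.
    rewrite distrC; apply: le_lt_trans (key _ _ _ a0 ab' bL) _; rewrite ltr_pM2l //.
    apply: hq; first by rewrite subr_ge0.
    by move: ab; rewrite distrC ger0_norm // subr_ge0.
  apply: le_lt_trans (key _ _ _ b0 (ltW ba') aL) _; rewrite ltr_pM2l //.
  apply: hq; first by rewrite subr_ge0 ltW.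
  by move: ab; rewrite ger0_norm // subr_ge0 ltW.
have -> : S a q0 - S b (q i) = (S a q0 - S b q0) + S b (q0 - q i).
  by rewrite linear_sub ?addrA ?subrK //; exact: C0_linear.
apply: le_lt_trans (ler_normD _ _) _; rewrite (splitr e); apply: ltrD => //.
apply: le_lt_trans (hM _ _ b0 bL) _.
have E : e / 2 = M * (e / (2 * M)) by field; rewrite gt_eqF.
by rewrite E ltr_pM2l.
Qed.

Lemma C0_continuous_clamp x : continuous (fun t : RR => S (Num.max t 0) x).
Proof. by move=> t; apply: C0_cvg; [exact: cvg_id|exact: cvg_cst]. Qed.

Variables (D : set X) (A : X -> X).
Hypothesis gS : generates S D A.

Lemma generator_cvg x : D x -> (fun h : RR => h^-1 *: (S h x - x)) @ 0^'+ --> A x.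
Proof. by case: gS => _; exact. Qed.

Lemma generator_invariant t x : 0 <= t -> D x -> D (S t x) /\ A (S t x) = S t (A x).
Proof.
move=> t0 Dx.
have c : (fun h : RR => h^-1 *: (S h (S t x) - S t x)) @ 0^'+ --> S t (A x).
  have bt : bounded_linear (S t) by case: hS => /(_ _ t0).
  have := cvg_comp _ _ (generator_cvg Dx) (continuous_of_bounded_linear bt (x := A x)).
  apply: cvg_trans; apply: near_eq_cvg.
  apply: filterS (nbhs_right_gt (0 : RR)) => h h0 /=.
  have lt := C0_linear t0.
  rewrite (linear_scale _ _ lt) (linear_sub _ _ lt).
  by rewrite -(C0_add x (ltW h0) t0) -(C0_add x t0 (ltW h0)) (addrC h t).
have DS : D (S t x) by apply/(gS.1 (S t x)).2; exists (S t (A x)).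
split=> //; apply: (@cvg_unique _ (@norm_hausdorff _ X) _ _ _ _ _ c).
exact: generator_cvg.
Qed.

Lemma cvg_norm_dnbhs0 : (fun h : RR => `|h|) @ (0 : RR)^' --> (0 : RR)^'+.
Proof.
move=> P [e /= e0 he]; exists e => //= h; rewrite /= sub0r normrN => h1 h2.
by apply: he; rewrite /= ?normr_gt0 // sub0r normrN normr_id.
Qed.

Lemma cvg_opp_dnbhs0 : (fun h : RR => - h) @ (0 : RR)^' --> (0 : RR)^'.
Proof.
move=> P [e /= e0 he]; exists e => //= h; rewrite /= sub0r normrN => h1 h2.
by apply: he; rewrite /= ?oppr_eq0 // sub0r opprK.
Qed.

(** For either sign of h the quotient equals S (min t (t + h)) applied to (S |h| x - x) / |h|, so
    the right derivative at 0 and joint continuity yield the two-sided derivative. *)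
Lemma generator_derive t x : 0 < t -> D x ->
  (fun h : RR => h^-1 *: (S (Num.max (t + h) 0) x - S (Num.max t 0) x)) @ (0 : RR)^'
    --> S t (A x).
Proof.
move=> t0 Dx.
have c1 : (fun h : RR => `|h|^-1 *: (S `|h| x - x)) @ (0 : RR)^' --> A x.
  exact: (cvg_comp _ _ cvg_norm_dnbhs0 (generator_cvg Dx)).
have c2 : (fun h : RR => Num.min t (t + h)) @ (0 : RR)^' --> t.
  apply/(@cvgrPdist_lt RR RR^o) => e e0.
  apply: filterS (@dnbhs0_lt RR RR^o e e0) => h he.
  apply: le_lt_trans he; case: (leP t (t + h)) => th; first by rewrite subrr normr0.
  by rewrite opprD addNKr normrN.
have c3 := C0_cvg (dnbhs_filter (0 : RR)) c2 c1; rewrite (max_l (ltW t0)) in c3.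
apply/cvgrPdist_lt => e e0; move/cvgrPdist_lt: c3 => /(_ e e0) H3.
have H1 := @dnbhs0_lt RR RR^o t t0.
have H2 : \forall h \near (0 : RR)^', h != 0 by exact: nbhs_dnbhs_neq.
apply: filterS3 H1 H2 H3 => h ht h0 /=.
have th : 0 <= t + h by move: ht; rewrite ltr_norml => /andP[? ?]; lra.
rewrite (max_l th) (max_l (ltW t0)); congr (`|_ - _| < e).
have lt := C0_linear (ltW t0); have [hp|hn] := leP 0 h.
  rewrite (ger0_norm hp) min_l ?lerDl // (max_l (ltW t0)).
  by rewrite (linear_scale _ _ lt) (linear_sub _ _ lt) -(C0_add x (ltW t0) hp).
rewrite (ltr0_norm hn) min_r ?gerDl ?(ltW hn) // (max_l th).
have hn0 : 0 <= - h by rewrite oppr_ge0 ltW.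
have lth := C0_linear th.
rewrite (linear_scale _ _ lth) (linear_sub _ _ lth) -(C0_add x th hn0) addrK.
by rewrite invrN scaleNr -scalerN opprB.
Qed.

(** The Bochner integral of s -> S s y, obtained as the Riesz representative of the weak
    integral. *)
Lemma integral_vector (h : RR) (y : X) : 0 <= h -> exists J : X, forall z,
  inner J z = Rintegral leb `[0, h] (fun s => inner (S (Num.max s 0) y) z).
Proof.
move=> h0; have [M [M0 hM]] := C0_local_bound h.
have cg z : continuous (fun s : RR => inner (S (Num.max s 0) y) z).
  by move=> s; apply: cvg_inner; [exact: C0_continuous_clamp|exact: cvg_cst].
have ig z : leb.-integrable `[0, h] (EFin \o (fun s => inner (S (Num.max s 0) y) z)).
  exact: (@continuous_integrable RR _ 0 h (cg z)).
pose phi z := Rintegral leb `[0, h] (fun s => inner (S (Num.max s 0) y) z).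
have phil a u v : phi (a *: u + v) = a * phi u + phi v.
  rewrite /phi -RintegralZl //.
  rewrite -RintegralD //; first by apply: eq_Rintegral => s _; rewrite innerDr innerZr.
  exact: (@integrableZl _ _ _ leb _ (measurable_itv _) a _ (ig u)).
have phib z : `|phi z| <= (M * `|y| * h) * `|z|.
  have -> : M * `|y| * h * `|z| = M * `|y| * `|z| * (h - 0) by rewrite subr0 mulrAC.
  apply: (@Rintegral_le_cst RR _ 0 h _ h0 (ig z)) => s.
  rewrite in_itv/= => /andP[s0 sh]; apply: le_trans (cauchy_schwarz _ _) _; rewrite ler_wpM2r // (max_l s0).
  exact: hM.
have [J hJ] := riesz phil phib.
by exists J => z; rewrite inner_sym -hJ.
Qed.

Lemma generatorZ a x : D x -> D (a *: x).
Proof.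
move=> Dx; apply/(gS.1 _).2; exists (a *: A x).
have c : (fun h : RR => a *: (h^-1 *: (S h x - x))) @ 0^'+ --> a *: A x.
  by apply: cvgZr; exact: generator_cvg.
apply: cvg_trans c; apply: near_eq_cvg.
apply: filterS (nbhs_right_gt (0 : RR)) => h h0 /=.
by rewrite (linear_scale a x (C0_linear (ltW h0))) -scalerBr !scalerA mulrC.
Qed.

(** S u J - J is the integral of S s y over [h, u + h] minus the integral over [0, u]; divided by u
    these two tend to S h y and y. *)
Lemma generator_integral (h : RR) (y J : X) : 0 < h ->
  (forall z, inner J z = Rintegral leb `[0, h] (fun s => inner (S (Num.max s 0) y) z)) ->
  D J.
Proof.
move=> h0 hJ; apply/(gS.1 _).2; exists (S h y - y).
have cg z : continuous (fun s : RR => inner (S (Num.max s 0) y) z).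
  by move=> s; apply: cvg_inner; [exact: C0_continuous_clamp|exact: cvg_cst].
apply/cvgrPdist_le => e e0; have e2 : 0 < e / 2 by exact: divr_gt0.
(* The first radius controls S s y - y for s near 0, the second S s y - S h y for s just above h. *)
have [e1 [e10 he1]] := C0_near0 y e2; have [e3 [e30 he3]] := C0_near0 (S h y) e2.
have H1 := nbhs_right_lt e10; have H2 := nbhs_right_lt e30.
have H3 := nbhs_right_gt (0 : RR); apply: filterS3 H1 H2 H3 => u u1 u3 u0.
apply: norm_le_inner; first exact: ltW.
move=> z; pose g s := inner (S (Num.max s 0) y) z.
pose I a b := Rintegral leb `[a, b] g.
have ig a b := @continuous_integrable RR _ a b (cg z).
have EJ : inner J z = I 0 h by exact: hJ.
have ESJ : inner (S u J) z = I u (u + h).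
  have bu : bounded_linear (S u) by case: hS => /(_ _ (ltW u0)).
  (* The integral is known only weakly, so S u is passed through it by means of its adjoint. *)
  have [Su hSu] := adjoint_exists bu.
  rewrite hSu hJ /I -(@Rintegral_shift RR g u h (cg z)).
  apply: eq_Rintegral => s; rewrite inE /= in_itv/= => /andP[s0 sh].
  rewrite -hSu /g (max_l s0) max_l ?addr_ge0 ?(ltW u0) //.
  by rewrite C0_add // ltW.
have E1 : I 0 u + I u (u + h) = I 0 (u + h).
  by rewrite /I -(@Rintegral_chasles RR g 0 u (u + h) (cg z)) ?lerDl ?(ltW u0) ?(ltW h0).
have E2 : I 0 h + I h (u + h) = I 0 (u + h).
  by rewrite /I -(@Rintegral_chasles RR g 0 h (u + h) (cg z)) ?lerDr ?(ltW u0) ?(ltW h0).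
have B a b v : 0 <= a -> a <= b -> (forall s, s \in `[a, b] -> `|S s y - v| <= e / 2) ->
    `|I a b - inner v z * (b - a)| <= e / 2 * `|z| * (b - a).
  move=> a0 ab hv.
  have cc : continuous (fun _ : RR => inner v z) by exact: cst_continuous.
  have -> : inner v z * (b - a) = Rintegral leb `[a, b] (fun _ => inner v z).
    by rewrite (@Rintegral_itv_cst RR).
  rewrite /I -RintegralB //; last exact: (@continuous_integrable RR _ a b cc).
  apply: (@Rintegral_le_cst RR) => //.
    have cgc : continuous (fun s : RR => g s - inner v z).
      by move=> s; apply: (@cvgB _ RR^o); [exact: cg|exact: cvg_cst].
    exact: (@continuous_integrable RR _ a b cgc).
  move=> s sab; have s0 : 0 <= s by move: sab; rewrite in_itv/= => /andP[/(le_trans a0)].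
  rewrite /g -innerBl (max_l s0); apply: le_trans (cauchy_schwarz _ _) _.
  by rewrite ler_wpM2r // hv.
have B1 : `|I 0 u - inner y z * u| <= e / 2 * `|z| * u.
  have := B 0 u y (lexx _) (ltW u0); rewrite !subr0; apply=> s; rewrite in_itv/= => /andP[s0 su].
  by apply/ltW/he1 => //; exact: le_lt_trans su u1.
have B2 : `|I h (u + h) - inner (S h y) z * u| <= e / 2 * `|z| * u.
  have := B h (u + h) (S h y) (ltW h0); rewrite addrK lerDr (ltW u0) => /(_ isT); apply=> s.
  rewrite in_itv/= => /andP[hs su]; have sh : 0 <= s - h by rewrite subr_ge0.
  have -> : S s y = S (s - h) (S h y) by rewrite -C0_add ?subrK ?(ltW h0).
  by apply/ltW/he3 => //; apply: le_lt_trans u3; rewrite lerBlDr.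
rewrite innerBl innerZl !innerBl ESJ EJ.
have EI (a b c d f : RR) : a + b = f -> c + d = f -> b - c = d - a.
  by move=> <- /eqP; rewrite eq_sym -subr_eq => /eqP <-; ring.
rewrite (EI _ _ _ _ _ E1 E2) -(ler_pM2r u0) mulrBl (mulrC u^-1) divfK ?gt_eqF //.
have -> : e * `|z| * u = e / 2 * `|z| * u + e / 2 * `|z| * u by rewrite -mulrDl -mulrDl -splitr.
move: B1 B2; rewrite !ler_norml => /andP[_ B1] /andP[B2 _].
have E3 (a b c d : RR) : (a - b) * u - (c - d) = - (c - a * u) + (d - b * u) by ring.
by rewrite E3; apply: lerD => //; rewrite lerNl.
Qed.

(** The averages of S s y over [0, h] belong to the domain and tend to y as h tends to 0. *)
Lemma generator_dense (y : X) (e : RR) : 0 < e -> exists d, D d /\ `|d - y| < e.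
Proof.
move=> e0; have e2 : 0 < e / 2 by exact: divr_gt0.
have [eta [eta0 he]] := C0_near0 y e2; pose h := eta / 2.
have h0 : 0 < h by exact: divr_gt0.
have [J hJ] := integral_vector y (ltW h0).
exists (h^-1 *: J); split; first exact/generatorZ/(generator_integral h0 hJ).
suff : `|h^-1 *: J - y| <= e / 2 by move=> H; apply: le_lt_trans H _; lra.
apply: norm_le_inner; first exact: ltW.
move=> z; rewrite innerBl innerZl hJ.
have cg : continuous (fun s : RR => inner (S (Num.max s 0) y - y) z).
  move=> s; apply: cvg_inner; last exact: cvg_cst.
  by apply: cvgB; [exact: C0_continuous_clamp|exact: cvg_cst].
have cg' : continuous (fun s : RR => inner (S (Num.max s 0) y) z).
  by move=> s; apply: cvg_inner; [exact: C0_continuous_clamp|exact: cvg_cst].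
have cc : continuous (fun _ : RR => inner y z) by exact: cst_continuous.
have B : `|Rintegral leb `[0, h] (fun s => inner (S (Num.max s 0) y - y) z)| <= e / 2 * `|z| * (h - 0).
  apply: (@Rintegral_le_cst RR); [exact: ltW|exact: (@continuous_integrable RR _ 0 h cg)|].
  move=> s; rewrite in_itv/= => /andP[s0 sh].
  rewrite (max_l s0); apply: le_trans (cauchy_schwarz _ _) _.
  rewrite ler_wpM2r //; apply/ltW/he => //; apply: le_lt_trans sh _.
  by rewrite /h; lra.
have E : Rintegral leb `[0, h] (fun s => inner (S (Num.max s 0) y - y) z) =
    Rintegral leb `[0, h] (fun s => inner (S (Num.max s 0) y) z) - inner y z * h.
  have -> : inner y z * h = Rintegral leb `[0, h] (fun _ => inner y z).
    by rewrite (@Rintegral_itv_cst RR) ?subr0 // ltW.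
  rewrite -RintegralB //; first by apply: eq_Rintegral => s _; rewrite innerBl.
    exact: (@continuous_integrable RR _ 0 h cg').
  exact: (@continuous_integrable RR _ 0 h cc).
rewrite E subr0 in B; have {}B := le_trans (ler_norm _) B.
rewrite -(ler_pM2r h0) mulrBl (mulrC h^-1) divfK ?gt_eqF //.
Qed.

End semigroup.

Lemma is_derive_of_cvg (R : realType) (f : R -> R) (s l : R) :
  (fun h : R => h^-1 * (f (s + h) - f s)) @ 0^' --> l -> is_derive s 1 f l.
Proof.
move=> c.
have c' : (fun h : R => h^-1 *: ((f \o shift s) (h *: (1 : R)) - f s)) @ 0^' --> l.
  apply: cvg_trans c; apply: near_eq_cvg; apply: nearW => h /=.
  by rewrite /GRing.scale /= mulr1 (addrC h).
apply: DeriveDef; first by apply/cvg_ex; exists l.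
exact: (cvg_lim (@norm_hausdorff _ R) c').
Qed.

(** * Duhamel's formula *)

Section duhamel.
Variable X : hilbertSpace.

(* For an adjoint semigroup only weak continuity in time is at hand, hence the
   formulation tested against vectors [r]. *)
Definition weak_semigroup (V : RR -> X -> X) :=
  [/\ forall x, V 0 x = x, forall t, 0 <= t -> linear (V t),
    forall L : RR, exists M : RR, 0 < M /\
      forall t x, 0 <= t -> t <= L -> `|V t x| <= M * `|x| &
    forall (I : Type) (F : set_system I), Filter F ->
      forall (u : I -> RR) (q : I -> X) (u0 : RR) (q0 r : X),
      u @ F --> u0 -> q @ F --> q0 ->
      (fun i => inner r (V (Num.max (u i) 0) (q i))) @ F --> inner r (V (Num.max u0 0) q0)].

Lemma C0_weak_semigroup V : C0_semigroup V -> weak_semigroup V.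
Proof.
move=> hV; split; [exact: C0_zero|exact: C0_linear|exact: C0_local_bound|].
move=> I F FF u q u0 q0 r uu qq; apply: cvg_inner; first exact: cvg_cst.
exact: C0_cvg.
Qed.

Lemma adjoint_weak_semigroup V W : C0_semigroup V ->
  (forall t, 0 <= t -> is_adjoint (V t) (W t)) -> weak_semigroup W.
Proof.
move=> hV hVW; split.
- by move=> x; apply: inner_inj => z; rewrite inner_sym -hVW // C0_zero // inner_sym.
- by move=> t t0; exact: adjoint_linear (hVW t t0).
- move=> L; have [M [M0 hM]] := C0_local_bound hV L; exists M; split=> // t x t0 tL.
  by apply: (adjoint_opnorm (hVW t t0) (ltW M0)) => z; exact: hM.
- move=> I F FF u q u0 q0 r uu qq.
  have p0 (t : RR) : 0 <= Num.max t 0 by rewrite le_max lexx orbT.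
  have -> : (fun i => inner r (W (Num.max (u i) 0) (q i))) =
      (fun i => inner (V (Num.max (u i) 0) r) (q i)).
    by apply/funext => i; rewrite hVW.
  rewrite -hVW //; apply: cvg_inner qq.
  by apply: C0_cvg => //; exact: cvg_cst.
Qed.

(** Variation of constants for the case where the generator of S is that of V plus P, in weak form.
    The lower time sigma stays free because, after Fubini's theorem, the formula is needed from
    every starting time. *)
Definition duhamel (V S : RR -> X -> X) (P : X -> X) :=
  forall (sigma t : RR) (r y : X), 0 <= sigma -> sigma <= t ->
  inner r (S (t - sigma) y) - inner r (V (t - sigma) y) =
  Rintegral leb `[sigma, t] (fun s => inner r (V (s - sigma) (P (S (t - s) y)))).

Variables (V S : RR -> X -> X) (P : X -> X) (Dr Dy : set X).
Hypotheses (wV : weak_semigroup V) (hS : C0_semigroup S) (bP : bounded_linear P)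
  (dense_r : forall (y : X) (e : RR), 0 < e -> exists d, Dr d /\ `|d - y| < e)
  (dense_y : forall (y : X) (e : RR), 0 < e -> exists d, Dy d /\ `|d - y| < e)
  (derive_VS : forall (sigma t s : RR) r y, 0 <= sigma -> sigma < s -> s < t -> Dr r -> Dy y ->
    (fun h : RR => h^-1 * (inner r (V (Num.max (s + h - sigma) 0) (S (Num.max (t - (s + h)) 0) y)) -
                    inner r (V (Num.max (s - sigma) 0) (S (Num.max (t - s) 0) y)))) @ (0 : RR)^' -->
     - inner r (V (Num.max (s - sigma) 0) (P (S (Num.max (t - s) 0) y)))).

Let continuous_shift (a : RR) : continuous (fun s : RR => s - a).
Proof. by move=> s; apply: (@cvgB _ RR^o); [exact: cvg_id|exact: cvg_cst]. Qed.

Let continuous_refl (a : RR) : continuous (fun s : RR => a - s).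
Proof. by move=> s; apply: (@cvgB _ RR^o); [exact: cvg_cst|exact: cvg_id]. Qed.

Let cvg_V (r : X) (a : RR) (q : RR -> X) : continuous q ->
  continuous (fun s : RR => inner r (V (Num.max (s - a) 0) (q s))).
Proof.
case: wV => _ _ _ h cq s; apply: (h RR (nbhs s) _ (fun s : RR => s - a) q).
  exact: continuous_shift.
exact: cq.
Qed.

Let continuous_S (t : RR) (y : X) : continuous (fun s : RR => S (Num.max (t - s) 0) y).
Proof. by move=> s; apply: C0_cvg => //; [exact: continuous_refl|exact: cvg_cst]. Qed.

Let continuous_PS (t : RR) (y : X) : continuous (fun s : RR => P (S (Num.max (t - s) 0) y)).
Proof.
move=> s; apply: (@continuous_comp _ _ _ (fun s : RR => S (Num.max (t - s) 0) y) P).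
  exact: continuous_S.
exact: (@continuous_of_bounded_linear X X P bP).
Qed.

(** The fundamental theorem of calculus for s -> <r, V (s - sigma) S (t - s) y>, which interpolates
    between the two terms on the left. Its derivative involves only P, as the generators cancel. *)
Let duhamel_dense (sigma t : RR) r y : 0 <= sigma -> sigma <= t -> Dr r -> Dy y ->
  inner r (S (t - sigma) y) - inner r (V (t - sigma) y) =
  Rintegral leb `[sigma, t] (fun s => inner r (V (Num.max (s - sigma) 0) (P (S (Num.max (t - s) 0) y)))).
Proof.
move=> s0 st hr hy.
pose f (s : RR) := inner r (V (Num.max (s - sigma) 0) (P (S (Num.max (t - s) 0) y))).
pose G (s : RR) := - inner r (V (Num.max (s - sigma) 0) (S (Num.max (t - s) 0) y)).
have cf : continuous f by exact: (@cvg_V r sigma _ (@continuous_PS t y)).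

have cG : continuous G.
  by move=> s; apply: (@cvgN _ RR^o); exact: (@cvg_V r sigma _ (@continuous_S t y)).
have lG (s : RR) : sigma < s < t ->
    (fun h : RR => h^-1 * (G (s + h) - G s)) @ (0 : RR)^' --> f s.
  move=> /andP[ss sst].
  have := derive_VS s0 ss sst hr hy; move/(@cvgN _ RR^o); rewrite opprK.
  apply: cvg_trans; apply: near_eq_cvg; apply: nearW => h /=.
  by rewrite /G -mulrN opprB opprK addrC.
have := @integral_FTC2 RR f G sigma t st cf cG
  (fun s hs => @is_derive_of_cvg RR G s (f s) (lG s hs)).
rewrite /Rintegral => -> /=; rewrite /G !subrr maxxx max_l ?subr_ge0 //.
rewrite (C0_zero hS); have [V0 _ _ _] := wV.
by rewrite V0 opprK addrC.
Qed.

(** The defect [G] of the formula is additive in each argument and bounded by K |r| |y|, and it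
    vanishes on a dense set of pairs, hence everywhere. *)
Lemma duhamel_of_derive : duhamel V S P.
Proof.
move=> sigma t r y s0 st; have [_ lV bV _] := wV.
have ts : 0 <= t - sigma by rewrite subr_ge0.
have [MV [MV0 hMV]] := bV t; have [MS [MS0 hMS]] := C0_local_bound hS t.
have [cP [cP0 hcP]] := bounded_linear_pos bP; have [lP _] := bP.
pose f r y (s : RR) := inner r (V (Num.max (s - sigma) 0) (P (S (Num.max (t - s) 0) y))).
have -> : Rintegral leb `[sigma, t] (fun s => inner r (V (s - sigma) (P (S (t - s) y)))) =
    Rintegral leb `[sigma, t] (f r y).
  apply: eq_Rintegral => s; rewrite inE /= in_itv/= => /andP[ss sst].
  by rewrite /f !max_l ?subr_ge0.
have cf r' y' : continuous (f r' y') by exact: (@cvg_V r' sigma _ (@continuous_PS t y')).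
have if_ r' y' : leb.-integrable `[sigma, t] (EFin \o f r' y').
  exact: (@continuous_integrable RR _ sigma t (cf r' y')).
pose G r y := inner r (S (t - sigma) y) - inner r (V (t - sigma) y) -
  Rintegral leb `[sigma, t] (f r y).
have tst : t - sigma <= t by rewrite gerBl.
pose K := MS + MV + MV * cP * MS * (t - sigma).
have K0 : 0 <= K by rewrite !addr_ge0 ?mulr_ge0 // ltW.
have Gb r' y' : `|G r' y'| <= K * `|r'| * `|y'|.
  have b1 : `|inner r' (S (t - sigma) y')| <= MS * (`|r'| * `|y'|).
    apply: le_trans (cauchy_schwarz _ _) _; rewrite mulrCA ler_wpM2l //; exact: hMS.
  have b2 : `|inner r' (V (t - sigma) y')| <= MV * (`|r'| * `|y'|).
    apply: le_trans (cauchy_schwarz _ _) _; rewrite mulrCA ler_wpM2l //; exact: hMV.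
  have b3 : `|Rintegral leb `[sigma, t] (f r' y')| <=
      MV * cP * MS * (`|r'| * `|y'|) * (t - sigma).
    apply: (@Rintegral_le_cst RR _ sigma t _ st (if_ r' y')) => s; rewrite in_itv/= => /andP[ss sst].
    rewrite /f !max_l ?subr_ge0 //; apply: le_trans (cauchy_schwarz _ _) _.
    rewrite mulrCA ler_wpM2l // -!mulrA.
    have s1 : 0 <= s - sigma by rewrite subr_ge0.
    have s2 : 0 <= t - s by rewrite subr_ge0.
    have s3 : s - sigma <= t by rewrite lerBlDr (le_trans sst) // lerDl.
    have s4 : t - s <= t by rewrite gerBl (le_trans s0).
    apply: le_trans (hMV _ _ s1 s3) _; rewrite ler_wpM2l ?(ltW MV0) //.
    apply: le_trans (hcP _) _; rewrite ler_wpM2l //; exact: hMS.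
  rewrite /G /K; apply: le_trans (ler_normB _ _) _.
  apply: (@le_trans _ _ (MS * (`|r'| * `|y'|) + MV * (`|r'| * `|y'|) +
    MV * cP * MS * (`|r'| * `|y'|) * (t - sigma))).
    by apply: lerD => //; apply: le_trans (ler_normB _ _) _; apply: lerD.
  by rewrite le_eqVlt; apply/orP; left; apply/eqP; ring.
have GBl r1 r2 y' : G (r1 - r2) y' = G r1 y' - G r2 y'.
  rewrite /G !innerBl.
  have -> : Rintegral leb `[sigma, t] (f (r1 - r2) y') =
      Rintegral leb `[sigma, t] (f r1 y') - Rintegral leb `[sigma, t] (f r2 y').
    rewrite -(@RintegralB _ _ RR leb `[sigma, t]%classic (f r1 y') (f r2 y')); [|exact: measurable_itv|exact: if_|exact: if_].
    by apply: eq_Rintegral => s _; rewrite /f innerBl.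
  by ring.
have GBr r' y1 y2 : G r' (y1 - y2) = G r' y1 - G r' y2.
  have p0 (u : RR) : 0 <= Num.max u 0 by rewrite le_max lexx orbT.
  rewrite /G (linear_sub _ _ (C0_linear hS ts)) (linear_sub _ _ (lV _ ts)) !innerBr.
  have -> : Rintegral leb `[sigma, t] (f r' (y1 - y2)) =
      Rintegral leb `[sigma, t] (f r' y1) - Rintegral leb `[sigma, t] (f r' y2).
    rewrite -(@RintegralB _ _ RR leb `[sigma, t]%classic (f r' y1) (f r' y2)); [|exact: measurable_itv|exact: if_|exact: if_].
    apply: eq_Rintegral => s _; rewrite /f.
    by rewrite (linear_sub _ _ (C0_linear hS (p0 _))) (linear_sub _ _ lP) (linear_sub _ _ (lV _ (p0 _))) innerBr.
  by ring.
suff : G r y = 0 by move/eqP; rewrite subr_eq0 => /eqP.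
apply/eqP; rewrite -normr_le0; apply/ler_addgt0Pr => e e0; rewrite add0r.
(* Approximating both vectors up to e / n costs at most (n - 1) e / n in total; the bound 1 on the
   distances keeps |r'| below |r| + 1. *)
pose n := K * (`|y| + `|r| + 1) + 1.
have n0 : 0 < n by rewrite ltr_wpDl // mulr_ge0 // !addr_ge0.
have d0 : 0 < Num.min 1 (e / n) by rewrite lt_min ltr01 divr_gt0.
have [r' [Dr' rr']] := dense_r r d0; have [y' [Dy' yy']] := dense_y y d0.
move: rr' yy'; rewrite !lt_min => /andP[rr1 rre] /andP[yy1 yye].
have G0 : G r' y' = 0.
  by apply/eqP; rewrite subr_eq0; apply/eqP; exact: duhamel_dense.
have -> : G r y = - G (r' - r) y - G r' (y' - y) by rewrite GBl GBr G0; ring.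
have h1 := Gb (r' - r) y; have h2 := Gb r' (y' - y).
have r'b : `|r'| <= `|r| + 1.
  have -> : r' = r + (r' - r) by rewrite subrKC.
  by apply: le_trans (ler_normD _ _) _; rewrite lerD2l ltW.
apply: le_trans (ler_normB _ _) _; rewrite normrN.
have en : 0 <= e / n by rewrite divr_ge0 // ltW.
have h3 : `|G (r' - r) y| <= K * (e / n) * `|y|.
  by apply: le_trans h1 _; rewrite ler_wpM2r // ler_wpM2l // ltW.
have h4 : `|G r' (y' - y)| <= K * (`|r| + 1) * (e / n).
  apply: le_trans h2 _; apply: ler_pM; rewrite ?mulr_ge0 ?(ltW yye) //.
  by rewrite ler_wpM2l.
apply: le_trans (lerD h3 h4) _.
have -> : K * (e / n) * `|y| + K * (`|r| + 1) * (e / n) = (n - 1) * (e / n).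
  by rewrite /n; ring.
by rewrite mulrBl mul1r mulrCA divff ?gt_eqF // mulr1 gerBl.
Qed.

End duhamel.

Lemma cvg_eqfun (I : Type) (F : set_system I) (f g : I -> RR) (l : RR) :
  f =1 g -> g @ F --> l -> f @ F --> l.
Proof. by move=> /funext ->. Qed.

(** * Duhamel's formula for a semigroup and for its adjoint *)

Section bounded_perturbation.
Variables (X : hilbertSpace) (T : RR -> X -> X) (D : set X) (A : X -> X).
Hypotheses (hT : C0_semigroup T) (gT : generates T D A).
Variables (S : RR -> X -> X) (P : X -> X).
Hypotheses (hS : C0_semigroup S) (bP : bounded_linear P).

Let cvg_refl_dnbhs (f : RR -> X) (s t : RR) (l : X) :
  (fun h : RR => h^-1 *: (f (t - s + h) - f (t - s))) @ (0 : RR)^' --> l ->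
  (fun h : RR => h^-1 *: (f (t - (s + h)) - f (t - s))) @ (0 : RR)^' --> - l.
Proof.
move=> c; have -> : (fun h : RR => h^-1 *: (f (t - (s + h)) - f (t - s))) =
    (fun h : RR => - ((- h)^-1 *: (f (t - s + - h) - f (t - s)))).
  by apply/funext => h; rewrite invrN scaleNr opprK opprD addrA.
by apply: cvgN; exact: (cvg_comp _ _ cvg_opp_dnbhs0 c).
Qed.

Let cvg_id_dnbhs (a b : RR) : (fun h : RR => a + b * h) @ (0 : RR)^' --> a.
Proof.
rewrite -{2}(addr0 a) -{2}(mulr0 b); apply: (@cvgD _ RR^o); first exact: cvg_cst.
by apply: cvgMr; apply: cvg_within_filter; exact: cvg_id.
Qed.

(** Product rule: both generators have the domain D, which S preserves, so w = S (t - s) y can be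
    differentiated under T as well. As T is strongly continuous, r may be any vector. *)
Lemma duhamel_perturbation : generates S D (fun x => A x + P x) -> duhamel T S P.
Proof.
move=> gS; apply: (@duhamel_of_derive _ _ _ _ setT D).
- exact: C0_weak_semigroup.
- exact: hS.
- exact: bP.
- by move=> y e e0; exists y; rewrite subrr normr0.
- by move=> y e; exact: (generator_dense hS gS y).
move=> sigma t s r y s0 ss st _ Dy.
have ss0 : 0 < s - sigma by rewrite subr_gt0.
have ts0 : 0 < t - s by rewrite subr_gt0.
have [Dw Aw] := generator_invariant hS gS (ltW ts0) Dy.
rewrite (max_l (ltW ss0)) (max_l (ltW ts0)).
set w := S (t - s) y in Dw Aw *.
have c1 := generator_derive hS gS ts0 Dy.
have c2 := @cvg_refl_dnbhs (fun u => S (Num.max u 0) y) _ _ _ c1.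
rewrite /= (max_l (ltW ts0)) -/w in c2.
have c3 : (fun h : RR => s - sigma + 1 * h) @ (0 : RR)^' --> s - sigma.
  exact: cvg_id_dnbhs.
have c4 := C0_cvg hT (dnbhs_filter (0 : RR)) c3 c2.
have c5 := generator_derive hT gT ss0 Dw.
have cr : (fun _ : RR => r) @ (0 : RR)^' --> r by exact: cvg_cst.
have c6 := cvg_inner (dnbhs_filter (0 : RR)) cr (cvgD c4 c5).
rewrite (max_l (ltW ss0)) in c6.
have lT := C0_linear hT (ltW ss0).
(* S commutes with its generator, so S (t - s) (A y + P y) = A w + P w and the terms with A
   cancel. *)
have E : inner r (T (s - sigma) (- S (t - s) (A y + P y)) + T (s - sigma) (A w)) =
    - inner r (T (s - sigma) (P w)).
  by rewrite -Aw -(linear_add _ _ lT) opprD addrAC addNr add0r -scaleN1r (linear_scale _ _ lT) innerZr mulN1r.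
have {}c6 := c6 (dnbhs_filter (0 : RR)); rewrite E in c6.
apply: (cvg_eqfun _ c6) => h /=.
rewrite fctE mul1r; have -> : s - sigma + h = s + h - sigma by rewrite addrAC.
have lT' : linear (T (Num.max (s + h - sigma) 0)).
  by apply: (C0_linear hT); rewrite le_max lexx orbT.
rewrite (linear_scale _ _ lT') (linear_sub _ _ lT') -scalerDr innerZr innerDr !innerBr.
by rewrite addrA subrK.
Qed.

Variables (Dstar : set X) (Astar : X -> X) (Tstar : RR -> X -> X).
Hypotheses (hAstar : is_unbounded_adjoint D A Dstar Astar)
  (hTstar : forall t, 0 <= t -> is_adjoint (T t) (Tstar t)).

(** The adjoint semigroup is not differentiated: [T] is moved onto r, which is taken in the domain
    of A, and <A v, w> = <v, A^* w> provides the cancellation. Both vectors thus range over dense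
    domains only. *)
Lemma duhamel_adjoint_perturbation :
  generates S Dstar (fun x => Astar x + P x) -> duhamel Tstar S P.
Proof.
move=> gS; apply: (@duhamel_of_derive _ _ _ _ D Dstar).
- exact: adjoint_weak_semigroup hT hTstar.
- exact: hS.
- exact: bP.
- by move=> y e; exact: (generator_dense hT gT y).
- by move=> y e; exact: (generator_dense hS gS y).
move=> sigma t s r y s0 ss st Dr Dy.
have ss0 : 0 < s - sigma by rewrite subr_gt0.
have ts0 : 0 < t - s by rewrite subr_gt0.
have [Dw Aw] := generator_invariant hS gS (ltW ts0) Dy.
have [Dv Av] := generator_invariant hT gT (ltW ss0) Dr.
set w := S (t - s) y in Dw Aw *; set v := T (s - sigma) r in Dv Av *.
have c1 := generator_derive hS gS ts0 Dy.
have c2 := @cvg_refl_dnbhs (fun u => S (Num.max u 0) y) _ _ _ c1.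
rewrite /= (max_l (ltW ts0)) -/w in c2.
have c3 : (fun h : RR => s - sigma + 1 * h) @ (0 : RR)^' --> s - sigma.
  exact: cvg_id_dnbhs.
have cr : (fun _ : RR => r) @ (0 : RR)^' --> r by exact: cvg_cst.
have cw : (fun _ : RR => w) @ (0 : RR)^' --> w by exact: cvg_cst.
have c4 := C0_cvg hT (dnbhs_filter (0 : RR)) c3 cr.
have c5 := generator_derive hT gT ss0 Dr.
rewrite (max_l (ltW ss0)) in c4 c5.
have c6 := @cvgD _ RR^o _ _ _ _ _ _ _
  (cvg_inner (dnbhs_filter (0 : RR)) c4 c2) (cvg_inner (dnbhs_filter (0 : RR)) c5 cw).
have E : inner (T (s - sigma) r) (- S (t - s) (Astar y + P y)) + inner (T (s - sigma) (A r)) w =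
    - inner r (Tstar (Num.max (s - sigma) 0) (P (S (Num.max (t - s) 0) y))).
  rewrite (max_l (ltW ss0)) (max_l (ltW ts0)) -/w -hTstar ?(ltW ss0) // -/v -Aw -Av.
  by rewrite (hAstar.2 w v Dw Dv) -innerDr opprD addrAC addNr add0r -scaleN1r innerZr mulN1r.
have {}c6 := c6 (dnbhs_filter (0 : RR)); rewrite E in c6.
apply: (cvg_eqfun _ c6) => h /=.
have p0 (u : RR) : 0 <= Num.max u 0 by rewrite le_max lexx orbT.
rewrite fctE mul1r -!hTstar //; have -> : s - sigma + h = s + h - sigma by rewrite addrAC.
rewrite innerZr innerZl -mulrDr innerBr innerBl (max_l (ltW ss0)) (max_l (ltW ts0)) -/w -/v.
by congr (_ * _); ring.
Qed.

End bounded_perturbation.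

(** * Mild solutions *)

(** On each of the finitely many level sets of [k] the function is some [h z] with z fixed. This
    reduces statements on simple functions to constants. *)
Lemma measurable_fun_finite_case d (T : measurableType d) (R : realType) (Z : Type)
    (D : set T) (k : T -> Z) (h : Z -> T -> R) :
  finite_set (k @` D) -> (forall z, measurable (D `&` k @^-1` [set z])) ->
  (forall z, measurable_fun D (h z)) -> measurable_fun D (fun x => h (k x) x).
Proof.
move=> fk mk mh mD B mB.
have -> : D `&` (fun x => h (k x) x) @^-1` B =
    \bigcup_(z in k @` D) ((D `&` k @^-1` [set z]) `&` (D `&` h z @^-1` B)).
  apply/seteqP; split => x /=.
    by move=> [Dx hB]; exists (k x); [exists x|].
  by move=> [z _ [[Dx kz] [_ hB]]]; split=> //; move: hB; rewrite -kz.
apply: fin_bigcup_measurable => // z _; apply: measurableI; first exact: mk.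
exact: mh.
Qed.

(** * Strong measurability and Borel representatives *)

Section strongly_measurable.
Variable X : hilbertSpace.
Implicit Types (f g : RR -> X).
Local Notation mR := (measurableTypeR RR).

(* Pointwise limits of simple functions at every point, not only almost
   everywhere: these are Borel. *)
Definition borel_on (a b : RR) f := exists g : nat -> RR -> X,
  (forall n, simple_on a b (g n)) /\
  forall s, s \in `[a, b] -> (fun n => g n s) @ \oo --> f s.

(** A level set of the composition is a finite union of level sets of [k], whatever [F] is. *)
Lemma simple_on_comp (a b : RR) (Z : Type) (k : RR -> Z) (F : Z -> X) :
  finite_set (k @` `[a, b]) ->
  (forall z, @measurable _ mR (`[a, b] `&` k @^-1` [set z])) -> simple_on a b (F \o k).
Proof.
move=> fk mk; split.
  by rewrite -image_comp; exact: finite_image.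
move=> y.
have -> : `[a, b] `&` (F \o k) @^-1` [set y] =
    \bigcup_(z in k @` `[a, b]) ((`[a, b] `&` k @^-1` [set z]) `&` [set s | F z = y]).
  apply/seteqP; split => s /=.
    by move=> [sab Fy]; exists (k s); [exists s|].
  by move=> [z _ [[sab kz] Fy]]; split=> //; rewrite kz.
apply: fin_bigcup_measurable => // z _; apply: measurableI; first exact: mk.
have [zy|zy] := pselect (F z = y).
  by rewrite (_ : [set _ | _] = setT) //; apply/seteqP; split.
by rewrite (_ : [set _ | _] = set0) //; apply/seteqP; split.
Qed.

Lemma simple_on_pair (a b : RR) (Z W : Type) (k : RR -> Z) (l : RR -> W) :
  finite_set (k @` `[a, b]) -> finite_set (l @` `[a, b]) ->
  (forall z, @measurable _ mR (`[a, b] `&` k @^-1` [set z])) ->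
  (forall w, @measurable _ mR (`[a, b] `&` l @^-1` [set w])) ->
  finite_set ((fun s => (k s, l s)) @` `[a, b]) /\
  (forall p, @measurable _ mR (`[a, b] `&` (fun s => (k s, l s)) @^-1` [set p])).
Proof.
move=> fk fl mk ml; split.
  apply: (@sub_finite_set _ _ ((k @` `[a, b]) `*` (l @` `[a, b]))); last exact: finite_setX.
  by move=> _ [s sab <-]; split => /=; exists s.
move=> [z w].
have -> : `[a, b] `&` (fun s => (k s, l s)) @^-1` [set (z, w)] =
    (`[a, b] `&` k @^-1` [set z]) `&` (`[a, b] `&` l @^-1` [set w]).
  apply/seteqP; split => s /= => [[sab [kz lw]]|[[sab kz] [_ lw]]]; first by split.
  by split=> //; rewrite kz lw.
by apply: measurableI.
Qed.

Lemma simple_on_add (a b : RR) f g : simple_on a b f -> simple_on a b g ->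
  simple_on a b (fun s => f s + g s).
Proof.
move=> [ff mf] [fg mg]; have [fp mp] := simple_on_pair ff fg mf mg.
exact: (simple_on_comp (fun p : X * X => p.1 + p.2) fp mp).
Qed.

Lemma borel_on_add (a b : RR) f g : borel_on a b f -> borel_on a b g ->
  borel_on a b (fun s => f s + g s).
Proof.
move=> [u [su uf]] [v [sv vg]]; exists (fun n s => u n s + v n s); split.
  by move=> n; exact: simple_on_add.
by move=> s sab; apply: cvgD; [exact: uf|exact: vg].
Qed.

(** Compose [f] with simple approximations of the identity. These are available for nonnegative
    functions, so the interval starts at 0. *)
Lemma borel_on_continuous (b : RR) f : continuous f -> borel_on 0 b f.
Proof.
move=> cf.
have mi : measurable_fun (`[0, b] : set mR) (fun s : mR => (s : RR)%:E).
  by apply/measurable_EFinP; exact: measurable_id.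
have mD : measurable (`[0, b] : set mR) by exact: measurable_itv.
pose u := nnsfun_approx mD mi.
exists (fun n s => f (u n s)); split=> [n|s s0b].
  apply: (simple_on_comp f (k := fun s => u n s)).
    by apply: (@sub_finite_set _ _ (range (u n))); [move=> _ [s _ <-]; exists s|exact: fimfunP].
  move=> z; apply: measurableI => //; exact: measurable_sfunP.
have c : (fun n => u n s) @ \oo --> s.
  have := @cvg_nnsfun_approx _ _ _ _ mD _ mi.
  move=> /(_ _ s s0b) h; apply: (fine_cvg (h _)) => t.
  by rewrite /= in_itv/= lee_fin => /andP[].
exact: (cvg_comp _ _ c (cf s)).
Qed.

Lemma simple_on_refl (b : RR) f : simple_on 0 b f -> simple_on 0 b (fun s => f (b - s)).
Proof.
move=> [ff mf]; split.
  apply: sub_finite_set ff => _ [s sb <-]; exists (b - s) => //.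
  by move: sb; rewrite /= !in_itv/= => /andP[? ?]; apply/andP; split; lra.
move=> y; have mr : measurable_fun setT (fun s : mR => b - s : mR).
  apply: (@continuous_measurable_fun RR) => s.
  by apply: (@cvgB _ RR^o); [exact: cvg_cst|exact: cvg_id].
have := mr measurableT _ (mf y); rewrite setTI; congr (measurable _).
apply/seteqP; split => s /=; rewrite !in_itv/=; move=> [/andP[? ?] ?]; split=> //;
  by apply/andP; split; lra.
Qed.

Lemma borel_on_refl (b : RR) f : borel_on 0 b f -> borel_on 0 b (fun s => f (b - s)).
Proof.
move=> [u [su uf]]; exists (fun n s => u n (b - s)); split.
  by move=> n; exact: simple_on_refl.
move=> s sb; apply: uf.
by move: sb; rewrite !in_itv/= => /andP[? ?]; apply/andP; split; lra.
Qed.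

(** The function and its approximants are set to 0 on a measurable null set containing all points of
    divergence; convergence then holds everywhere and the approximants stay simple. *)
Lemma strongly_measurable_borel (a b : RR) f : strongly_measurable_on a b f ->
  exists f' : RR -> X, borel_on a b f' /\ exists N : set mR,
    [/\ measurable N, leb N = 0%E & forall s, s \in `[a, b] -> ~ N s -> f s = f' s].
Proof.
move=> [u [su [N [mN N0 hN]]]].
pose cut (g : RR -> X) s := if `[< N s >] then 0 else g s.
exists (cut f); split; last first.
  by exists N; split=> // s _ Ns; rewrite /cut; case: asboolP.
exists (fun n => cut (u n)); split=> [n|s sab]; last first.
  rewrite /cut; case: asboolP => Ns; first exact: cvg_cst.
  by apply: contrapT => h; apply: Ns; apply: hN => /=; move=> h'; apply: h; exact: h'.
have [fu mu] := su n.
pose k s := `[< N s >].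
have fk : finite_set (k @` `[a, b]) by exact: finite_finset.
have mk z : @measurable _ mR (`[a, b] `&` k @^-1` [set z]).
  apply: measurableI; first exact: measurable_itv.
  case: z.
    rewrite (_ : _ @^-1` _ = N) //; apply/seteqP; split => s; rewrite /= /k.
      by move/asboolP.
    by move=> ?; apply/asboolP.
  rewrite (_ : _ @^-1` _ = ~` N); first exact: measurableC.
  by apply/seteqP; split => s; rewrite /= /k; [move/asboolP|move=> ?; apply/asboolP].
have [fp mp] := simple_on_pair fk fu mk mu.
exact: (simple_on_comp (fun p : bool * X => if p.1 then 0 else p.2) fp mp).
Qed.

Lemma measurable_norm_borel (a b : RR) f : borel_on a b f ->
  @measurable_fun _ _ mR mR `[a, b] (fun s => `|f s|).
Proof.
move=> [u [su uf]].
apply: (@measurable_fun_cvg _ mR RR _ (fun n s => `|u n s|)) => //.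
  move=> n; have [fu mu] := su n.
  exact: (@measurable_fun_finite_case _ mR RR X _ _ (fun z _ => `|z|) fu mu).
by move=> s sab; apply: cvg_norm; exact: uf.
Qed.

(** With [f] simple only inner products of [q] with finitely many fixed vectors occur, so weak
    measurability of [q] suffices. *)
Lemma measurable_inner_borel (a b : RR) f (q : RR -> X) : borel_on a b f ->
  (forall z, @measurable_fun _ _ mR mR `[a, b] (fun s => inner z (q s))) ->
  @measurable_fun _ _ mR mR `[a, b] (fun s => inner (f s) (q s)).
Proof.
move=> [u [su uf]] mq.
apply: (@measurable_fun_cvg _ mR RR _ (fun n s => inner (u n s) (q s))) => //.
  move=> n; have [fu mu] := su n.
  exact: (@measurable_fun_finite_case _ mR RR X _ _ (fun z s => inner z (q s)) fu mu).
by move=> s sab; apply: cvg_inner; [exact: uf|exact: cvg_cst].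
Qed.

(** For simple [f] and [g] the kernel is, piece by piece, a continuous function of the time
    difference; the limit in [f] and [g] is taken at each fixed pair of times. *)
Lemma measurable_kernel (V : RR -> X -> X) (b : RR) f g : weak_semigroup V ->
  borel_on 0 b f -> borel_on 0 b g ->
  @measurable_fun _ _ (mR * mR)%type mR (triangle b)
    (fun p => inner (f p.1) (V (Num.max (p.2 - p.1) 0) (g p.2))).
Proof.
move=> wV [u [su uf]] [v [sv vg]]; have [_ lV bV cV] := wV.
have mt : @measurable _ (mR * mR)%type (triangle (b : Real.sort RR)).
  exact: (@measurable_triangle RR).
apply: (@measurable_fun_cvg _ (mR * mR)%type RR _
  (fun n p => inner (u n p.1) (V (Num.max (p.2 - p.1) 0) (v n p.2)))) => //.
  move=> n; have [fu mu] := su n; have [fv mv] := sv n.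
  apply: (@measurable_fun_finite_case _ (mR * mR)%type RR (X * X)%type (triangle (b : Real.sort RR))
    (fun p => (u n p.1, v n p.2))
    (fun z p => inner z.1 (V (Num.max (p.2 - p.1) 0) z.2))).
  - apply: (@sub_finite_set _ _ ((u n @` `[0, b]) `*` (v n @` `[0, b]))); last exact: finite_setX.
    move=> _ [[r s] /and3P[/= r0 rs sb] <-]; split => /=.
      by exists r => //=; rewrite in_itv/= r0 (le_trans rs).
    by exists s => //=; rewrite in_itv/= sb (le_trans r0).
  - move=> [z w].
    have -> : triangle (b : Real.sort RR) `&` (fun p => (u n p.1, v n p.2)) @^-1` [set (z, w)] =
        triangle (b : Real.sort RR) `&`
          ((`[0, b] `&` u n @^-1` [set z]) `*` (`[0, b] `&` v n @^-1` [set w])).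
      apply/seteqP; split => [[r s]|[r s]] /=.
        move=> [/and3P[/= r0 rs sb] [uz vw]].
        split; first exact/and3P.
        by split; split => //; rewrite in_itv/= ?r0 ?sb ?(le_trans rs) ?(le_trans r0).
      by move=> [h [[_ uz] [_ vw]]]; split=> //; rewrite uz vw.
    by apply: measurableI => //; apply: measurableX.
  - move=> [z w]; apply: measurable_funTS.
    have cz : continuous (fun t : RR => inner z (V (Num.max t 0) w)).
      by move=> t; apply: (cV RR (nbhs t)); [exact: cvg_id|exact: cvg_cst].
    have m1 : measurable_fun setT (fst : mR * mR -> mR) by exact: measurable_fst.
    have m2 : measurable_fun setT (snd : mR * mR -> mR) by exact: measurable_snd.
    have mc := @continuous_measurable_fun RR _ cz.
    exact: (measurableT_comp mc (measurable_funB m2 m1)).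
move=> [r s] /and3P[/= r0 rs sb]; apply: cvg_inner.
  by apply: uf; rewrite in_itv/= r0 (le_trans rs).
have p0 : 0 <= Num.max (s - r) 0 by rewrite le_max lexx orbT.
have bVs : bounded_linear (V (Num.max (s - r) 0)).
  split; first exact: lV.
  by have [M [_ hM]] := bV (Num.max (s - r) 0); exists M => x; exact: hM.
have h : (fun n => v n s) @ \oo --> g s by apply: vg; rewrite in_itv/= sb (le_trans r0).
exact: (cvg_comp _ _ h (continuous_of_bounded_linear bVs (x := g s))).
Qed.

End strongly_measurable.

(** * Mild equations and the energy identity *)

Section mild.
Variable X : hilbertSpace.
Implicit Types (f g : RR -> X) (V S : RR -> X -> X).
Local Notation mR := (measurableTypeR RR).

Definition integrable_on (a b : RR) f := borel_on a b f /\
  leb.-integrable `[a, b] (EFin \o (fun s => `|f s|)).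

(** The semigroup acts on the test vector: the state satisfies this with the adjoint of [T] as V,
    the time-reversed costate with [T] itself. *)
Definition mild V (b : RR) (m : RR -> X) (r : X) f := forall t, t \in `[0, b] ->
  forall y, inner (m t) y = inner r (V t y) +
    Rintegral leb `[0, t] (fun s => inner (f s) (V (t - s) y)).

Lemma borel_on_sub (b t : RR) f : t <= b -> borel_on 0 b f -> borel_on 0 t f.
Proof.
move=> tb [u [su uf]].
have sub : (`[0, t] `<=` `[0, b])%classic.
  by move=> s; rewrite /= !in_itv/= => /andP[-> st]; exact: le_trans st tb.
exists u; split=> [n|s /sub/uf//]; have [fu mu] := su n; split.
  by apply: sub_finite_set fu => _ [s /sub sb <-]; exists s.
move=> y; have -> : `[0, t] `&` u n @^-1` [set y] = `[0, t] `&` (`[0, b] `&` u n @^-1` [set y]).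
  by apply/seteqP; split => s /=; [move=> [/[dup] /sub]|move=> [? [_ ?]]].
by apply: measurableI; first exact: measurable_itv.
Qed.

Lemma integrable_on_sub (b t : RR) f : t <= b -> integrable_on 0 b f -> integrable_on 0 t f.
Proof.
move=> tb [bf fi]; split; first exact: borel_on_sub bf.
apply: integrableS fi => //.
by move=> s; rewrite /= !in_itv/= => /andP[-> st]; exact: le_trans st tb.
Qed.

Lemma integrable_on_continuous (b : RR) f : continuous f -> integrable_on 0 b f.
Proof.
move=> cf; split; first exact: borel_on_continuous.
apply: (@continuous_integrable RR _ 0 b) => s.
by apply: cvg_norm; exact: cf.
Qed.

Lemma integrable_on_add (b : RR) f g : integrable_on 0 b f -> integrable_on 0 b g ->
  integrable_on 0 b (fun s => f s + g s).
Proof.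
move=> [bf fi] [bg gi]; have bfg := borel_on_add bf bg; split=> //.
apply: (@le_integrable _ _ _ leb _ (measurable_itv _) _ (EFin \o (fun s => `|f s| + `|g s|))).
- by apply/measurable_EFinP; exact: measurable_norm_borel bfg.
- by move=> s _; rewrite /= !lee_fin !ger0_norm ?addr_ge0 // ler_normD.
- exact: (@integrableD _ _ _ leb _ (measurable_itv _) _ _ fi gi).
Qed.

Lemma integrable_inner (b M : RR) f (q : RR -> X) : integrable_on 0 b f ->
  (forall z, @measurable_fun _ _ mR mR `[0, b] (fun s => inner z (q s))) ->
  (forall s, s \in `[0, b] -> `|q s| <= M) ->
  leb.-integrable `[0, b] (EFin \o (fun s => inner (f s) (q s))).
Proof.
move=> [bf fi] mq qM.
apply: (@le_integrable _ _ _ leb _ (measurable_itv _) _ (fun s => ((`|M|)%:E * (`|f s|)%:E)%E)).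
- by apply/measurable_EFinP; exact: measurable_inner_borel.
- move=> s sb; rewrite -EFinM !abse_EFin lee_fin [leRHS]ger0_norm ?mulr_ge0 // mulrC.
  apply: le_trans (cauchy_schwarz _ _) _; rewrite ler_wpM2l //.
  by apply: le_trans (qM s sb) _; exact: ler_norm.
- exact: (@integrableZl _ _ _ leb _ (measurable_itv _) _ _ fi).
Qed.

Lemma Fubini_kernel V (b : RR) f g : weak_semigroup V -> integrable_on 0 b f ->
  integrable_on 0 b g ->
  Rintegral leb `[0, b] (fun s => Rintegral leb `[0, s] (fun r => inner (f r) (V (s - r) (g s)))) =
  Rintegral leb `[0, b] (fun r => Rintegral leb `[r, b] (fun s => inner (f r) (V (s - r) (g s)))).
Proof.
move=> wV [bf fi] [bg gi]; have [_ _ bV _] := wV; have [M [M0 hM]] := bV b.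
pose K r s := inner (f r) (V (Num.max (s - r) 0) (g s)).
have := @Fubini_triangle RR b K (fun r => M * `|f r|) (fun s => `|g s|)
  (measurable_kernel wV bf bg) (@integrableZl _ _ _ leb _ (measurable_itv _) M _ fi) gi.
have H r s : 0 <= r -> r <= s -> s <= b -> `|K r s| <= M * `|f r| * `|g s|.
  move=> r0 rs sb; rewrite /K max_l ?subr_ge0 //; apply: le_trans (cauchy_schwarz _ _) _.
  rewrite [M * _]mulrC -mulrA ler_wpM2l //; apply: hM; first by rewrite subr_ge0.
  by apply: le_trans sb; rewrite gerBl.
move=> /(_ H) E.
transitivity (Rintegral leb `[0, b] (fun s => Rintegral leb `[0, s] (fun r => K r s))).
  apply: eq_Rintegral => s _; apply: eq_Rintegral => r; rewrite inE /= in_itv/= => /andP[_ rs].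
  by rewrite /K max_l ?subr_ge0.
transitivity (Rintegral leb `[0, b] (fun r => Rintegral leb `[r, b] (K r))); first exact: E.
apply: eq_Rintegral => r _; apply: eq_Rintegral => s; rewrite inE /= in_itv/= => /andP[rs _].
by rewrite /K max_l ?subr_ge0.
Qed.

(** Replacing V by S in the mild equation changes the terms in [r] and [f] by Duhamel integrals.
    These add up to the integral of the mild equation at time s tested with P S (t - s) y, which is
    the last term. *)
Lemma mild_transfer V S (P : X -> X) (b : RR) m r f :
  weak_semigroup V -> C0_semigroup S -> bounded_linear P -> duhamel V S P ->
  continuous m -> integrable_on 0 b f -> mild V b m r f ->
  forall t, t \in `[0, b] -> forall y,
  inner (m t) y = inner r (S t y) +
    Rintegral leb `[0, t] (fun s => inner (f s) (S (t - s) y)) -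
    Rintegral leb `[0, t] (fun s => inner (m s) (P (S (t - s) y))).
Proof.
move=> wV hS bP dVS cm fi hm t tb y; have [_ lV bV cV] := wV.
have /andP[t0 tb'] : 0 <= t <= b by move: tb; rewrite in_itv.
have fit := integrable_on_sub tb' fi.
have [MV [MV0 hMV]] := bV t; have [MS [MS0 hMS]] := C0_local_bound hS t.
pose q s := P (S (Num.max (t - s) 0) y).
have cS : continuous (fun s : RR => S (Num.max (t - s) 0) y).
  move=> s; apply: C0_cvg => //; last exact: cvg_cst.
  by apply: (@cvgB _ RR^o); [exact: cvg_cst|exact: cvg_id].
have cq : continuous q.
  move=> s; exact: (cvg_comp _ _ (cS s) (continuous_of_bounded_linear bP (x := S (Num.max (t - s) 0) y))).
have qi := integrable_on_continuous t cq.
have c1 : continuous (fun s : RR => inner (m s) (q s)).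
  by move=> s; apply: cvg_inner; [exact: cm|exact: cq].
have c2 : continuous (fun s : RR => inner r (V (Num.max s 0) (q s))).
  by move=> s; apply: (cV RR (nbhs s)); [exact: cvg_id|exact: cq].
have i1 : leb.-integrable `[0, t] (EFin \o (fun s => inner (m s) (q s))).
  exact: (@continuous_integrable RR _ 0 t c1).
have i2 : leb.-integrable `[0, t] (EFin \o (fun s => inner r (V (Num.max s 0) (q s)))).
  exact: (@continuous_integrable RR _ 0 t c2).
have E1 : Rintegral leb `[0, t] (fun s => inner (m s) (P (S (t - s) y))) =
    Rintegral leb `[0, t] (fun s => inner (m s) (q s)).
  by apply: eq_Rintegral => s; rewrite inE /= in_itv/= => /andP[_ st]; rewrite /q max_l ?subr_ge0.
(* The mild equation at time s is tested with q s, and the result is integrated over [0, t]. *)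
have E2 : Rintegral leb `[0, t] (fun s => inner (m s) (q s)) -
    Rintegral leb `[0, t] (fun s => inner r (V (Num.max s 0) (q s))) =
    Rintegral leb `[0, t] (fun s => Rintegral leb `[0, s] (fun u => inner (f u) (V (s - u) (q s)))).
  rewrite -(@RintegralB _ _ RR leb `[0, t]%classic); [|exact: measurable_itv|exact: i1|exact: i2].
  apply: eq_Rintegral => s; rewrite inE /= in_itv/= => /andP[s0 st].
  by rewrite hm ?in_itv/= ?s0 ?(le_trans st) // max_l // addrAC subrr add0r.
(* Duhamel's formula from time 0 for the initial value. *)
have E3 : Rintegral leb `[0, t] (fun s => inner r (V (Num.max s 0) (q s))) =
    inner r (S t y) - inner r (V t y).
  have := dVS 0 t r y (lexx _) t0; rewrite subr0 => ->.
  apply: eq_Rintegral => s; rewrite inE /= in_itv/= => /andP[s0 st].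
  by rewrite /q max_l // max_l ?subr_ge0 // subr0.
have mS z : @measurable_fun _ _ mR mR `[0, t] (fun s => inner z (S (Num.max (t - s) 0) y)).
  apply: measurable_funTS; apply: (@continuous_measurable_fun RR) => s.
  by apply: cvg_inner; [exact: cvg_cst|exact: cS].
have mV z : @measurable_fun _ _ mR mR `[0, t] (fun s => inner z (V (Num.max (t - s) 0) y)).
  apply: measurable_funTS; apply: (@continuous_measurable_fun RR) => s.
  apply: (cV RR (nbhs s)); last exact: cvg_cst.
  by apply: (@cvgB _ RR^o); [exact: cvg_cst|exact: cvg_id].
have tst s : s \in `[0, t] -> [/\ 0 <= t - s, t - s <= t & Num.max (t - s) 0 = t - s].
  by rewrite in_itv/= => /andP[s0 st]; rewrite max_l subr_ge0 ?gerBl.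
have i3 : leb.-integrable `[0, t] (EFin \o (fun s => inner (f s) (S (Num.max (t - s) 0) y))).
  apply: (@integrable_inner t (MS * `|y|)) => // s /tst[? ? ->]; exact: hMS.
have i4 : leb.-integrable `[0, t] (EFin \o (fun s => inner (f s) (V (Num.max (t - s) 0) y))).
  apply: (@integrable_inner t (MV * `|y|)) => // s /tst[? ? ->]; exact: hMV.
(* After Fubini the inner integral is Duhamel's formula from time u, tested against f u. *)
have E4 : Rintegral leb `[0, t] (fun s => Rintegral leb `[0, s] (fun u => inner (f u) (V (s - u) (q s)))) =
    Rintegral leb `[0, t] (fun s => inner (f s) (S (t - s) y)) -
    Rintegral leb `[0, t] (fun s => inner (f s) (V (t - s) y)).
  rewrite (Fubini_kernel wV fit qi).
  transitivity (Rintegral leb `[0, t] (fun s => inner (f s) (S (Num.max (t - s) 0) y)) -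
    Rintegral leb `[0, t] (fun s => inner (f s) (V (Num.max (t - s) 0) y))); last first.
    by congr (_ - _); apply: eq_Rintegral => s /set_mem /tst[_ _ ->].
  rewrite -(@RintegralB _ _ RR leb `[0, t]%classic); [|exact: measurable_itv|exact: i3|exact: i4].
  apply: eq_Rintegral => u /set_mem ut; have [_ _ ->] := tst u ut.
  move: ut; rewrite /= in_itv/= => /andP[u0 ut].
  rewrite (dVS u t (f u) y u0 ut); apply: eq_Rintegral => s; rewrite inE /= in_itv/= => /andP[us st].
  by rewrite /q max_l // subr_ge0.
have := hm t tb y; rewrite E1 => ->.
by move: E2; rewrite E3 E4 => /eqP; rewrite subr_eq => /eqP ->; ring.
Qed.

(** Inserting the costate equation into <f, l> and the state equation into <g, x> produces the same
    kernel <f u, W (s - u) g s>, integrated over the triangle in the two orders. What remains are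
    the terms with r2 and r4. *)
Lemma energy_identity V W (b : RR) (x l : RR -> X) (r4 r2 : X) f g :
  0 <= b -> C0_semigroup V -> (forall t, 0 <= t -> is_adjoint (V t) (W t)) ->
  continuous x -> continuous l -> integrable_on 0 b f -> integrable_on 0 b g ->
  mild W b x r4 f ->
  (forall t, t \in `[0, b] -> forall y, inner (l t) y = inner r2 (V (b - t) y) +
    Rintegral leb `[t, b] (fun s => inner (g s) (V (s - t) y))) ->
  inner (x b) r2 - inner (l 0) r4 =
  Rintegral leb `[0, b] (fun s => inner (f s) (l s)) -
  Rintegral leb `[0, b] (fun s => inner (g s) (x s)).
Proof.
move=> b0 hV hVW cx cl fi gi hx hl.
have wW := adjoint_weak_semigroup hV hVW; have [_ _ bW cW] := wW.
have [MW [MW0 hMW]] := bW b; have [MV [MV0 hMV]] := C0_local_bound hV b.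
have cb : continuous (fun s : RR => b - s).
  by move=> s; apply: (@cvgB _ RR^o); [exact: cvg_cst|exact: cvg_id].
have bound (q : RR -> X) : continuous q -> exists M : RR, forall s, s \in `[0, b] -> `|q s| <= M.
  move=> cq; have cn : {within `[0, b], continuous (fun s => `|q s|)}.
    by apply: continuous_subspaceT => s; apply: cvg_norm; exact: cq.
  by have [c _ hc] := @EVT_max RR _ 0 b b0 cn; exists `|q c|.
have mc (q : RR -> X) : continuous q ->
    forall z, @measurable_fun _ _ mR mR `[0, b] (fun s => inner z (q s)).
  move=> cq z; apply: measurable_funTS; apply: (@continuous_measurable_fun RR) => s.
  by apply: cvg_inner; [exact: cvg_cst|exact: cq].
have i1 : leb.-integrable `[0, b] (EFin \o (fun s => inner (f s) (l s))).
  by have [M hM] := bound _ cl; apply: (integrable_inner fi (mc _ cl) hM).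
have i2 : leb.-integrable `[0, b] (EFin \o (fun s => inner (g s) (x s))).
  by have [M hM] := bound _ cx; apply: (integrable_inner gi (mc _ cx) hM).
have bs s : s \in `[0, b] -> [/\ 0 <= s, s <= b, 0 <= b - s, b - s <= b & Num.max (b - s) 0 = b - s].
  by rewrite in_itv/= => /andP[s0 sb]; rewrite max_l ?subr_ge0 ?gerBl.
have i3 : leb.-integrable `[0, b] (EFin \o (fun s => inner (f s) (W (Num.max (b - s) 0) r2))).
  apply: (@integrable_inner b (MW * `|r2|)) => //.
    move=> z; apply: measurable_funTS; apply: (@continuous_measurable_fun RR) => s.
    by apply: (cW RR (nbhs s)); [exact: cb|exact: cvg_cst].
  by move=> s /bs[_ _ ? ? ->]; exact: hMW.
have i4 : leb.-integrable `[0, b] (EFin \o (fun s => inner (g s) (V (Num.max s 0) r4))).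
  apply: (@integrable_inner b (MV * `|r4|)) => //.
    by apply: mc; exact: C0_continuous_clamp.
  by move=> s /bs[s0 sb _ _ _]; rewrite max_l //; exact: hMV.
have E1 : Rintegral leb `[0, b] (fun s => inner (f s) (l s)) -
    Rintegral leb `[0, b] (fun s => inner (f s) (W (Num.max (b - s) 0) r2)) =
    Rintegral leb `[0, b] (fun s => Rintegral leb `[s, b] (fun u => inner (f s) (W (u - s) (g u)))).
  rewrite -(@RintegralB _ _ RR leb `[0, b]%classic); [|exact: measurable_itv|exact: i1|exact: i3].
  apply: eq_Rintegral => s /set_mem sb; have [s0 sb' bs0 _ ->] := bs s sb.
  rewrite -hVW // inner_sym hl // (inner_sym r2) addrAC subrr add0r.
  apply: eq_Rintegral => u; rewrite inE /= in_itv/= => /andP[su ub].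
  by rewrite -hVW ?subr_ge0 // inner_sym.
have E2 : Rintegral leb `[0, b] (fun s => inner (g s) (x s)) -
    Rintegral leb `[0, b] (fun s => inner (g s) (V (Num.max s 0) r4)) =
    Rintegral leb `[0, b] (fun s => Rintegral leb `[0, s] (fun u => inner (f u) (W (s - u) (g s)))).
  rewrite -(@RintegralB _ _ RR leb `[0, b]%classic); [|exact: measurable_itv|exact: i2|exact: i4].
  apply: eq_Rintegral => s /set_mem sb; have [s0 sb' bs0 _ _] := bs s sb.
  by rewrite inner_sym hx // max_l // -(hVW s s0) (inner_sym (V s r4)) addrAC subrr add0r.
(* This and the next identity are the state equation at time b tested with r2 and the costate
   equation at time 0 tested with r4. *)
have E3 : Rintegral leb `[0, b] (fun s => inner (f s) (W (Num.max (b - s) 0) r2)) =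
    inner (x b) r2 - inner r4 (W b r2).
  rewrite hx ?in_itv/= ?b0 ?lexx // addrAC subrr add0r.
  by apply: eq_Rintegral => s /set_mem sb; have [_ _ _ _ ->] := bs s sb.
have E4 : Rintegral leb `[0, b] (fun s => inner (g s) (V (Num.max s 0) r4)) =
    inner (l 0) r4 - inner r2 (V b r4).
  rewrite hl ?in_itv/= ?b0 ?lexx // subr0 addrAC subrr add0r.
  by apply: eq_Rintegral => s /set_mem sb; have [s0 _ _ _ _] := bs s sb; rewrite max_l // subr0.
have E5 : inner r2 (V b r4) = inner r4 (W b r2) by rewrite inner_sym hVW.
rewrite (Fubini_kernel wW fi gi) -E1 E3 E4 E5 in E2.
move: E2 => /eqP; rewrite subr_eq => /eqP ->; ring.
Qed.

End mild.

(** * Pairings and elementary inequalities *)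

Section sums_of_bounds.
Context {R : realType}.
Local Notation mu := (@lebesgue_measure R).
Variable D : set R.
Hypothesis mD : measurable D.

Lemma ge0_integral_add_le (g h : R -> R) (a b : R) :
  measurable_fun D g -> measurable_fun D h ->
  (forall s, D s -> 0 <= g s) -> (forall s, D s -> 0 <= h s) ->
  (\int[mu]_(s in D) (g s)%:E <= a%:E)%E -> (\int[mu]_(s in D) (h s)%:E <= b%:E)%E ->
  (\int[mu]_(s in D) (g s + h s)%:E <= (a + b)%:E)%E.
Proof.
move=> mg mh g0 h0 ga hb.
have -> : (\int[mu]_(s in D) (g s + h s)%:E = \int[mu]_(s in D) ((g s)%:E + (h s)%:E))%E by [].
rewrite ge0_integralD //; first by rewrite EFinD; apply: leeD.
  exact/measurable_EFinP.
exact/measurable_EFinP.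
Qed.

Lemma ge0_integral_scale_le (c a : R) (g : R -> R) : 0 <= c -> measurable_fun D g ->
  (forall s, D s -> 0 <= g s) -> (\int[mu]_(s in D) (g s)%:E <= a%:E)%E ->
  (\int[mu]_(s in D) (c * g s)%:E <= (c * a)%:E)%E.
Proof.
move=> c0 mg g0 ga.
have -> : (\int[mu]_(s in D) (c * g s)%:E = \int[mu]_(s in D) (c%:E * (g s)%:E))%E by [].
rewrite ge0_integralZl //; first by rewrite EFinM; apply: lee_wpmul2l.
exact/measurable_EFinP.
Qed.

(** [w] is bounded by n both in L^2 and pointwise, so it pairs with [u] whether p bounds the L^1
    norm or the L^2 norm of [u]. *)
Lemma integral_pairing_le (u w : R -> R) (p n : R) :
  measurable_fun D u -> measurable_fun D w ->
  (forall s, D s -> 0 <= u s) -> (forall s, D s -> 0 <= w s <= n) -> 0 <= p -> 0 <= n ->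
  (\int[mu]_(s in D) (u s)%:E <= p%:E)%E \/
    (\int[mu]_(s in D) (u s ^+ 2)%:E <= (p ^+ 2)%:E)%E ->
  (\int[mu]_(s in D) (w s ^+ 2)%:E <= (n ^+ 2)%:E)%E ->
  (\int[mu]_(s in D) (u s * w s)%:E <= (p * n)%:E)%E.
Proof.
move=> mu_ mw u0 wn p0 n0 [up|up] wn2.
  apply: (@le_trans _ _ (\int[mu]_(s in D) (n * u s)%:E)%E); last first.
    by rewrite mulrC; exact: ge0_integral_scale_le.
  apply: ge0_le_integral => //.
  - by move=> s Ds; rewrite lee_fin mulr_ge0 ?u0 //; case/andP: (wn s Ds).
  - by apply/measurable_EFinP; exact: measurable_funM.
  - by apply/measurable_EFinP; apply: measurable_funM => //; exact: measurable_cst.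
  - by move=> s Ds; rewrite lee_fin mulrC ler_wpM2r ?u0 //; case/andP: (wn s Ds).
have pn : 0 <= p * n by rewrite mulr_ge0.
rewrite -[X in (_ <= X%:E)%E](ger0_norm pn) -sqrtr_sqr exprMn.
apply: (@cauchy_schwarz_integral _ _ _ (fun s => u s ^+ 2) (fun s => w s ^+ 2)) => //.
- exact: measurable_funM.
- exact: measurable_funX.
- exact: measurable_funX.
- move=> s Ds; have /andP[w0 _] := wn s Ds.
  by split; rewrite ?sqr_ge0 ?mulr_ge0 ?u0 // exprMn.
- exact: sqr_ge0.
- exact: sqr_ge0.
Qed.

End sums_of_bounds.

Lemma ler_sqr_add4 (R : realFieldType) (a b c d : R) :
  (a + b + c + d) ^+ 2 <= 4 * (a ^+ 2 + b ^+ 2 + c ^+ 2 + d ^+ 2).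
Proof.
have := sqr_ge0 (a - b); have := sqr_ge0 (a - c); have := sqr_ge0 (a - d).
have := sqr_ge0 (b - c); have := sqr_ge0 (b - d); have := sqr_ge0 (c - d).
nra.
Qed.

(** The factor 2 is dictated by the squared version below, where a square of four summands costs a
    factor 4; one constant then serves both the sup bound and the L^2 bound. *)
Lemma scaled_sum_le (R : realFieldType) (M kk c2 c3 a b c d : R) : 0 < M -> 1 <= kk -> 0 <= c2 -> 0 <= c3 ->
    0 <= a -> 0 <= b -> 0 <= c -> 0 <= d ->
    M * (a + kk * b + c2 * (kk * c) + c3 * (kk * d)) <=
    2 * M * kk * (1 + c2 + c3) * (a + b + c + d).
Proof.
move=> M0' kk1' c20' c30' a0 b0' c0 d0.
have -> : 2 * M * kk * (1 + c2 + c3) * (a + b + c + d) =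
  M * (kk * (1 + c2 + c3) * (a + b + c + d)) + M * (kk * (1 + c2 + c3) * (a + b + c + d)) by ring.
rewrite -[leLHS]addr0; apply: lerD; last first.
  by rewrite !mulr_ge0 ?addr_ge0 // ?(ltW M0') // (le_trans ler01).
rewrite ler_wpM2l ?(ltW M0') //.
have kk0 : 0 <= kk by rewrite (le_trans ler01).
have e1 : a <= kk * a by rewrite ler_peMl.
have g1 : 0 <= kk * (c2 * a + c2 * b + c2 * d + c3 * a + c3 * b + c3 * c + c + d).
  by rewrite mulr_ge0 // !addr_ge0 // mulr_ge0.
have -> : kk * (1 + c2 + c3) * (a + b + c + d) = kk * a + kk * b + c2 * (kk * c) + c3 * (kk * d) +
  kk * (c2 * a + c2 * b + c2 * d + c3 * a + c3 * b + c3 * c + c + d) by ring.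
by rewrite -[leLHS]addr0; apply: lerD => //; do 3?apply: lerD.
Qed.

Lemma scaled_sqr_sum_le (R : realFieldType) (M kk c2 c3 a b c d : R) : 0 <= kk -> 0 <= c2 -> 0 <= c3 ->
    0 <= a -> 0 <= b -> 0 <= c -> 0 <= d ->
    4 * M ^+ 2 * ((kk * a) ^+ 2 + (kk * b) ^+ 2 + c2 ^+ 2 * (kk * c) ^+ 2 + c3 ^+ 2 * (kk * d) ^+ 2) <=
    (2 * M * kk * (1 + c2 + c3) * (a + b + c + d)) ^+ 2.
Proof.
move=> kk0 c20' c30' a0 b0' c0 d0.
have -> : (2 * M * kk * (1 + c2 + c3) * (a + b + c + d)) ^+ 2 =
  4 * M ^+ 2 * (kk ^+ 2 * ((1 + c2 + c3) * (a + b + c + d)) ^+ 2) by ring.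
have -> : (kk * a) ^+ 2 + (kk * b) ^+ 2 + c2 ^+ 2 * (kk * c) ^+ 2 + c3 ^+ 2 * (kk * d) ^+ 2 =
  kk ^+ 2 * (a ^+ 2 + b ^+ 2 + (c2 * c) ^+ 2 + (c3 * d) ^+ 2) by ring.
apply: ler_wpM2l; first by rewrite mulr_ge0 ?sqr_ge0.
apply: ler_wpM2l; first exact: sqr_ge0.
have x0 : 0 <= c2 * c by exact: mulr_ge0.
have y0 : 0 <= c3 * d by exact: mulr_ge0.
apply: (@le_trans _ _ ((a + b + c2 * c + c3 * d) ^+ 2)).
  move: (c2 * c) (c3 * d) x0 y0 => x y x0 y0.
  have g : 0 <= a * b + a * x + a * y + b * x + b * y + x * y by rewrite !addr_ge0 // mulr_ge0.
  have -> : (a + b + x + y) ^+ 2 = a ^+ 2 + b ^+ 2 + x ^+ 2 + y ^+ 2 +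
    2 * (a * b + a * x + a * y + b * x + b * y + x * y) by ring.
  by rewrite lerDl mulr_ge0.
rewrite ler_pXn2r ?nnegrE ?addr_ge0 ?mulr_ge0 ?addr_ge0 //.
have g : 0 <= c + d + c2 * (a + b + d) + c3 * (a + b + c) by rewrite !addr_ge0 ?mulr_ge0 ?addr_ge0.
have -> : (1 + c2 + c3) * (a + b + c + d) =
  a + b + c2 * c + c3 * d + (c + d + c2 * (a + b + d) + c3 * (a + b + c)) by ring.
by rewrite lerDl.
Qed.

(** Used with x = 1 / k: the integral of e^(-2 k t) is at most 1 / (2 k), and is to be bounded by
    the square of the convolution constant 1 + 1 / k. *)
Lemma half_le_sqr (R : realFieldType) (x : R) : 0 < x -> 2^-1 * x <= (1 + x) ^+ 2.
Proof.
move=> x0; have -> : (1 + x) ^+ 2 = 2^-1 * x + (1 + x ^+ 2 + (2 - 2^-1) * x) by ring.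
by rewrite lerDl !addr_ge0 ?sqr_ge0 // mulr_ge0 ?(ltW x0) //; lra.
Qed.

Lemma continuous_norm_sqr (X : hilbertSpace) (x : RR -> X) : continuous x ->
  continuous (fun s : RR => `|x s| ^+ 2).
Proof.
move=> cx s; have -> : (fun s : RR => `|x s| ^+ 2) = (fun s : RR => inner (x s) (x s)).
  by apply/funext => u; rewrite inner_norm.
by apply: cvg_inner; exact: cx.
Qed.

Lemma sqr_scaled_add4_le (R : realFieldType) (M c2 c3 a b c d : R) :
  (M * (a + b + c2 * c + c3 * d)) ^+ 2 <=
  4 * M ^+ 2 * (a ^+ 2 + b ^+ 2 + c2 ^+ 2 * c ^+ 2 + c3 ^+ 2 * d ^+ 2).
Proof.
have -> : 4 * M ^+ 2 * (a ^+ 2 + b ^+ 2 + c2 ^+ 2 * c ^+ 2 + c3 ^+ 2 * d ^+ 2) =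
  M ^+ 2 * (4 * (a ^+ 2 + b ^+ 2 + (c2 * c) ^+ 2 + (c3 * d) ^+ 2)) by ring.
by rewrite exprMn; apply: ler_wpM2l; [exact: sqr_ge0|exact: ler_sqr_add4].
Qed.

(** * Horizon-free estimate under a stable semigroup *)

Section mild_estimate.
Variable X : hilbertSpace.
Local Notation mR := (measurableTypeR RR).
Variables (S : RR -> X -> X) (P : X -> X) (M k b c2 c3 : RR) (m f : RR -> X) (r : X)
  (q1 q2 q3 : RR -> RR) (n1 n2 n3 : RR).
Hypotheses (M0 : 0 < M) (k0 : 0 < k) (b0 : 0 <= b) (c20 : 0 <= c2) (c30 : 0 <= c3)
  (hS : C0_semigroup S) (bP : bounded_linear P) (cm : continuous m) (fi : integrable_on 0 b f)
  (hSM : forall t x, 0 <= t -> `|S t x| <= M * expR (- (k * t)) * `|x|)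
  (hm : forall t, t \in `[0, b] -> forall y, inner (m t) y = inner r (S t y) +
    Rintegral leb `[0, t] (fun s => inner (f s) (S (t - s) y)) -
    Rintegral leb `[0, t] (fun s => inner (m s) (P (S (t - s) y))))
  (fq : forall s, s \in `[0, b] -> `|f s| <= q1 s + c2 * q2 s)
  (Pq : forall s z, s \in `[0, b] -> `|inner (m s) (P z)| <= c3 * q3 s * `|z|)
  (q10 : forall s, 0 <= q1 s) (q20 : forall s, 0 <= q2 s) (q30 : forall s, 0 <= q3 s)
  (i1 : leb.-integrable `[0, b] (EFin \o q1)) (i2 : leb.-integrable `[0, b] (EFin \o q2))
  (i3 : leb.-integrable `[0, b] (EFin \o q3))
  (n10 : 0 <= n1) (n20 : 0 <= n2) (n30 : 0 <= n3)
  (h1 : (\int[leb]_(s in `[0%R, b]) (q1 s)%:E <= n1%:E)%E \/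
    (\int[leb]_(s in `[0%R, b]) (q1 s ^+ 2)%:E <= (n1 ^+ 2)%:E)%E)
  (h2 : (\int[leb]_(s in `[0%R, b]) (q2 s ^+ 2)%:E <= (n2 ^+ 2)%:E)%E)
  (h3 : (\int[leb]_(s in `[0%R, b]) (q3 s ^+ 2)%:E <= (n3 ^+ 2)%:E)%E).

Let e (t : RR) (s : RR) : RR := expR (- (k * (t - s))).

Let e_ge0 t s : 0 <= e t s. Proof. exact: expR_ge0. Qed.

Let conv (q : RR -> RR) (t : RR) : RR := @convolution RR k q t.

Let integrable_eq (q : RR -> RR) t : t \in `[0, b] -> (forall s, 0 <= q s) ->
  leb.-integrable `[0, b] (EFin \o q) ->
  leb.-integrable `[0, t] (EFin \o (fun s => e t s * q s)).
Proof.
rewrite in_itv/= => /andP[t0 tb] q0 iq.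
have iqt : leb.-integrable `[0, t] (EFin \o q).
  apply: integrableS iq => //.
  by move=> s; rewrite /= !in_itv/= => /andP[-> st]; exact: le_trans st tb.
apply: (@le_integrable _ _ _ leb _ (measurable_itv _) _ (EFin \o q)) => //.
  apply/measurable_EFinP; apply: measurable_funM; first exact: (@measurable_expR_gap RR).
  by apply/measurable_EFinP; exact: measurable_int iqt.
move=> s; rewrite /= in_itv/= => /andP[s0 st]; rewrite lee_fin !ger0_norm ?mulr_ge0 //.
rewrite ler_piMl // -[leRHS]exp.expR0 ler_expR oppr_le0 mulr_ge0 ?(ltW k0) //.
by rewrite subr_ge0.
Qed.

(** The transferred equation is estimated under the integral for every test vector, so that the
    decay of S turns each majorant into an exponential convolution. Here q1 majorises the data, q2
    the coupling to the other unknown and q3 the perturbation term. *)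
Let pointwise t : t \in `[0, b] -> `|m t| <=
  M * (expR (- (k * t)) * `|r| + conv q1 t + c2 * conv q2 t + c3 * conv q3 t).
Proof.
move=> tb; have /andP[t0 tb'] : 0 <= t <= b by move: tb; rewrite in_itv.
have sub s : s \in `[0, t] -> s \in `[0, b].
  by rewrite !in_itv/= => /andP[-> st]; exact: le_trans st tb'.
have tst s : s \in `[0, t] -> [/\ 0 <= t - s, t - s <= t & Num.max (t - s) 0 = t - s].
  by rewrite in_itv/= => /andP[s0 st]; rewrite max_l subr_ge0 ?gerBl.
have fit := integrable_on_sub tb' fi.
have ie1 := integrable_eq tb q10 i1; have ie2 := integrable_eq tb q20 i2.
have ie3 := integrable_eq tb q30 i3.
have conv0 q : (forall s, 0 <= q s) -> 0 <= conv q t.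
  by move=> q0; apply: Rintegral_ge0 => s _; rewrite mulr_ge0.
apply: norm_le_inner.
  rewrite mulr_ge0 ?(ltW M0) // !addr_ge0 ?mulr_ge0 ?expR_ge0 ?conv0 //.
move=> y; have cS : continuous (fun s : RR => S (Num.max (t - s) 0) y).
  move=> s; apply: C0_cvg => //; last exact: cvg_cst.
  by apply: (@cvgB _ RR^o); [exact: cvg_cst|exact: cvg_id].
pose F s := inner (f s) (S (Num.max (t - s) 0) y).
pose G s := inner (m s) (P (S (Num.max (t - s) 0) y)).
have cG : continuous G.
  move=> s; apply: cvg_inner; first exact: cm.
  exact: (cvg_comp _ _ (cS s) (continuous_of_bounded_linear bP (x := S (Num.max (t - s) 0) y))).
have iG : leb.-integrable `[0, t] (EFin \o G) by exact: (@continuous_integrable RR _ 0 t cG).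
have Sb u : 0 <= u -> `|S u y| <= M * `|y|.
  move=> u0; apply: le_trans (hSM _ u0) _; rewrite ler_wpM2r // ler_piMr ?(ltW M0) //.
  by rewrite -[leRHS]exp.expR0 ler_expR oppr_le0 mulr_ge0 // ltW.
have iF : leb.-integrable `[0, t] (EFin \o F).
  apply: (@integrable_inner _ t (M * `|y|)) => //.
    move=> z; apply: measurable_funTS; apply: (@continuous_measurable_fun RR) => s.
    by apply: cvg_inner; [exact: cvg_cst|exact: cS].
  by move=> s /tst[? _ ->]; exact: Sb.
pose Q s := M * `|y| * (e t s * q1 s + c2 * (e t s * q2 s) + c3 * (e t s * q3 s)).
have ic2 : leb.-integrable `[0, t] (EFin \o (fun s => c2 * (e t s * q2 s))).
  exact: (@integrableZl _ _ _ leb _ (measurable_itv _) c2 _ ie2).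
have ic3 : leb.-integrable `[0, t] (EFin \o (fun s => c3 * (e t s * q3 s))).
  exact: (@integrableZl _ _ _ leb _ (measurable_itv _) c3 _ ie3).
have i12 : leb.-integrable `[0, t] (EFin \o (fun s => e t s * q1 s + c2 * (e t s * q2 s))).
  exact: (@integrableD _ _ _ leb _ (measurable_itv _) _ _ ie1 ic2).
have i123 : leb.-integrable `[0, t] (EFin \o (fun s => e t s * q1 s + c2 * (e t s * q2 s) + c3 * (e t s * q3 s))).
  exact: (@integrableD _ _ _ leb _ (measurable_itv _) _ _ i12 ic3).
have iQ : leb.-integrable `[0, t] (EFin \o Q).
  exact: (@integrableZl _ _ _ leb _ (measurable_itv _) (M * `|y|) _ i123).
have iFG : leb.-integrable `[0, t] (EFin \o (fun s => F s - G s)).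
  exact: (@integrableB _ _ _ leb _ (measurable_itv _) _ _ iF iG).
have EQ : Rintegral leb `[0, t] Q = M * `|y| * (conv q1 t + c2 * conv q2 t + c3 * conv q3 t).
  rewrite (@RintegralZl _ _ RR leb `[0, t]%classic) //.
  rewrite (@RintegralD _ _ RR leb `[0, t]%classic) // (@RintegralD _ _ RR leb `[0, t]%classic) //.
  by rewrite !(@RintegralZl _ _ RR leb `[0, t]%classic).
have FGQ s : s \in `[0, t] -> `|F s - G s| <= Q s.
  move=> st; have [ts0 _ E] := tst s st; have sb := sub s st.
  have Se := hSM y ts0.
  have qf0 : 0 <= q1 s + c2 * q2 s by rewrite addr_ge0 // mulr_ge0.
  rewrite /F /G E; apply: le_trans (ler_normB _ _) _.
  apply: (@le_trans _ _ ((q1 s + c2 * q2 s) * (M * e t s * `|y|) + c3 * q3 s * (M * e t s * `|y|))).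
    apply: lerD.
      by apply: le_trans (cauchy_schwarz _ _) _; apply: ler_pM => //; exact: fq.
    by apply: le_trans (Pq _ sb) _; rewrite ler_wpM2l // mulr_ge0.
  by rewrite /Q le_eqVlt; apply/orP; left; apply/eqP; ring.
have E1 : inner (m t) y = inner r (S t y) + Rintegral leb `[0, t] (fun s => F s - G s).
  rewrite hm // (@RintegralB _ _ RR leb `[0, t]%classic) // -addrA; congr (_ + (_ - _)).
    by apply: eq_Rintegral => s /set_mem /tst[_ _ E]; rewrite /F E.
  by apply: eq_Rintegral => s /set_mem /tst[_ _ E]; rewrite /G E.
rewrite E1 mulrDr mulrDr mulrDr -!addrA mulrDl; apply: lerD.
  apply: le_trans (ler_norm _) _; apply: le_trans (cauchy_schwarz _ _) _.
  have := hSM y t0; move: (expR (- (k * t))) => ek hh.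
  have -> : M * (ek * `|r|) * `|y| = `|r| * (M * ek * `|y|) by ring.
  by rewrite ler_wpM2l.
have -> : (M * conv q1 t + (M * (c2 * conv q2 t) + M * (c3 * conv q3 t))) * `|y| = Rintegral leb `[0, t] Q.
  by rewrite EQ; ring.
apply: le_trans (ler_norm _) _.
apply: le_trans (le_normr_Rintegral _ iFG) _ => //.
apply: le_Rintegral => //; exact: (@integrable_norm _ _ _ leb _ _ iFG).
Qed.

(** The decay constants of S, the bound 1 + 1 / k of [convolution_bounds] and the weights of the two
    couplings; the length b of the interval does not occur. *)
Let C := 2 * M * (1 + k^-1) * (1 + c2 + c3).

Lemma mild_estimate :
  (forall t, t \in `[0, b] -> `|m t| <= C * (`|r| + n1 + n2 + n3)) /\
  (\int[leb]_(t in `[0%R, b]) (`|m t| ^+ 2)%:E <= ((C * (`|r| + n1 + n2 + n3)) ^+ 2)%:E)%E.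
Proof.
have mq q : leb.-integrable `[0, b] (EFin \o q) -> @measurable_fun _ _ mR mR `[0, b] q.
  by move=> iq; apply/measurable_EFinP; exact: measurable_int iq.
have [s1 l1] := @convolution_bounds RR k b n1 q1 k0 n10 (mq _ i1) (fun s _ => q10 s) h1.
have [s2 l2] := @convolution_bounds RR k b n2 q2 k0 n20 (mq _ i2) (fun s _ => q20 s) (or_intror h2).
have [s3 l3] := @convolution_bounds RR k b n3 q3 k0 n30 (mq _ i3) (fun s _ => q30 s) (or_intror h3).
have mc q : (forall s, 0 <= q s) -> leb.-integrable `[0, b] (EFin \o q) ->
    @measurable_fun _ _ mR mR `[0, b] (conv q).
  by move=> q0 iq; apply: (@measurable_convolution_fine RR k b q k0 (mq _ iq)) => s _.
pose kk := 1 + k^-1; pose cc := 1 + c2 + c3.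
have ki0 : 0 < k^-1 by rewrite invr_gt0.
have kk1 : 1 <= kk by rewrite lerDl ltW.
have cc1 : 1 <= cc by rewrite /cc -addrA lerDl addr_ge0.
have r0 := normr_ge0 r.
have CE : C = 2 * M * kk * cc by [].
have cnv0 q t : (forall s, 0 <= q s) -> 0 <= conv q t.
  by move=> q0; apply: Rintegral_ge0 => s _; rewrite mulr_ge0.
split=> [t tb|].
  apply: le_trans (pointwise tb) _.
  have ek1 : expR (- (k * t)) <= 1.
    rewrite -[leRHS]exp.expR0 ler_expR oppr_le0 mulr_ge0 ?(ltW k0) //.
    by move: tb; rewrite in_itv/= => /andP[].
  have H1 := s1 t tb; have H2 := s2 t tb; have H3 := s3 t tb.
  apply: (@le_trans _ _ (M * (`|r| + kk * n1 + c2 * (kk * n2) + c3 * (kk * n3)))).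
    rewrite ler_wpM2l ?(ltW M0) //; apply: lerD; last by rewrite ler_wpM2l.
    apply: lerD; last by rewrite ler_wpM2l.
    by apply: lerD => //; rewrite ler_piMl.
  exact: scaled_sum_le.
pose z t := expR (- (k * t)) * `|r|.
have z2 t : z t ^+ 2 = `|r| ^+ 2 * expR (- ((2 * k) * (t - 0))).
  rewrite /z exprMn mulrC; congr (_ * _); rewrite expr2 -exp.expRD; congr expR; ring.
have mz : @measurable_fun _ _ mR mR `[0, b] z.
  have -> : z = (fun t => expR (0 + (- k) * t) * `|r|).
    by apply/funext => t; rewrite /z; congr (expR _ * _); ring.
  apply: measurable_funM; last exact: measurable_cst.
  by apply: measurable_funTS; apply: (@continuous_measurable_fun RR); exact: (@continuous_expR_affine RR).
have lz : (\int[leb]_(t in `[0%R, b]) (z t ^+ 2)%:E <= ((kk * `|r|) ^+ 2)%:E)%E.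
  under eq_integral do rewrite z2.
  apply: (@le_trans _ _ (`|r| ^+ 2 * (2 * k)^-1)%:E).
    apply: (@ge0_integral_scale_le RR _ (measurable_itv _) _ _ _ (sqr_ge0 _)).
    - have -> : (fun s => expR (- (2 * k * (s - 0)))) = (fun s => expR (0 + (- (2 * k)) * s)).
        by apply/funext => s; congr expR; ring.
      by apply: measurable_funTS; apply: (@continuous_measurable_fun RR); exact: (@continuous_expR_affine RR).
    - by move=> s _; exact: expR_ge0.
    - by apply: (@integral_expR_right RR) => //; rewrite mulr_gt0.
  rewrite lee_fin exprMn mulrC ler_wpM2r ?sqr_ge0 // invfM.
  exact: half_le_sqr.
apply: (@le_trans _ _ (\int[leb]_(t in `[0%R, b]) ((4 * M ^+ 2) *
    (z t ^+ 2 + conv q1 t ^+ 2 + c2 ^+ 2 * conv q2 t ^+ 2 + c3 ^+ 2 * conv q3 t ^+ 2))%:E)%E).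
  apply: ge0_le_integral => //.
  - apply/measurable_EFinP; apply: measurable_funTS; apply: (@continuous_measurable_fun RR) => t.
    exact: continuous_norm_sqr.
  - apply/measurable_EFinP; apply: measurable_funM; first exact: measurable_cst.
    apply: measurable_funD; last by apply: measurable_funM; [exact: measurable_cst|apply: measurable_funX; exact: mc].
    apply: measurable_funD; last by apply: measurable_funM; [exact: measurable_cst|apply: measurable_funX; exact: mc].
    by apply: measurable_funD; apply: measurable_funX => //; exact: mc.
  - move=> t tb; rewrite lee_fin.
    apply: (@le_trans _ _ ((M * (z t + conv q1 t + c2 * conv q2 t + c3 * conv q3 t)) ^+ 2)).
      by rewrite ler_pXn2r ?nnegrE // ?(pointwise tb) // mulr_ge0 ?(ltW M0) // !addr_ge0 ?mulr_ge0 ?expR_ge0 ?cnv0.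
    exact: sqr_scaled_add4_le.
apply: (@le_trans _ _ ((4 * M ^+ 2) * ((kk * `|r|) ^+ 2 + (kk * n1) ^+ 2 + c2 ^+ 2 * (kk * n2) ^+ 2 +
    c3 ^+ 2 * (kk * n3) ^+ 2))%:E).
  have mcx q : (forall s, 0 <= q s) -> leb.-integrable `[0, b] (EFin \o q) ->
      @measurable_fun _ _ mR mR `[0, b] (fun t => conv q t ^+ 2).
    by move=> q0 iq; apply: measurable_funX; exact: mc.
  have m1 := mcx _ q10 i1; have m2 := mcx _ q20 i2; have m3 := mcx _ q30 i3.
  have mz2 : @measurable_fun _ _ mR mR `[0, b] (fun t => z t ^+ 2) by exact: measurable_funX.
  have m2' : @measurable_fun _ _ mR mR `[0, b] (fun t => c2 ^+ 2 * conv q2 t ^+ 2).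
    by apply: measurable_funM => //; exact: measurable_cst.
  have m3' : @measurable_fun _ _ mR mR `[0, b] (fun t => c3 ^+ 2 * conv q3 t ^+ 2).
    by apply: measurable_funM => //; exact: measurable_cst.
  have p2 (x : RR) : 0 <= x ^+ 2 by exact: sqr_ge0.
  apply: (@ge0_integral_scale_le RR _ (measurable_itv _)).
  - by rewrite mulr_ge0.
  - by apply: measurable_funD => //; apply: measurable_funD => //; exact: measurable_funD.
  - by move=> s _; rewrite !addr_ge0 // mulr_ge0.
  apply: (@ge0_integral_add_le RR _ (measurable_itv _)).
  - by apply: measurable_funD => //; exact: measurable_funD.
  - exact: m3'.
  - by move=> s _; rewrite !addr_ge0 // mulr_ge0.
  - by move=> s _; rewrite mulr_ge0.
  - apply: (@ge0_integral_add_le RR _ (measurable_itv _)).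
    + exact: measurable_funD.
    + exact: m2'.
    + by move=> s _; rewrite addr_ge0.
    + by move=> s _; rewrite mulr_ge0.
    + by apply: (@ge0_integral_add_le RR _ (measurable_itv _)).
    + by apply: (@ge0_integral_scale_le RR _ (measurable_itv _)).
  - by apply: (@ge0_integral_scale_le RR _ (measurable_itv _)).
rewrite lee_fin CE.
by apply: scaled_sqr_sum_le => //; rewrite (le_trans ler01).
Qed.

End mild_estimate.

Lemma dist_max_le (R : realFieldType) (a u v : R) :
  `|Num.max a u - Num.max a v| <= `|u - v|.
Proof.
have := ler_norm (u - v); have := ler_norm (v - u); rewrite (distrC v u).
move: `|u - v| (normr_ge0 (u - v)) => n n0 h1 h2.
by case: (leP a u) => au; case: (leP a v) => av; rewrite ler_norml; apply/andP; split; lra.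
Qed.

Lemma dist_min_le (R : realFieldType) (a u v : R) :
  `|Num.min u a - Num.min v a| <= `|u - v|.
Proof.
have := ler_norm (u - v); have := ler_norm (v - u); rewrite (distrC v u).
move: `|u - v| (normr_ge0 (u - v)) => n n0 h1 h2.
by case: (leP u a) => au; case: (leP v a) => av; rewrite ler_norml; apply/andP; split; lra.
Qed.

(** * Continuous extension from the time interval *)

Section clamp.
Variable X : hilbertSpace.

(** Projection onto [0, b]. Mild solutions are continuous only within the interval; composed with
    [clamp] they become continuous on the line and keep their values on [0, b]. *)
Definition clamp (b s : RR) : RR := Num.max 0 (Num.min s b).

Lemma clamp_in (b s : RR) : 0 <= b -> clamp b s \in `[0, b].
Proof.
move=> b0; rewrite in_itv/= /clamp le_max lexx /= ge_max b0 /=.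
by rewrite ge_min lexx orbT.
Qed.

Lemma clamp_id (b s : RR) : s \in `[0, b] -> clamp b s = s.
Proof. by rewrite in_itv/= => /andP[s0 sb]; rewrite /clamp (min_l sb) max_r. Qed.

Lemma continuous_clamp (b : RR) : 0 <= b -> continuous (clamp b).
Proof.
move=> b0; apply: (@lipschitz_continuous RR^o RR^o _ 1) => x y; rewrite mul1r /clamp.
apply: le_trans (dist_max_le _ _ _) _; exact: dist_min_le.
Qed.

Lemma continuous_comp_clamp (b : RR) (x : RR -> X) : 0 <= b ->
  {within `[0, b], continuous x} -> continuous (x \o clamp b).
Proof.
move=> b0 /subspace_continuousP cx s.
apply: (@cvg_comp _ _ _ (clamp b) x _ (within `[0, b] (nbhs (clamp b s)))); last first.
  by apply: cx; exact: clamp_in.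
move=> P hP.
have hc : nbhs s (clamp b @^-1` [set y | `[0, b]%classic y -> P y]).
  exact: (@continuous_clamp b b0 s _ hP).
rewrite /=; apply: (filterS _ hc) => u /= h.
by apply: h; exact: clamp_in.
Qed.

End clamp.

(** * The two norms of the theorem *)

Section norms.
Variable X : hilbertSpace.
Variable b : RR.
Hypothesis b0 : 0 < b.
Implicit Types f g x : RR -> X.

Lemma L2sq_continuous x : continuous x ->
  L2sq 0 b x = (fine (L2sq 0 b x))%:E.
Proof.
move=> cx; rewrite fineK // /L2sq.
apply: (@integrable_fin_num _ _ _ leb _ (measurable_itv _)).
by apply: (@continuous_integrable RR _ 0 b); exact: continuous_norm_sqr.
Qed.

Lemma norm_2inf_le x (Q : RR) : 0 <= Q ->
  (forall t, t \in `[0, b] -> `|x t| <= Q) -> (L2sq 0%R b x <= (Q ^+ 2)%:E)%E ->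
  norm_2inf 0 b x <= Q.
Proof.
move=> Q0 xQ x2; rewrite /norm_2inf ge_max; apply/andP; split.
  rewrite -[leRHS](ger0_norm Q0) -sqrtr_sqr ler_wsqrtr // -lee_fin fineK //.
  rewrite ge0_fin_numE; first by apply: le_lt_trans x2 _; rewrite ltry.
  by apply: integral_ge0 => s _; rewrite lee_fin sqr_ge0.
apply: ge_sup.
  by exists `|x 0|, 0 => //; rewrite /= in_itv/= lexx ltW.
by move=> _ [t tb <-]; exact: xQ.
Qed.

(** [fine] and [sup] return default values on infinite or unbounded arguments; continuity on a
    compact interval makes both values in [norm_2inf] the true ones. *)
Lemma norm_2inf_bounds (x y : RR -> X) : continuous y -> (forall t, t \in `[0, b] -> x t = y t) ->
  [/\ 0 <= norm_2inf 0 b x, forall t, t \in `[0, b] -> `|y t| <= norm_2inf 0 b x &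
   (L2sq 0%R b y <= (norm_2inf 0%R b x ^+ 2)%:E)%E].
Proof.
move=> cy xy.
have E : L2sq 0 b x = L2sq 0 b y.
  by apply: eq_integral => s /set_mem sb; rewrite xy.
have N0 : 0 <= norm_2inf 0 b x by rewrite le_max sqrtr_ge0.
split=> //.
- move=> t tb; rewrite -xy // le_max; apply/orP; right.
  apply: ub_le_sup; last by exists t.
  have cn : {within `[0, b], continuous (fun s => `|y s|)}.
    by apply: continuous_subspaceT => s; apply: cvg_norm; exact: cy.
  have [c _ hc] := @EVT_max RR _ 0 b (ltW b0) cn.
  by exists `|y c| => _ [s sb <-]; rewrite xy //; exact: hc.
- rewrite (L2sq_continuous cy) lee_fin.
  have f0 : 0 <= fine (L2sq 0 b y).
    by apply: fine_ge0; apply: integral_ge0 => s _; rewrite lee_fin sqr_ge0.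
  rewrite -[leLHS](sqr_sqrtr f0) ler_pXn2r ?nnegrE ?sqrtr_ge0 //.
  by rewrite /norm_2inf E le_max lexx.
Qed.

(** The equations see [f] only under integrals, so a Borel version can take its place; the last
    clause is the form in which they are transferred. The disjunction records which norm attains the
    minimum, the L^1 norm being the one when the L^2 norm is infinite. *)
Lemma borel_representative f : in_L1 0 b f -> exists f' : RR -> X,
  [/\ integrable_on 0 b f', norm_1v2 0 b f = norm_1v2 0 b f',
    0 <= norm_1v2 0 b f',
    (\int[leb]_(s in `[0%R, b]) (`|f' s|)%:E <= (norm_1v2 0%R b f')%:E)%E \/
    (\int[leb]_(s in `[0%R, b]) (`|f' s| ^+ 2)%:E <= (norm_1v2 0%R b f' ^+ 2)%:E)%E &
  forall (D : set RR) (h k : RR -> RR), (forall s, D s -> s \in `[0, b] /\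
     (f s = f' s -> h s = k s)) -> Rintegral leb D h = Rintegral leb D k].
Proof.
move=> [sf lf]; have [f' [bf' [N [mN N0 ff']]]] := strongly_measurable_borel sf.
have E1 : L1int 0 b f = L1int 0 b f'.
  by apply: (integral_null_eq mN N0) => s sb Ns; rewrite ff'.
have E2 : L2sq 0 b f = L2sq 0 b f'.
  by apply: (integral_null_eq mN N0) => s sb Ns; rewrite ff'.
have i0 : (0 <= L1int 0%R b f')%E by apply: integral_ge0 => s _; rewrite lee_fin.
have i20 : (0 <= L2sq 0%R b f')%E by apply: integral_ge0 => s _; rewrite lee_fin sqr_ge0.
have fin1 : L1int 0 b f' \is a fin_num by rewrite ge0_fin_numE // -E1.
exists f'; split.
- split=> //; apply/integrableP; split.
    by apply/measurable_EFinP; exact: measurable_norm_borel bf'.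
  apply: le_lt_trans lf; rewrite E1 le_eqVlt; apply/orP; left; apply/eqP.
  by apply: eq_integral => s _; rewrite /= normr_id.
- by rewrite /norm_1v2 E1 E2.
- rewrite /norm_1v2; case: ifP => _; last exact: fine_ge0.
  by rewrite le_min sqrtr_ge0 fine_ge0.
- rewrite /norm_1v2; case: ifPn => h2; last by left; rewrite fineK.
  have fin2 : L2sq 0 b f' \is a fin_num by rewrite ge0_fin_numE.
  case: (leP (fine (L1int 0 b f')) _) => _; first by left; rewrite fineK.
  by right; rewrite sqr_sqrtr ?fine_ge0 // fineK.
- move=> D h k hk; congr fine; apply: (integral_null_eq mN N0) => s Ds Ns.
  by have [sb ->] := hk s Ds => //; apply: ff'.
Qed.

End norms.

(** Let Z be the norm of the solution, W that of the data and s = a + b. The stable estimates give Z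
    <= C (W + s), the energy gives s^2 <= (2 / kappa) Z W; together they form a quadratic inequality
    for s, which bounds s by a multiple of W. *)
Lemma optimality_algebra (R : realFieldType) (C2 C1 kappa nx nl p2 p4 p1 p3 a b : R) :
  0 <= C1 -> 0 <= C2 -> 0 < kappa -> 0 <= nx -> 0 <= nl -> 0 <= p1 -> 0 <= p2 ->
  0 <= p3 -> 0 <= p4 -> 0 <= a -> 0 <= b ->
  nx <= C2 * (p4 + p3 + b + a) -> nl <= C1 * (p2 + p1 + a + b) ->
  kappa * (a ^+ 2 + b ^+ 2) <= nx * p2 + nl * p4 + p3 * nl + p1 * nx ->
  nx + nl <= (C1 + C2) * (2 * kappa^-1 * (C1 + C2) + 2) * (p1 + p2 + p3 + p4).
Proof.
move=> C10 C20 k0 nx0 nl0 p10 p20 p30 p40 a0 b0 hx hl he.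
set C := C1 + C2; set W := p1 + p2 + p3 + p4; set Z := nx + nl; set s := a + b.
have W0 : 0 <= W by rewrite /W !addr_ge0.
have C0 : 0 <= C by rewrite addr_ge0.
have s0 : 0 <= s by rewrite addr_ge0.
have ki : 0 < kappa^-1 by rewrite invr_gt0.
have hZ : Z <= C * (W + s).
  have g1 : nx <= C2 * (W + s) by apply: le_trans hx _; rewrite ler_wpM2l // /W /s; lra.
  have g2 : nl <= C1 * (W + s) by apply: le_trans hl _; rewrite ler_wpM2l // /W /s; lra.
  by rewrite /Z /C mulrDl addrC lerD.
have h1 : nx * p2 + nl * p4 + p3 * nl + p1 * nx <= Z * W.
  have g : 0 <= nx * p3 + nx * p4 + nl * p1 + nl * p2 by rewrite !addr_ge0 // mulr_ge0.
  have -> : Z * W = nx * p2 + nl * p4 + p3 * nl + p1 * nx + (nx * p3 + nx * p4 + nl * p1 + nl * p2).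
    by rewrite /Z /W; ring.
  by rewrite lerDl.
have h2 : s ^+ 2 <= 2 * kappa^-1 * (Z * W).
  have g : s ^+ 2 <= 2 * (a ^+ 2 + b ^+ 2).
    have -> : 2 * (a ^+ 2 + b ^+ 2) = s ^+ 2 + (a - b) ^+ 2 by rewrite /s; ring.
    by rewrite lerDl sqr_ge0.
  apply: le_trans g _; rewrite -mulrA ler_wpM2l // mulrC ler_pdivlMr // mulrC.
  exact: le_trans he h1.
set D := kappa^-1 * C; have D0 : 0 <= D by rewrite mulr_ge0 // ltW.
have h3 : s ^+ 2 <= 2 * D * (W + s) * W.
  apply: le_trans h2 _.
  have -> : 2 * D * (W + s) * W = 2 * kappa^-1 * (C * (W + s) * W) by rewrite /D; ring.
  by apply: ler_wpM2l; [rewrite mulr_ge0 // ltW|exact: ler_wpM2r].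
have h4 : s <= (2 * D + 1) * W.
  have g0 : 0 <= (2 * D + 1) * W by rewrite mulr_ge0 // addr_ge0 // mulr_ge0.
  rewrite -(ler_pXn2r (n := 2)) ?nnegrE //.
  (* By Young's inequality 2 D W s <= s^2 / 2 + 2 D^2 W^2, so s^2 <= (4 D + 4 D^2) W^2, which is
     below the square of (2 D + 1) W. *)
  have := sqr_ge0 (s - 2 * D * W); have := sqr_ge0 W; move: h3; clear -D0.
  by rewrite !expr2 => *; nra.
have -> : C * (2 * kappa^-1 * C + 2) * W = C * (W + (2 * D + 1) * W) by rewrite /D; ring.
by apply: le_trans hZ _; rewrite ler_wpM2l // lerD2l.
Qed.

Lemma continuous_bounded_comp (V W : hilbertSpace) (F : V -> W) (q : RR -> V) :
  bounded_linear F -> continuous q -> continuous (fun s : RR => F (q s)).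
Proof.
move=> bF cq s.
exact: (cvg_comp _ _ (cq s) (continuous_of_bounded_linear bF (x := q s))).
Qed.

Lemma energy_algebra (R : realFieldType) (a b q v3 v1 u w b1 b2 b3 b4 : R) :
  u - w = q + v3 - (v1 - a) -> b <= q -> `|u| <= b1 -> `|w| <= b2 -> `|v3| <= b3 ->
  `|v1| <= b4 -> a + b <= b1 + b2 + b3 + b4.
Proof.
move=> E bq; rewrite !ler_norml => /andP[_ ?] /andP[? _] /andP[? _] /andP[_ ?].
by lra.
Qed.

Section pairings.
Variable X : hilbertSpace.
Variable b : RR.
Local Notation mR := (measurableTypeR RR).

Lemma Rintegral_pairing_le (f w : RR -> X) (p n : RR) : integrable_on 0 b f -> continuous w ->
  0 <= p -> 0 <= n -> (forall s, s \in `[0, b] -> `|w s| <= n) ->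
  (L2sq 0%R b w <= (n ^+ 2)%:E)%E ->
  (\int[leb]_(s in `[0%R, b]) (`|f s|)%:E <= p%:E)%E \/
    (\int[leb]_(s in `[0%R, b]) (`|f s| ^+ 2)%:E <= (p ^+ 2)%:E)%E ->
  leb.-integrable `[0, b] (EFin \o (fun s => inner (f s) (w s))) /\
  `|Rintegral leb `[0, b] (fun s => inner (f s) (w s))| <= p * n.
Proof.
move=> fi cw p0 n0 wn w2 fp; have [bf _] := fi.
have mw z : @measurable_fun _ _ mR mR `[0, b] (fun s => inner z (w s)).
  apply: measurable_funTS; apply: (@continuous_measurable_fun RR) => s.
  by apply: cvg_inner; [exact: cvg_cst|exact: cw].
have mnw : @measurable_fun _ _ mR mR `[0, b] (fun s => `|w s|).
  apply: measurable_funTS; apply: (@continuous_measurable_fun RR) => s.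
  by apply: cvg_norm; exact: cw.
have mnf := measurable_norm_borel bf.
have ifw := integrable_inner fi mw wn; split=> //.
have le1 : (\int[leb]_(s in `[0%R, b]) (`|f s| * `|w s|)%:E <= (p * n)%:E)%E.
  apply: (@integral_pairing_le RR _ (measurable_itv _) (fun s => `|f s|) (fun s => `|w s|) p n) => //.
  by move=> s sb; rewrite normr_ge0 wn.
rewrite -lee_fin; apply: le_trans le1.
rewrite (@EFin_normr_Rintegral _ _ RR leb `[0, b]%classic (fun s => inner (f s) (w s)) (measurable_itv _) ifw).
apply: le_trans (le_abse_integral _ _ _) _ => //.
  by apply/measurable_EFinP; exact: measurable_inner_borel.
apply: ge0_le_integral => //.
- by apply: (@measurable_int _ _ RR leb); apply: integrable_abse; exact: ifw.
- by apply/measurable_EFinP; exact: measurable_funM.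
- by move=> s _; rewrite lee_fin cauchy_schwarz.
Qed.

End pairings.

(** * The estimate on a single domain *)

Section single_domain.
Variables (X U Y : hilbertSpace) (T Tstar : RR -> X -> X) (D Dstar : set X) (A Astar : X -> X)
  (B : U -> X) (Bstar : X -> U) (C : X -> Y) (Cstar : Y -> X)
  (Rop Rstar Qinv : U -> U) (CB CC CR alpha : RR).
Hypotheses (hT : C0_semigroup T) (hA : generates T D A)
  (hAstar : is_unbounded_adjoint D A Dstar Astar)
  (hTstar : forall t, 0 <= t -> is_adjoint (T t) (Tstar t))
  (hB : bounded_linear B) (hBstar : is_adjoint B Bstar)
  (hC : bounded_linear C) (hCstar : is_adjoint C Cstar)
  (hR : bounded_linear Rop) (hRstar : is_adjoint Rop Rstar)
  (hQ1 : forall u, Qinv (Rstar (Rop u)) = u) (hQ2 : forall u, Rstar (Rop (Qinv u)) = u)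
  (hCB : 0 < CB) (hCC : 0 < CC) (hCR : 0 < CR) (halpha : 0 < alpha)
  (hBn : opnorm_le B CB) (hCn : opnorm_le C CC) (hRn : opnorm_le Rop CR)
  (hcoer : forall u, alpha * `|u| ^+ 2 <= `|Rop u| ^+ 2).
Variables (K1 : X -> U) (S1 : RR -> X -> X) (cK1 M1 k1 : RR)
  (K2 : X -> Y) (S2 : RR -> X -> X) (cK2 M2 k2 : RR).
Hypotheses (bK1 : bounded_linear K1) (nK1 : opnorm_le K1 cK1) (cK10 : 0 <= cK1)
  (hS1 : C0_semigroup S1) (gS1 : generates S1 D (fun x => A x + B (K1 x)))
  (M10 : 0 < M1) (k10 : 0 < k1)
  (sS1 : forall t x, 0 <= t -> `|S1 t x| <= M1 * expR (- (k1 * t)) * `|x|)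
  (bK2 : bounded_linear K2) (nK2 : opnorm_le K2 cK2) (cK20 : 0 <= cK2)
  (hS2 : C0_semigroup S2) (gS2 : generates S2 Dstar (fun x => Astar x + Cstar (K2 x)))
  (M20 : 0 < M2) (k20 : 0 < k2)
  (sS2 : forall t x, 0 <= t -> `|S2 t x| <= M2 * expR (- (k2 * t)) * `|x|).

Let bounded_linear_comp (V W Z : hilbertSpace) (F : V -> W) (G : W -> Z) :
  bounded_linear F -> bounded_linear G -> bounded_linear (fun v => G (F v)).
Proof.
move=> bF bG; have [c [c0 hc]] := bounded_linear_pos bF; have [d [d0 hd]] := bounded_linear_pos bG.
have [lF _] := bF; have [lG _] := bG; split; first by move=> a x y; rewrite lF lG.
exists (d * c) => x; apply: le_trans (hd _) _; rewrite -mulrA ler_wpM2l //; exact: hc.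
Qed.

Let bBstar : bounded_linear Bstar.
Proof.
by split; [exact: adjoint_linear hBstar|exists CB; exact: (adjoint_opnorm hBstar (ltW hCB) hBn)].
Qed.

Let bCstar : bounded_linear Cstar.
Proof.
by split; [exact: adjoint_linear hCstar|exists CC; exact: (adjoint_opnorm hCstar (ltW hCC) hCn)].
Qed.

(** Write v = R^* R w with w = Q^-1 v. *)
Let inner_Qinv v : inner (Qinv v) v = `|Rop (Qinv v)| ^+ 2.
Proof. by rewrite -{2}(hQ2 v) -hRstar inner_norm. Qed.

(** For w = Q^-1 v: alpha |w|^2 <= |R w|^2 = <w, v> <= |w| |v|. *)
Let Qinv_norm v : `|Qinv v| <= alpha^-1 * `|v|.
Proof.
have h := hcoer (Qinv v); rewrite -inner_Qinv in h.
have h' := le_trans h (le_trans (ler_norm _) (cauchy_schwarz _ _)).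
rewrite mulrC ler_pdivlMr // mulrC.
have [->|n0] := eqVneq `|Qinv v| 0; first by rewrite mulr0.
have np : 0 < `|Qinv v| by rewrite lt_neqAle eq_sym n0 normr_ge0.
by rewrite -(ler_pM2l np) mulrCA -expr2.
Qed.

Let bQinv : bounded_linear Qinv.
Proof.
split; last by exists alpha^-1; exact: Qinv_norm.
have [lR _] := hR; have lRs := adjoint_linear hRstar.
by move=> a u v; rewrite -[LHS]hQ1; rewrite -{1}(hQ2 u) -{1}(hQ2 v) -lRs -lR !hQ1.
Qed.

(** For w = Q^-1 v: |v| = |R^* R w| <= CR |R w|. The upper bound on R is thus a lower bound on
    Q^-1. *)
Let Qinv_coercive v : `|v| ^+ 2 / CR ^+ 2 <= inner (Qinv v) v.
Proof.
rewrite inner_Qinv ler_pdivrMr ?exprn_gt0 // -exprMn ler_pXn2r ?nnegrE ?mulr_ge0 ?(ltW hCR) //.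
rewrite mulrC -{1}(hQ2 v); exact: (adjoint_opnorm hRstar (ltW hCR) hRn).
Qed.

(** The constant of [mild_estimate] for the state: [CB / alpha] bounds B Q^-1, and [cK2] bounds the
    feedback from detectability. [C1] is its analogue for the costate. *)
Let C2 := 2 * M2 * (1 + k2^-1) * (1 + CB / alpha + cK2).
Let C1 := 2 * M1 * (1 + k1^-1) * (1 + CC + cK1).
(** The energy controls |C x|^2 with weight 1 and |B^* lam|^2 with the weight of [Qinv_coercive]. *)
Let kappa := Num.min 1 (CR ^+ 2)^-1.

(** The constant of [optimality_algebra]. It is fixed before the horizon and the data are introduced
    and involves the uniform bounds only. *)
Definition optimality_constant : RR :=
  (C1 + C2) * (2 * kappa^-1 * (C1 + C2) + 2).

Variables (b : RR) (r1 r3 x l : RR -> X) (r2 r4 : X).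
Hypotheses (b0 : 0 < b) (cx : continuous x) (cl : continuous l)
  (i1 : integrable_on 0 b r1) (i3 : integrable_on 0 b r3).

Let bz t : t \in `[0, b] -> 0 <= t /\ t <= b.
Proof. by rewrite in_itv/= => /andP. Qed.

Let av (s : RR) := `|C (x s)|.
Let bv (s : RR) := `|Bstar (l s)|.
Let f (s : RR) := B (Qinv (Bstar (l s))) + r3 s.
Let g (s : RR) := r1 s - Cstar (C (x s)).

Let cBl : continuous (fun s : RR => Bstar (l s)).
Proof. exact: continuous_bounded_comp. Qed.

Let cCx : continuous (fun s : RR => C (x s)).
Proof. exact: continuous_bounded_comp. Qed.

Let cBQ : continuous (fun s : RR => B (Qinv (Bstar (l s)))).
Proof. exact: (continuous_bounded_comp (bounded_linear_comp bQinv hB) cBl). Qed.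

Let cCC : continuous (fun s : RR => - Cstar (C (x s))).
Proof. by move=> s; apply: cvgN; exact: (continuous_bounded_comp bCstar cCx). Qed.

Let fi : integrable_on 0 b f.
Proof. exact: (integrable_on_add (integrable_on_continuous b cBQ) i3). Qed.

Let gi : integrable_on 0 b g.
Proof. exact: (integrable_on_add i1 (integrable_on_continuous b cCC)). Qed.

Let cav : continuous av.
Proof. by move=> s; apply: cvg_norm; exact: cCx. Qed.

Let cbv : continuous bv.
Proof. by move=> s; apply: cvg_norm; exact: cBl. Qed.

Let a2 := Num.sqrt (fine (L2sq 0 b (fun s => C (x s)))).
Let b2 := Num.sqrt (fine (L2sq 0 b (fun s => Bstar (l s)))).

Let a2E : (L2sq 0%R b (fun s => C (x s)) = (a2 ^+ 2)%:E)%E.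
Proof.
rewrite (L2sq_continuous b cCx) sqr_sqrtr // fine_ge0 //.
by apply: integral_ge0 => s _; rewrite lee_fin sqr_ge0.
Qed.

Let b2E : (L2sq 0%R b (fun s => Bstar (l s)) = (b2 ^+ 2)%:E)%E.
Proof.
rewrite (L2sq_continuous b cBl) sqr_sqrtr // fine_ge0 //.
by apply: integral_ge0 => s _; rewrite lee_fin sqr_ge0.
Qed.

Variables (n1 n3 : RR).
Hypotheses (n10 : 0 <= n1) (n30 : 0 <= n3)
  (h1 : (\int[leb]_(s in `[0%R, b]) (`|r1 s|)%:E <= n1%:E)%E \/
    (\int[leb]_(s in `[0%R, b]) (`|r1 s| ^+ 2)%:E <= (n1 ^+ 2)%:E)%E)
  (h3 : (\int[leb]_(s in `[0%R, b]) (`|r3 s|)%:E <= n3%:E)%E \/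
    (\int[leb]_(s in `[0%R, b]) (`|r3 s| ^+ 2)%:E <= (n3 ^+ 2)%:E)%E)
  (hx : mild Tstar b x r4 f)
  (hl : forall t, t \in `[0, b] -> forall y, inner (l t) y = inner r2 (T (b - t) y) +
    Rintegral leb `[t, b] (fun s => inner (g s) (T (s - t) y))).

(** The perturbation is P = C^* K2, and <x, C^* K2 z> = <C x, K2 z>, so the state enters only
    through C x; the forcing B Q^-1 B^* lam is controlled by B^* lam. *)
Lemma state_estimate :
  (forall t, t \in `[0, b] -> `|x t| <= C2 * (`|r4| + n3 + b2 + a2)) /\
  (L2sq 0%R b x <= ((C2 * (`|r4| + n3 + b2 + a2)) ^+ 2)%:E)%E.
Proof.
have bP := bounded_linear_comp bK2 bCstar.
have dV := duhamel_adjoint_perturbation hT hA hS2 bP hAstar hTstar gS2.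
have hm := mild_transfer (adjoint_weak_semigroup hT hTstar) hS2 bP dV cx fi hx.
have cBa : 0 <= CB / alpha by rewrite divr_ge0 // ltW.
apply: (@mild_estimate X S2 _ M2 k2 b (CB / alpha) cK2 x f r4 (fun s => `|r3 s|) bv av
  n3 b2 a2 M20 k20 (ltW b0) cBa cK20 hS2 bP cx fi sS2 hm).
- move=> s _; rewrite addrC; apply: le_trans (ler_normD _ _) _; rewrite lerD2r.
  apply: le_trans (hBn _) _; rewrite -mulrA; apply: ler_wpM2l; first exact: ltW.
  exact: Qinv_norm.
- move=> s z _; rewrite -hCstar; apply: le_trans (cauchy_schwarz _ _) _.
  rewrite [leRHS](_ : _ = av s * (cK2 * `|z|)); last by ring.
  by apply: ler_wpM2l; [exact: normr_ge0|exact: nK2].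
- by move=> s; exact: normr_ge0.
- by move=> s; exact: normr_ge0.
- by move=> s; exact: normr_ge0.
- by case: i3.
- exact: (@continuous_integrable RR _ 0 b cbv).
- exact: (@continuous_integrable RR _ 0 b cav).
- exact: n30.
- exact: sqrtr_ge0.
- exact: sqrtr_ge0.
- exact: h3.
- by rewrite -b2E.
- by rewrite -a2E.
Qed.

Let refl_in s : s \in `[0, b] -> b - s \in `[0, b].
Proof. by move=> /bz[? ?]; rewrite in_itv/= subr_ge0 gerBl; apply/andP. Qed.

Let integral_rev (h : RR -> RR) : @measurable_fun _ _ (measurableTypeR RR) (measurableTypeR RR) `[0, b] h ->
  (forall s, 0 <= h s) ->
  (\int[leb]_(s in `[0%R, b]) (h (b - s))%:E = \int[leb]_(s in `[0%R, b]) (h s)%:E)%E.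
Proof.
move=> mh h0; have := @ge0_integral_refl RR b 0 b (fun s => (h s)%:E).
rewrite subrr subr0; apply; first exact/measurable_EFinP.
by move=> s _; rewrite lee_fin.
Qed.

Let integrable_rev (h : RR -> RR) : leb.-integrable `[0, b] (EFin \o h) -> (forall s, 0 <= h s) ->
  leb.-integrable `[0, b] (EFin \o (fun s => h (b - s))).
Proof.
move=> ih h0; have mh : @measurable_fun _ _ (measurableTypeR RR) (measurableTypeR RR) `[0, b] h.
  by apply/measurable_EFinP; exact: measurable_int ih.
apply/integrableP; split.
  apply/measurable_EFinP.
  have mr : @measurable_fun _ _ (measurableTypeR RR) (measurableTypeR RR) `[0, b] (fun s => b - s).
    apply: measurable_funTS; apply: (@continuous_measurable_fun RR) => s.
    by apply: (@cvgB _ RR^o); [exact: cvg_cst|exact: cvg_id].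
  apply: (measurable_comp (measurable_itv `[0, b]) _ mh mr).
  by move=> _ [s sb <-]; exact: refl_in.
have /integrableP[_] := ih; rewrite /=.
under eq_integral do rewrite ger0_norm //.
by under [in X in _ -> X]eq_integral do rewrite ger0_norm //; rewrite integral_rev.
Qed.

(** The time-reversed costate solves a forward mild equation for [T]. Here P = B K1, and <l, B K1 z>
    = <B^* l, K1 z>, so the costate enters only through B^* lam. *)
Lemma costate_estimate :
  (forall t, t \in `[0, b] -> `|l t| <= C1 * (`|r2| + n1 + a2 + b2)) /\
  (L2sq 0%R b l <= ((C1 * (`|r2| + n1 + a2 + b2)) ^+ 2)%:E)%E.
Proof.
have bP := bounded_linear_comp bK1 hB.
have dV := duhamel_perturbation hT hA hS1 bP gS1.
have crefl : continuous (fun s : RR => b - s).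
  by move=> s; apply: (@cvgB _ RR^o); [exact: cvg_cst|exact: cvg_id].
have crev (Z : hilbertSpace) (q : RR -> Z) : continuous q -> continuous (fun s : RR => q (b - s)).
  by move=> cq s; exact: (cvg_comp _ _ (crefl s) (cq (b - s))).
pose m s := l (b - s); pose h s := g (b - s).
have cm : continuous m by exact: crev.
have hi : integrable_on 0 b h.
  split; first by apply: borel_on_refl; case: gi.
  by apply: (integrable_rev (h := fun s => `|g s|)) => //; case: gi.
have hm : mild T b m r2 h.
  move=> t tb y; have [t0 tb'] := bz tb; rewrite /m (hl (refl_in tb)).
  have E : b - (b - t) = t by rewrite opprB addrCA subrr addr0.
  rewrite E; congr (_ + _).
  (* Clamping the time makes the integrand measurable on all of [0, b], as the reflection requires
     measurability on the subinterval. *)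
  pose F s := inner (g s) (T (Num.max (s - (b - t)) 0) y).
  transitivity (Rintegral leb `[b - t, b] F).
    by apply: eq_Rintegral => s; rewrite inE /= in_itv/= => /andP[st _]; rewrite /F max_l // subr_ge0.
  transitivity (Rintegral leb `[0, t] (fun s => F (b - s))); last first.
    apply: eq_Rintegral => s; rewrite inE /= in_itv/= => /andP[_ st].
    have Es : b - s - (b - t) = t - s by ring.
    by rewrite /F /h Es max_l // subr_ge0.
  have mF : @measurable_fun _ _ (measurableTypeR RR) (measurableTypeR RR) `[b - t, b - 0] F.
    have mF' : @measurable_fun _ _ (measurableTypeR RR) (measurableTypeR RR) `[0, b] F.
      apply: measurable_inner_borel; first by case: gi.
      move=> z; apply: measurable_funTS; apply: (@continuous_measurable_fun RR) => s.
      apply: cvg_inner; first exact: cvg_cst.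
      apply: (C0_cvg hT); last exact: cvg_cst.
      by apply: (@cvgB _ RR^o); [exact: cvg_id|exact: cvg_cst].
    apply: (measurable_funS (measurable_itv _) _ mF').
    by move=> s; rewrite /= subr0 !in_itv/= => /andP[bs ->]; rewrite andbT (le_trans _ bs) // subr_ge0.
  by have := @Rintegral_refl RR b 0 t F mF; rewrite subr0 => ->.
have Em := mild_transfer (C0_weak_semigroup hT) hS1 bP dV cm hi hm.
have mr1 := measurable_norm_borel i1.1.
have mx (q : RR -> RR) : @measurable_fun _ _ (measurableTypeR RR) (measurableTypeR RR) `[0, b] q ->
  @measurable_fun _ _ (measurableTypeR RR) (measurableTypeR RR) `[0, b] (fun s => q s ^+ 2).
  by move=> mq; exact: measurable_funX.
have mav : @measurable_fun _ _ (measurableTypeR RR) (measurableTypeR RR) `[0, b] av.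
  by apply: measurable_funTS; exact: (@continuous_measurable_fun RR _ cav).
have mbv : @measurable_fun _ _ (measurableTypeR RR) (measurableTypeR RR) `[0, b] bv.
  by apply: measurable_funTS; exact: (@continuous_measurable_fun RR _ cbv).
have [e1 e2] : (forall t, t \in `[0, b] -> `|m t| <= C1 * (`|r2| + n1 + a2 + b2)) /\
  (\int[leb]_(t in `[0%R, b]) (`|m t| ^+ 2)%:E <= ((C1 * (`|r2| + n1 + a2 + b2)) ^+ 2)%:E)%E.
  apply: (@mild_estimate X S1 _ M1 k1 b CC cK1 m h r2 (fun s => `|r1 (b - s)|)
    (fun s => av (b - s)) (fun s => bv (b - s))
    n1 a2 b2 M10 k10 (ltW b0) (ltW hCC) cK10 hS1 bP cm hi sS1 Em).
  - move=> s _; apply: le_trans (ler_normB _ _) _; rewrite lerD2l.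
    exact: (adjoint_opnorm hCstar (ltW hCC) hCn).
  - move=> s z _; rewrite inner_sym hBstar inner_sym; apply: le_trans (cauchy_schwarz _ _) _.
    rewrite [leRHS](_ : _ = bv (b - s) * (cK1 * `|z|)); last by ring.
    by apply: ler_wpM2l; [exact: normr_ge0|exact: nK1].
  - by move=> s; exact: normr_ge0.
  - by move=> s; exact: normr_ge0.
  - by move=> s; exact: normr_ge0.
  - exact: (integrable_rev (h := fun s => `|r1 s|) i1.2 (fun s => normr_ge0 _)).
  - exact: (integrable_rev (h := av) (@continuous_integrable RR _ 0 b cav) (fun s => normr_ge0 _)).
  - exact: (integrable_rev (h := bv) (@continuous_integrable RR _ 0 b cbv) (fun s => normr_ge0 _)).
  - exact: n10.
  - exact: sqrtr_ge0.
  - exact: sqrtr_ge0.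
  - case: h1 => hh; [left|right].
      rewrite (integral_rev (h := fun s => `|r1 s|)); [exact: hh|exact: mr1|by move=> s; exact: normr_ge0].
    rewrite (integral_rev (h := fun s => `|r1 s| ^+ 2)); [exact: hh|exact: mx|by move=> s; exact: sqr_ge0].
  - rewrite (integral_rev (h := fun s => av s ^+ 2)); [by rewrite -a2E|exact: mx|by move=> s; exact: sqr_ge0].
  - rewrite (integral_rev (h := fun s => bv s ^+ 2)); [by rewrite -b2E|exact: mx|by move=> s; exact: sqr_ge0].
split=> [t tb|].
  by have := e1 (b - t) (refl_in tb); rewrite /m opprB addrCA subrr addr0.
rewrite /L2sq -(integral_rev (h := fun s => `|l s| ^+ 2)); [exact: e2| |by move=> s; exact: sqr_ge0].
apply: mx; apply: measurable_funTS; apply: (@continuous_measurable_fun RR) => s; apply: cvg_norm; exact: cl.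
Qed.

Variables (nx nl : RR).
Hypotheses (nx0 : 0 <= nx) (nl0 : 0 <= nl)
  (xn : forall t, t \in `[0, b] -> `|x t| <= nx) (xn2 : (L2sq 0%R b x <= (nx ^+ 2)%:E)%E)
  (ln : forall t, t \in `[0, b] -> `|l t| <= nl) (ln2 : (L2sq 0%R b l <= (nl ^+ 2)%:E)%E).

(** In the energy identity |C x|^2 and <Q^-1 B^* lam, B^* lam> carry the same sign. Their sum is
    bounded by two endpoint terms and two pairings of data with the solution. *)
Lemma energy_estimate :
  kappa * (a2 ^+ 2 + b2 ^+ 2) <= nx * `|r2| + nl * `|r4| + n3 * nl + n1 * nx.
Proof.
have eb := energy_identity (ltW b0) hT hTstar cx cl fi gi hx hl.
have [j3 p3] := Rintegral_pairing_le i3 cl n30 nl0 ln ln2 h3.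
have [j1 p1] := Rintegral_pairing_le i1 cx n10 nx0 xn xn2 h1.
have cq : continuous (fun s : RR => inner (Qinv (Bstar (l s))) (Bstar (l s))).
  move=> s; apply: cvg_inner; last exact: cBl.
  exact: (continuous_bounded_comp bQinv cBl).
have ca2 : continuous (fun s : RR => `|C (x s)| ^+ 2) by exact: continuous_norm_sqr.
have cb2 : continuous (fun s : RR => `|Bstar (l s)| ^+ 2) by exact: continuous_norm_sqr.
have jq : leb.-integrable `[0, b] (EFin \o (fun s => inner (Qinv (Bstar (l s))) (Bstar (l s)))).
  exact: (@continuous_integrable RR _ 0 b cq).
have ja : leb.-integrable `[0, b] (EFin \o (fun s => `|C (x s)| ^+ 2)).
  exact: (@continuous_integrable RR _ 0 b ca2).
have jb : leb.-integrable `[0, b] (EFin \o (fun s => `|Bstar (l s)| ^+ 2)).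
  exact: (@continuous_integrable RR _ 0 b cb2).
have E1 : Rintegral leb `[0, b] (fun s => inner (f s) (l s)) =
    Rintegral leb `[0, b] (fun s => inner (Qinv (Bstar (l s))) (Bstar (l s))) +
    Rintegral leb `[0, b] (fun s => inner (r3 s) (l s)).
  rewrite -(@RintegralD _ _ RR leb `[0, b]%classic) //.
  by apply: eq_Rintegral => s _; rewrite /f innerDl hBstar.
have E2 : Rintegral leb `[0, b] (fun s => inner (g s) (x s)) =
    Rintegral leb `[0, b] (fun s => inner (r1 s) (x s)) -
    Rintegral leb `[0, b] (fun s => `|C (x s)| ^+ 2).
  rewrite -(@RintegralB _ _ RR leb `[0, b]%classic) //.
  by apply: eq_Rintegral => s _; rewrite /g innerBl (inner_sym (Cstar _)) -hCstar inner_norm.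
have Ea : Rintegral leb `[0, b] (fun s => `|C (x s)| ^+ 2) = a2 ^+ 2.
  by have := a2E; rewrite /L2sq /Rintegral => ->.
have Eb : Rintegral leb `[0, b] (fun s => `|Bstar (l s)| ^+ 2) = b2 ^+ 2.
  by have := b2E; rewrite /L2sq /Rintegral => ->.
have Eq : b2 ^+ 2 / CR ^+ 2 <= Rintegral leb `[0, b] (fun s => inner (Qinv (Bstar (l s))) (Bstar (l s))).
  rewrite -Eb -(@RintegralZr _ _ RR leb `[0, b]%classic) //.
  apply: (@le_Rintegral _ _ RR leb `[0, b]%classic).
  - exact: measurable_itv.
  - exact: (@integrableZr _ _ _ leb _ (measurable_itv _) _ _ jb).
  - exact: jq.
  - by move=> s _; exact: Qinv_coercive.
have kap1 : kappa <= 1 by rewrite ge_min lexx.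
have kap2 : kappa <= (CR ^+ 2)^-1 by rewrite ge_min lexx orbT.
have g1 : kappa * (a2 ^+ 2 + b2 ^+ 2) <= a2 ^+ 2 + b2 ^+ 2 / CR ^+ 2.
  rewrite mulrDr; apply: lerD; first by rewrite ler_piMl ?sqr_ge0.
  by rewrite mulrC ler_wpM2l ?sqr_ge0.
have tb : b \in `[0, b] by rewrite in_itv/= lexx ltW.
have t0 : 0 \in `[0, b] by rewrite in_itv/= lexx ltW.
have g2 : `|inner (x b) r2| <= nx * `|r2|.
  by apply: le_trans (cauchy_schwarz _ _) _; rewrite ler_wpM2r // xn.
have g3 : `|inner (l 0) r4| <= nl * `|r4|.
  by apply: le_trans (cauchy_schwarz _ _) _; rewrite ler_wpM2r // ln.
rewrite E1 E2 Ea in eb; apply: le_trans g1 _.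
exact: energy_algebra eb Eq g2 g3 p3 p1.
Qed.

Hypotheses
  (nx_le : forall Q, 0 <= Q -> (forall t, t \in `[0, b] -> `|x t| <= Q) ->
    (L2sq 0%R b x <= (Q ^+ 2)%:E)%E -> nx <= Q)
  (nl_le : forall Q, 0 <= Q -> (forall t, t \in `[0, b] -> `|l t| <= Q) ->
    (L2sq 0%R b l <= (Q ^+ 2)%:E)%E -> nl <= Q).

Let C1_ge0 : 0 <= C1.
Proof. by rewrite !mulr_ge0 ?addr_ge0 ?invr_ge0 // ltW. Qed.

Let C2_ge0 : 0 <= C2.
Proof. by rewrite !mulr_ge0 ?addr_ge0 ?invr_ge0 ?divr_ge0 // ltW. Qed.

Let kappa_gt0 : 0 < kappa.
Proof. by rewrite lt_min ltr01 invr_gt0 exprn_gt0. Qed.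

Lemma optimality_constant_ge0 : 0 <= optimality_constant.
Proof.
by rewrite mulr_ge0 ?addr_ge0 // !mulr_ge0 ?addr_ge0 // invr_ge0 ltW.
Qed.

(** The two minimality hypotheses let [nx] and [nl] stand for the norms of the original solution,
    while [x] and [l] are its continuous extensions. *)
Lemma optimality_bound :
  nx + nl <= optimality_constant * (n1 + `|r2| + n3 + `|r4|).
Proof.
have [x1 x2] := state_estimate; have [l1 l2] := costate_estimate.
have a20 : 0 <= a2 by exact: sqrtr_ge0.
have b20 : 0 <= b2 by exact: sqrtr_ge0.
apply: (@optimality_algebra _ C2 C1 kappa nx nl `|r2| `|r4| n1 n3 a2 b2) => //.
- by apply: nx_le x1 x2; rewrite mulr_ge0 // !addr_ge0.
- by apply: nl_le l1 l2; rewrite mulr_ge0 // !addr_ge0.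
- exact: energy_estimate.
Qed.

End single_domain.

(** * Assembly of the uniform estimate *)

Lemma sqrt_sum_le (R : rcfType) (c nx nl p1 p2 p3 p4 : R) : 0 <= c ->
  0 <= nx -> 0 <= nl -> 0 <= p1 -> 0 <= p2 -> 0 <= p3 -> 0 <= p4 ->
  nx + nl <= c * (p1 + p2 + p3 + p4) ->
  Num.sqrt (nx ^+ 2 + nl ^+ 2) <=
  (2 * c + 1) * Num.sqrt (p1 ^+ 2 + p2 ^+ 2 + p3 ^+ 2 + p4 ^+ 2).
Proof.
move=> c0 nx0 nl0 p10 p20 p30 p40 h.
set q := p1 ^+ 2 + p2 ^+ 2 + p3 ^+ 2 + p4 ^+ 2.
have q0 : 0 <= q by rewrite !addr_ge0 ?sqr_ge0.
have s0 : 0 <= p1 + p2 + p3 + p4 by rewrite !addr_ge0.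
have g1 : Num.sqrt (nx ^+ 2 + nl ^+ 2) <= nx + nl.
  rewrite -[leRHS]ger0_norm ?addr_ge0 // -sqrtr_sqr ler_wsqrtr // sqrrD.
  have : 0 <= nx * nl by exact: mulr_ge0.
  by rewrite mulr2n; lra.
(* Comparison of the sum with the Euclidean norm of four components, at the cost of a factor 2. *)
have g2 : p1 + p2 + p3 + p4 <= 2 * Num.sqrt q.
  rewrite -(ler_pXn2r (n := 2)) ?nnegrE ?mulr_ge0 ?sqrtr_ge0 //.
  rewrite [leRHS]exprMn sqr_sqrtr //.
  have -> : 2 ^+ 2 = 4 :> R by rewrite expr2 -natrM.
  exact: ler_sqr_add4.
apply: le_trans g1 _; apply: le_trans h _.
apply: (@le_trans _ _ (2 * c * Num.sqrt q)); last first.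
  by rewrite ler_wpM2r ?sqrtr_ge0 // lerDl.
by rewrite [2 * c]mulrC -mulrA ler_wpM2l.
Qed.

Unset Implicit Arguments.

Theorem mainTheorem2
  (O : Type) (X U Y : O -> hilbertSpace)
  (D : forall o, set (X o)) (A : forall o, X o -> X o)
  (Dstar : forall o, set (X o)) (Astar : forall o, X o -> X o)
  (T Tstar : forall o, RR -> X o -> X o)
  (B : forall o, U o -> X o) (Bstar : forall o, X o -> U o)
  (C : forall o, X o -> Y o) (Cstar : forall o, Y o -> X o)
  (Rop : forall o, U o -> U o) (Rstar : forall o, U o -> U o)
  (Qinv : forall o, U o -> U o)
  (hT : forall o, C0_semigroup (T o))
  (hA : forall o, generates (T o) (D o) (A o))
  (hAstar : forall o, is_unbounded_adjoint (D o) (A o) (Dstar o) (Astar o))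
  (hTstar : forall o t, 0 <= t -> is_adjoint (T o t) (Tstar o t))
  (hB : forall o, bounded_linear (B o)) (hBstar : forall o, is_adjoint (B o) (Bstar o))
  (hC : forall o, bounded_linear (C o)) (hCstar : forall o, is_adjoint (C o) (Cstar o))
  (hR : forall o, bounded_linear (Rop o)) (hRstar : forall o, is_adjoint (Rop o) (Rstar o))
  (hQinv : forall o, (forall u, Qinv o (Rstar o (Rop o u)) = u) /\
                     (forall u, Rstar o (Rop o (Qinv o u)) = u))
  (hstab : du_stabilizable D A B)
  (hdet : du_stabilizable Dstar Astar Cstar)
  (CB CC CR alpha : RR) (hCB : 0 < CB) (hCC : 0 < CC) (hCR : 0 < CR) (halpha : 0 < alpha)
  (hBn : forall o, opnorm_le (B o) CB) (hCn : forall o, opnorm_le (C o) CC)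
  (hRn : forall o, opnorm_le (Rop o) CR)
  (hcoer : forall o (u : U o), alpha * `|u| ^+ 2 <= `|Rop o u| ^+ 2) :
  exists c : RR, 0 < c /\
    forall (Tf : RR), 0 < Tf -> forall o (r1 : RR -> X o) (r2 : X o) (r3 : RR -> X o) (r4 : X o)
      (x lam : RR -> X o),
      in_L1 0 Tf r1 -> in_L1 0 Tf r3 ->
      mild_solution (T o) (Tstar o) (B o) (Bstar o) (C o) (Cstar o) (Qinv o) Tf
        r1 r2 r3 r4 x lam ->
      Num.sqrt (norm_2inf 0 Tf x ^+ 2 + norm_2inf 0 Tf lam ^+ 2)
        <= c * Num.sqrt (norm_1v2 0 Tf r1 ^+ 2 + `|r2| ^+ 2 + norm_1v2 0 Tf r3 ^+ 2 + `|r4| ^+ 2).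
Proof.
case: hstab => K1 [bK1 [[cK1 nK1] [S1 [hS1 [gS1 [M1 [k1 [M10 [k10 sS1]]]]]]]]].
case: hdet => K2 [bK2 [[cK2 nK2] [S2 [hS2 [gS2 [M2 [k2 [M20 [k20 sS2]]]]]]]]].
(* The feedback bounds come without a sign, whereas the single-domain estimate takes nonnegative
   ones. *)
have abs_bound (V W : hilbertSpace) (F : V -> W) (c : RR) : opnorm_le F c -> opnorm_le F `|c|.
  by move=> h v; apply: le_trans (h v) _; rewrite ler_wpM2r // ler_norm.
pose c := optimality_constant CB CC CR alpha `|cK1| M1 k1 `|cK2| M2 k2.
have c0 : 0 <= c by apply: optimality_constant_ge0.
(* [c] is only known to be nonnegative; adding 1 makes the constant positive. *)
exists (2 * c + 1); split; first by rewrite ltr_wpDl // mulr_ge0.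
move=> Tf Tf0 o r1 r2 r3 r4 x lam L1r1 L1r3 [wx [wl [ex el]]].
have [r1' [i1 E1 p1 h1 rep1]] := borel_representative L1r1.
have [r3' [i3 E3 p3 h3 rep3]] := borel_representative L1r3.
rewrite E1 E3.
pose y := x \o clamp Tf; pose l := lam \o clamp Tf.
have cy : continuous y by exact: continuous_comp_clamp (ltW Tf0) wx.
have cl : continuous l by exact: continuous_comp_clamp (ltW Tf0) wl.
have xy t : t \in `[0, Tf] -> x t = y t by move=> tT; rewrite /y /= clamp_id.
have ll t : t \in `[0, Tf] -> lam t = l t by move=> tT; rewrite /l /= clamp_id.
have [nx0 xn xn2] := norm_2inf_bounds Tf0 cy xy.
have [nl0 ln ln2] := norm_2inf_bounds Tf0 cl ll.
have hx : mild (Tstar o) Tf y r4 (fun s => B o (Qinv o (Bstar o (l s))) + r3' s).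
  move=> t tT z; have /andP[t0 tT'] : 0 <= t <= Tf by move: tT; rewrite in_itv.
  (* The semigroup moves onto the test vector, and [r3] is replaced by its Borel version under the
     integral. *)
  rewrite -xy // ex // hTstar //; congr (_ + _); apply: rep3 => s.
  rewrite /= in_itv/= => /andP[s0 st].
  have sT : s \in `[0, Tf] by rewrite in_itv/= s0 (le_trans st).
  by split=> // ->; rewrite ll // hTstar // subr_ge0.
have hl t : t \in `[0, Tf] -> forall z, inner (l t) z = inner r2 (T o (Tf - t) z) +
    Rintegral leb `[t, Tf] (fun s => inner (r1' s - Cstar o (C o (y s))) (T o (s - t) z)).
  move=> tT z; have /andP[t0 tT'] : 0 <= t <= Tf by move: tT; rewrite in_itv.
  have adj u v w : 0 <= u -> inner (Tstar o u v) w = inner v (T o u w).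
    by move=> u0; rewrite inner_sym -hTstar // inner_sym.
  rewrite -ll // el // adj ?subr_ge0 //; congr (_ + _); apply: rep1 => s.
  rewrite /= in_itv/= => /andP[ts sT'].
  have sT : s \in `[0, Tf] by rewrite in_itv/= sT' (le_trans t0).
  by split=> // ->; rewrite xy // adj // subr_ge0.
have [hQ1 hQ2] := hQinv o.
have bnd : norm_2inf 0 Tf x + norm_2inf 0 Tf lam <=
    c * (norm_1v2 0 Tf r1' + `|r2| + norm_1v2 0 Tf r3' + `|r4|).
  apply: (optimality_bound (hT o) (hA o) (hAstar o) (hTstar o) (hB o) (hBstar o)
    (hC o) (hCstar o) (hR o) (hRstar o) hQ1 hQ2 hCB hCC hCR halpha (hBn o) (hCn o) (hRn o)
    (hcoer o) (bK1 o) (abs_bound _ _ _ _ (nK1 o)) (normr_ge0 cK1) (hS1 o) (gS1 o) M10 k10 (sS1 o)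
    (bK2 o) (abs_bound _ _ _ _ (nK2 o)) (normr_ge0 cK2) (hS2 o) (gS2 o) M20 k20 (sS2 o)
    Tf0 cy cl i1 i3 p1 p3 h1 h3 hx hl nx0 nl0 xn xn2 ln ln2).
  - move=> Q Q0 yQ y2; apply: norm_2inf_le => // [t tT|]; first by rewrite xy // yQ.
    by apply: le_trans y2; rewrite le_eqVlt; apply/orP; left; apply/eqP;
      apply: eq_integral => s /set_mem sT; rewrite xy.
  - move=> Q Q0 lQ l2; apply: norm_2inf_le => // [t tT|]; first by rewrite ll // lQ.
    by apply: le_trans l2; rewrite le_eqVlt; apply/orP; left; apply/eqP;
      apply: eq_integral => s /set_mem sT; rewrite ll.
move: nx0 nl0 p1 p3 bnd.
move: (norm_2inf 0 Tf x) (norm_2inf 0 Tf lam) (norm_1v2 0 Tf r1') (norm_1v2 0 Tf r3') => nx nl n1 n3.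
move=> nx0 nl0 n10 n30 bnd.
exact: (sqrt_sum_le c0 nx0 nl0 n10 (normr_ge0 r2) n30 (normr_ge0 r4) bnd).
Qed.
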